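(* Let $W:\mathcal{X}\to\mathcal{P}(\mathcal{Y})$ be a channel, $M,L,n\in\mathbb{Z}_+$, and $P\in\mathcal{P}(\mathcal{X})$ a finitely supported distribution with $nP(x)\in\mathbb{Z}_{\ge0}$ for all $x$, such that $$I_1(P;W)<\tfrac1n\ln\tfrac ML<\lim_{\alpha\uparrow\infty} I_1\big(P;W_\alpha^{q_{\alpha,P}}\big).$$ Let $R=\frac1n\ln\frac ML$ and $\alpha^*=\frac{1}{1-E_{sc}'(R,W,P)}$, where $E_{sc}'$ is the derivative of $E_{sc}(\cdot,W,P)$ with respect to the rate. Then $\alpha^*\in(1,\infty)$ and $I_1\big(P;W_{\alpha^*}^{q_{\alpha^*,P}}\big)=R$. Moreover, every $(M,L)$ list code of block length $n$ on the stationary product channel $W^{\otimes n}$ whose codewords all have composition $P$ has average error probability satisfying $$P_e^{(n)}\ge 1-2e^{\alpha^*}\Big(\frac{\hat\delta}{\alpha^*-1}\Big)^{1/\alpha^*} n^{-\frac{1}{2\alpha^*}}e^{-nE_{sc}(R,W,P)},$$ where, writing $q=q_{\alpha^*,P}$, $V(x)=W_{\alpha^*}^{q}(x)$ and $\ell_x=\ln\frac{dW(x)_{ac}}{dq}$ (with $W(x)_{ac}$ the part of $W(x)$ absolutely continuous w.r.t. $q$), $$a_2=\sum_x P(x)\,\mathbb{E}_{V(x)}\big[|\ell_x-\mathbb{E}_{V(x)}[\ell_x]|^2\big],\quad a_3=\sum_x P(x)\,\mathbb{E}_{V(x)}\big[|\ell_x-\mathbb{E}_{V(x)}[\ell_x]|^3\big],\quad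 \hat\delta=\frac{1}{e\sqrt{a_2}}\Big(\frac{1}{\sqrt{2\pi}}+2\frac{0.56\,a_3}{a_2}\Big)$$ (assuming $a_2>0$).
   Context: A channel is a map $W:\mathcal{X}\to\mathcal{P}(\mathcal{Y})$ into probability measures on a measurable space $(\mathcal{Y},\mathcal{B})$; $\mathcal{P}(\mathcal{X})$ denotes finitely supported probability mass functions on $\mathcal{X}$. Rényi divergence: $D_\alpha(W\|Q)=\frac{1}{\alpha-1}\ln\int (\frac{dW}{d\nu})^\alpha(\frac{dQ}{d\nu})^{1-\alpha}d\nu$ ($\alpha\ne1$), $D_1(W\|Q)=\int \frac{dW}{d\nu}[\ln\frac{dW}{d\nu}-\ln\frac{dQ}{d\nu}]d\nu$. Conditional Rényi divergence: $D_\alpha(W\|Q|P)=\sum_x P(x)D_\alpha(W(x)\|Q)$. Augustin information: $I_\alpha(P;W)=\inf_{Q}D_\alpha(W\|Q|P)$ over probability measures $Q$ on $\mathcal{Y}$; the infimum is attained by a unique measure $q_{\alpha,P}$, the Augustin mean. Tilted measures: for probability measures $W,Q$, with $W_{ac}$ the part of $W$ absolutely continuous w.r.t. $Q$, $W_1^Q=W_{ac}/\|W_{ac}\|$, and for $\alpha>0$ with $D_\alpha(W_1^Q\|Q)<\infty$, $\frac{dW_\alpha^Q}{dQ}=e^{(1-\alpha)D_\alpha(W_1^Q\|Q)}(\frac{dW_1^Q}{dQ})^\alpha$. The tilted channel $W_\alpha^{q_{\alpha,P}}$ maps $x$ to the order-$\alpha$ tilted measure between $W(x)$ and $q_{\alpha,P}$;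 $I_1(P;V)$ for a channel $V$ is the order-1 Augustin information (mutual information). Strong converse exponent: $E_{sc}(R,W,P)=\sup_{\alpha\in(1,\infty)}\frac{1-\alpha}{\alpha}(I_\alpha(P;W)-R)$. An $(M,L)$ code of length $n$ consists of an encoder $\Psi:\{1,\dots,M\}\to\mathcal{X}^n$ and a measurable decoder $\Theta$ from $\mathcal{Y}^n$ to subsets of $\{1,\dots,M\}$ of size at most $L$; $P_e^{(n)}=\frac1M\sum_m W^{\otimes n}(\Psi(m))(\{y: m\notin\Theta(y)\})$, where $W^{\otimes n}(x_1^n)=\bigotimes_t W(x_t)$. A codeword $x_1^n$ has composition $P$ if its empirical distribution equals $P$. *)

(* Defs.v *)
From HB Require Import structures.
From mathcomp Require Import all_boot all_order all_algebra.
From mathcomp Require Import mathcomp_extra boolp classical_sets functions.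
From mathcomp Require Import cardinality fsbigop reals ereal topology.
From mathcomp Require Import normedtype sequences esum measure.
From mathcomp Require Import measurable_realfun numfun lebesgue_measure.
From mathcomp Require Import lebesgue_integral charge exp trigo derive realfun.
From mathcomp Require Import probability.
Set Implicit Arguments. Unset Strict Implicit. Unset Printing Implicit Defensive.
Import Order.TTheory GRing.Theory Num.Theory.
Import numFieldNormedType.Exports.
Local Open Scope classical_set_scope.
Local Open Scope ring_scope.

Section mdens.
Local Open Scope ereal_scope.
Context d (T : measurableType d) (R : realType) (mu : {measure set T -> \bar R})
  (h : T -> \bar R).
Definition dens_guard : T -> \bar R :=
  if pselect (measurable_fun setT h /\ forall y, 0 <= h y) then h else cst 0.
Lemma dens_guardP : measurable_fun setT dens_guard /\ forall y, 0 <= dens_guard y.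
Proof.
by rewrite /dens_guard; case: pselect => // _; split.
Qed.
Definition mdens (A : set T) : \bar R := \int[mu]_(y in A) dens_guard y.
Let mdens0 : mdens set0 = 0.
Proof. by rewrite /mdens integral_set0. Qed.
Let mdens_ge0 A : 0 <= mdens A.
Proof. by apply: integral_ge0 => y _; case: dens_guardP. Qed.
Let mdens_ssa : semi_sigma_additive mdens.
Proof. by case: dens_guardP => m p; exact: semi_sigma_additive_nng_induced. Qed.
HB.instance Definition _ := isMeasure.Build _ _ _ mdens mdens0 mdens_ge0 mdens_ssa.
End mdens.

Section defs.
Local Open Scope ereal_scope.
Context d (Y : measurableType d) (R : realType).
Implicit Types (mu W Q : {measure set Y -> \bar R}).

Definition is_dens mu W (f : Y -> \bar R) :=
  [/\ measurable_fun setT f, (forall y, 0 <= f y) &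
      forall A, measurable A -> W A = \int[mu]_(y in A) f y].

Definition dens mu W : Y -> \bar R :=
  match pselect (exists f, is_dens mu W f) with
  | left h => sval (cid h)
  | right _ => cst 0
  end.

Definition eln (z : \bar R) : \bar R :=
  match z with
  | r%:E => if (0 < r)%R then (ln r)%:E else -oo
  | +oo => +oo
  | -oo => -oo
  end.

(** integrand of the Renyi integral, (dW/dnu)^a (dQ/dnu)^(1-a),
    with 0^(1-a) = +oo for a > 1 and 0 * +oo = 0 *)
Definition renyi_integrand (a : R) (f g : R) : \bar R :=
  if (0 < g)%R then ((f `^ a) * (g `^ (1 - a)))%:E
  else if ((0 < f) && (1 < a))%R then +oo else 0.

(** integrand of the order-1 divergence, f (ln f - ln g), with 0 ln 0 = 0 and
    f ln (f/0) = +oo for f > 0 *)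
Definition kl_integrand (f g : R) : \bar R :=
  if (0 < f)%R then (if (0 < g)%R then (f * (ln f - ln g))%:E else +oo) else 0.

Definition renyi (a : R) W Q : \bar R :=
  let nu := measure_add W Q in
  let f := dens nu W in let g := dens nu Q in
  if a == 1%R then \int[nu]_y kl_integrand (fine (f y)) (fine (g y))
  else ((a - 1)^-1)%:E * eln (\int[nu]_y renyi_integrand a (fine (f y)) (fine (g y))).

Variable X : choiceType.
Definition is_fpmf (P : X -> R) (S : seq X) :=
  [/\ uniq S, (forall x, x \notin S -> P x = 0%R), (forall x, (0 <= P x)%R) &
      (\sum_(x <- S) P x = 1)%R].

Definition renyi_cond (a : R) (W : X -> {measure set Y -> \bar R}) Q
  (P : X -> R) (S : seq X) : \bar R :=
  \sum_(x <- S) (P x)%:E * renyi a (W x) Q.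

Definition augustin_info (a : R) (W : X -> {measure set Y -> \bar R})
  (P : X -> R) (S : seq X) : \bar R :=
  ereal_inf [set renyi_cond a W Q P S | Q in [set: probability Y R]].

Definition is_augustin_mean (a : R) (W : X -> {measure set Y -> \bar R})
  (P : X -> R) (S : seq X) (q : probability Y R) :=
  renyi_cond a W q P S = augustin_info a W P S.

(** d W_ac / d Q, where W_ac is the part of W absolutely continuous w.r.t. Q,
    computed from densities w.r.t. nu = W + Q *)
Definition ac_dens W Q : Y -> \bar R :=
  let nu := measure_add W Q in
  fun y => let f := fine (dens nu W y) in let g := fine (dens nu Q y) in
    if (0 < g)%R then (f / g)%:E else 0.

Definition tilt1 W Q : {measure set Y -> \bar R} :=
  mdens Q (fun y => ac_dens W Q y * ((fine (\int[Q]_z ac_dens W Q z))^-1)%:E).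

Definition tilted (a : R) W Q : {measure set Y -> \bar R} :=
  mdens Q (fun y => (expR ((1 - a) * fine (renyi a (tilt1 W Q) Q)) *
                     (fine (dens Q (tilt1 W Q) y)) `^ a)%:E).

Definition Esc (W : X -> {measure set Y -> \bar R}) (P : X -> R) (S : seq X)
  (r : R) : \bar R :=
  ereal_sup [set ((1 - a) / a)%:E * (augustin_info a W P S - r%:E)
            | a in `]1%R, +oo[%classic].

(** value of the product measure (m_1 x ... x m_k) on a function of
    (y_1, ..., y_k), as iterated integral *)
Fixpoint iprod_int (ms : seq {measure set Y -> \bar R}) (f : seq Y -> \bar R)
  : \bar R :=
  match ms with
  | [::] => f [::]
  | m :: ms' => \int[m]_y iprod_int ms' (fun s => f (y :: s))
  end.

Definition prod_chan (n : nat) (W : X -> {measure set Y -> \bar R})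
  (x : n.-tuple X) (E : set (n.-tuple Y)) : \bar R :=
  iprod_int [seq W xi | xi <- x]
    (fun s => match insub s with Some t => (\1_E t)%:E | None => 0 end).

Definition avg_error (n M : nat) (W : X -> {measure set Y -> \bar R})
  (enc : 'I_M -> n.-tuple X) (dec : n.-tuple Y -> {set 'I_M}) : \bar R :=
  ((M%:R)^-1)%:E *
  \sum_(m < M) prod_chan W (enc m) [set y | m \notin dec y].

Definition has_composition (n : nat) (x : n.-tuple X) (P : X -> R) :=
  forall z, P z = ((count_mem z x)%:R / n%:R)%R.

End defs.

(* Main.v *)
(** With [rho = (a - 1) / a] and [g rho = rho * I_a(P; W)], the exponent [Esc] is
    the convex conjugate of [g] on [0, 1]. Perturbing the Augustin mean [q] of
    order [a] shows the fixed point equation [sum_x P(x) W_a^q(x) = q]; testing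
    [D_b(W | Q | P)] against the tilted channel then gives
    [g rho' >= g rho + (rho' - rho) I_1(P; W_a^q)], with a matching second order
    upper bound because the densities [dW(x)/dq] are bounded. So
    [I_1(P; W_a^q)] is the slope of [g] at [rho], the maximiser [rho] of
    [rho r - g rho] is where this slope equals [r], and [Esc' r = rho].

    For the error bound, the density [f] of the output of a codeword satisfies
    [1_A f <= e^tau 1_A + f 1{f > e^tau}]. Summed over the messages the first
    term contributes at most [e^tau L / M]. Under the tilted product measure the
    second one is [E[e^{-s (S - t)} 1{S >= t}]] with [s = a - 1], for a sum [S]
    of [n] centred independent variables. Instead of the Berry-Esseen theorem,
    this expectation is bounded directly: smoothing with a Fejer kernel only
    involves the characteristic function of [S] at frequencies [<= 0.54 a2 / a3],
    where it is at most [e^{-0.32 n a2 v^2}]. Optimising over [tau] and comparing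
    numerical constants yields the stated bound. *)
Require Import Defs.
From HB Require Import structures.
From mathcomp Require Import all_boot all_order all_algebra.
From mathcomp Require Import mathcomp_extra boolp classical_sets functions.
From mathcomp Require Import cardinality fsbigop reals ereal topology.
From mathcomp Require Import normedtype sequences esum measure.
From mathcomp Require Import measurable_realfun numfun lebesgue_measure.
From mathcomp Require Import lebesgue_integral charge exp trigo derive realfun.
From mathcomp Require Import probability.
From mathcomp Require Import gauss_integral ftc.
From mathcomp Require Import ring lra.
Set Implicit Arguments.
Unset Strict Implicit.
Unset Printing Implicit Defensive.
Import Order.TTheory GRing.Theory Num.Theory.
Import numFieldNormedType.Exports.
Local Open Scope classical_set_scope.
Local Open Scope ring_scope.

(** * Real inequalities *)

(** Continuity in [a] of the Augustin mean or of [I_1(P; W_a^q)] is never established.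
    Differentiability of the exponent rests on pointwise facts instead: a supporting line of [g] at
    every [rho], a quadratic upper bound that forces the slope at the maximiser to be the rate, and
    strictness of the supporting line there. Strictness comes from the equality case of the
    variational bound: it would make the tilted channel equal to [W], against [I_1(P; W) < R]. The
    densities [f_i] are bounded because the fixed point equation gives [p_i v_i <= 1] with [v_i]
    proportional to [f_i^a]. The smoothing estimate has constants far larger than those of the
    claim: [sqrt (2 pi) / 3.6] against [1 / sqrt (2 pi)], and about [7.7] against [1.12] in front of
    [lam = a3 / a2]. The loss is affordable since the prefactor [2 e^a] enters the optimisation with
    the exponent [a], which leaves a spare factor [(2 - e^-c) e^((2 - c) s + s^2)] for [s = a - 1]
    and any [c >= 0]. *)

Section real_inequalities.
Context {R : realType}.
Implicit Types x y s t p : R.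

(** Integrates an inequality from [0]; iterating it from [cos <= 1] produces the Taylor bounds
    below. *)
Lemma le_from0_derive (f df : R -> R) x :
  (forall t, is_derive t (1 : R) f (df t)) ->
  (forall t, 0 <= t -> 0 <= df t) -> 0 <= x -> f 0 <= f x.
Proof.
move=> fdf df0 x0.
have df1 t : derive1 f t = df t by rewrite derive1E; apply: derive_val.
apply: (@ger0_derive1_le_cc _ f 0 x) => //.
- by move=> t; rewrite in_itv/= => /andP[/ltW t0 _]; rewrite df1 df0.
- apply: continuous_subspaceT => t.
  exact/differentiable_continuous/derivable1_diffP.
- by rewrite in_itv/= lexx.
- by rewrite in_itv/= x0 lexx.
Qed.

Lemma sin_le_id x : 0 <= x -> sin x <= x.
Proof.
move=> x0; have := @le_from0_derive (fun t => t - sin t) (fun t => 1 - cos t) x.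
rewrite sin0 subrr subr_ge0; exact.
Qed.

Lemma cos_ge_quad x : 1 - x ^+ 2 / 2 <= cos x.
Proof.
wlog x0 : x / 0 <= x.
  move=> H; have [/H//|/ltW x0] := leP 0 x.
  by rewrite -cosN -sqrrN; apply: H; rewrite oppr_ge0.
have := @le_from0_derive (fun t => cos t - 1 + t ^+ 2 / 2) (fun t => t - sin t) x.
rewrite cos0 subrr expr0n/= mul0r addr0 => H.
suff : 0 <= cos x - 1 + x ^+ 2 / 2 by lra.
apply: H => // t; last by move=> t0; rewrite subr_ge0 sin_le_id.
by apply: is_derive_eq; rewrite /GRing.scale/=; field.
Qed.

Lemma sin_ge_cubic x : 0 <= x -> x - x ^+ 3 / 6 <= sin x.
Proof.
move=> x0.
have := @le_from0_derive (fun t => sin t - t + t ^+ 3 / 6)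
  (fun t => cos t - 1 + t ^+ 2 / 2) x.
rewrite sin0 subrr expr0n/= mul0r addr0 => H.
suff : 0 <= sin x - x + x ^+ 3 / 6 by lra.
apply: H => // t; last by have := cos_ge_quad t; lra.
by apply: is_derive_eq; rewrite /GRing.scale/=; field.
Qed.

Lemma cos_le_quartic x : cos x <= 1 - x ^+ 2 / 2 + x ^+ 4 / 24.
Proof.
wlog x0 : x / 0 <= x.
  move=> H; have [/H//|/ltW x0] := leP 0 x.
  rewrite -cosN; have := H (- x); rewrite oppr_ge0 => /(_ x0) /le_trans; apply.
  by rewrite le_eqVlt; apply/orP; left; apply/eqP; ring.
have := @le_from0_derive (fun t => 1 - t ^+ 2 / 2 + t ^+ 4 / 24 - cos t)
  (fun t => sin t - t + t ^+ 3 / 6) x.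
rewrite cos0 !expr0n/= !mul0r subr0 addr0 subrr => H.
suff : 0 <= 1 - x ^+ 2 / 2 + x ^+ 4 / 24 - cos x by lra.
apply: H => // t; last by move=> /sin_ge_cubic; lra.
by apply: is_derive_eq; rewrite /GRing.scale/=; field.
Qed.

(** The quartic bound is enough up to [4], and beyond [3] the right-hand side is at least [1]. The
    cubic remainder is the one that pairs with third absolute moments. *)
Lemma cos_le_cubic x : cos x <= 1 - x ^+ 2 / 2 + `|x| ^+ 3 / 6.
Proof.
rewrite -cos_norm -(real_normK (num_real x)).
have : 0 <= `|x| by []; move: `|x| => y y0.
have [y4|y4] := leP y 4.
  apply: le_trans (cos_le_quartic y) _.
  suff : 0 <= y ^+ 3 * (4 - y) by lra.
  by rewrite mulr_ge0 ?exprn_ge0// subr_ge0.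
apply: le_trans (cos_le1 y) _.
suff : 0 <= y ^+ 2 * (y - 3) by lra.
by rewrite mulr_ge0 ?exprn_ge0//; lra.
Qed.

(** The quartic bound makes [cos (8 / 5)] negative. The value is what [balancing_constant] consumes,
    in the form [2 pi <= (18 / 5) (16 / 9)]. *)
Lemma pi_le_16_5 : pi <= 16 / 5 :> R.
Proof.
rewrite leNgt; apply/negP => h.
have c : 0 < cos (8 / 5 : R) by apply: cos_gt0_pihalf; apply/andP; split; lra.
by have := cos_le_quartic (8 / 5 : R); lra.
Qed.

End real_inequalities.

(** * Optimisation of the threshold and comparison of the numerical constants *)

Section balancing.
Context {R : realType}.
Implicit Types x y s t p c lam : R.

Lemma expR_ge_taylor4 x : 0 <= x ->
  1 + x + x ^+ 2 / 2 + x ^+ 3 / 6 + x ^+ 4 / 24 <= expR x.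
Proof.
have step (f g : R -> R) : (forall t, is_derive t (1 : R) g (f t)) -> g 0 = 1 ->
    (forall t, 0 <= t -> f t <= expR t) -> forall t, 0 <= t -> g t <= expR t.
  move=> gf g0 fe t t0.
  have := @le_from0_derive R (fun u => expR u - g u) (fun u => expR u - f u) t.
  rewrite g0 expR0 subrr subr_ge0; apply => // u u0.
  by rewrite subr_ge0 fe.
move: x; pose f1 t : R := 1 + t; pose f2 t : R := 1 + t + t ^+ 2 / 2.
pose f3 t : R := 1 + t + t ^+ 2 / 2 + t ^+ 3 / 6.
apply: (step f3) => [t||].
- by apply: is_derive_eq; rewrite /f3 /GRing.scale/=; field.
- by rewrite !expr0n/= !mul0r !addr0.
apply: (step f2) => [t||].
- by apply: is_derive_eq; rewrite /f2 /GRing.scale/=; field.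
- by rewrite /f3 !expr0n/= !mul0r !addr0.
apply: (step f1) => [t||t _]; last exact: expR_ge1Dx.
- by apply: is_derive_eq; rewrite /f1 /GRing.scale/=; field.
- by rewrite /f2 !expr0n/= !mul0r !addr0.
Qed.

Lemma sqrt_2pi_le : Num.sqrt (2 * pi) <= 38 / 15 :> R.
Proof.
have -> : (38 / 15 : R) = Num.sqrt ((38 / 15) ^+ 2).
  by rewrite sqrtr_sqr ger0_norm//; lra.
by rewrite ler_wsqrtr//; have := @pi_le_16_5 R; lra.
Qed.

(** The left side is [s] times the constant of the smoothing estimate; the right side is the
    constant of the theorem times the spare factor. The terms free of [lam] and linear in [lam] are
    compared separately, which leaves two inequalities in [s] alone. *)
Lemma balancing_constant s lam : 0 < s -> 0 <= lam ->
  exists2 c, 0 <= c &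
   Num.sqrt (2 * pi) / (18 / 5) * (1 + 100 / 9 * (s * lam)) <=
   ((Num.sqrt (2 * pi))^-1 + 2 * ((56 / 100) * lam)) *
     ((2 - expR (- c)) * expR ((2 - c) * s + s ^+ 2)).
Proof.
move=> s0 lam0; set q := Num.sqrt (2 * pi).
have q0 : 0 < q by rewrite sqrtr_gt0 mulr_gt0// pi_gt0.
have qle : q <= 38 / 15 := sqrt_2pi_le.
have qq : q / (18 / 5) <= q^-1 * (16 / 9).
  rewrite ler_pdivlMl// mulrA -expr2 sqr_sqrtr ?mulr_ge0 ?pi_ge0//.
  by have := @pi_le_16_5 R; lra.
suff [c c0 [h1 h2]] : exists2 c, 0 <= c &
    16 / 9 <= (2 - expR (- c)) * expR ((2 - c) * s + s ^+ 2) /\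
    38 / 15 / (18 / 5) * (100 / 9) * s <=
      28 / 25 * ((2 - expR (- c)) * expR ((2 - c) * s + s ^+ 2)).
  exists c => //; move: h1 h2; set Psi := _ * expR _ => h1 h2.
  rewrite [X in X <= _]mulrDr mulr1 [X in _ <= X]mulrDl lerD//.
    by apply: le_trans qq _; rewrite ler_wpM2l// invr_ge0 ltW.
  have -> : 2 * (56 / 100 * lam) * Psi = lam * (28 / 25 * Psi) by field.
  have -> : q / (18 / 5) * (100 / 9 * (s * lam)) =
            lam * (q * s) * (250 / 81) by field.
  apply: le_trans (_ : lam * (38 / 15 / (18 / 5) * (100 / 9) * s) <= _).
    have : q * s <= 38 / 15 * s by rewrite ler_wpM2r// ltW.
    move=> qs; have : lam * (q * s) <= lam * (38 / 15 * s) by rewrite ler_wpM2l.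
    lra.
  by rewrite ler_wpM2l.
(* For small [s] only [2 - e^-c] helps and must exceed [16 / 9], hence a large [c]. For larger [s]
   the exponential has to dominate a linear function of [s], hence a small [c]. *)
have [s28|s28] := leP s (5 / 18).
  exists 2 => //.
  have e2 : expR (- 2) <= 9 / 64 :> R.
    have := @expR_ge_taylor4 1 ler01; set e := expR 1 => e1.
    have ee : expR (- 2) * (e * e) = 1.
      by rewrite /e -!expRD (_ : -2 + _ = 0) ?expR0//; ring.
    have : 0 < expR (- 2) :> R by exact: expR_gt0.
    have : 64 / 9 <= e * e.
      have -> : 64 / 9 = (8 / 3) * (8 / 3) :> R by lra.
      by apply: ler_pM => //; lra.
    move=> h1 h2.
    have := ler_wpM2l (ltW h2) h1; rewrite ee; lra.
  have e3 : 1 + s ^+ 2 <= expR ((2 - 2) * s + s ^+ 2).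
    by rewrite subrr mul0r add0r expR_ge1Dx.
  have s2 : 0 <= s ^+ 2 by rewrite exprn_ge0// ltW.
  have h : 119 / 64 * (1 + s ^+ 2) <=
      (2 - expR (- 2)) * expR ((2 - 2) * s + s ^+ 2).
    apply: ler_pM => //; lra.
  split; first lra.
  (* Both factors are nonpositive. *)
  suff : 0 <= (s - 5 / 18) * (s - 5 / 18 - 4) by nra.
  by rewrite nmulr_lge0; lra.
exists 2^-1; first by lra.
have e2 : expR (- 2^-1) <= 17 / 28 :> R.
  have /expR_ge_taylor4 : 0 <= 2^-1 :> R by lra.
  have : expR (- 2^-1) * expR 2^-1 = 1 :> R by rewrite -expRD addNr expR0.
  have : 0 < expR (- 2^-1) :> R by exact: expR_gt0.
  nra.
(* Tangent of the square at [2 / 5], to make the exponent affine in [s]. *)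
have s2 : 4 / 5 * s - 4 / 25 <= s ^+ 2 by have := sqr_ge0 (s - 2 / 5); nra.
have e3 : expR (23 / 10 * s - 4 / 25) <= expR ((2 - 2^-1) * s + s ^+ 2).
  by rewrite ler_expR; lra.
have e4 : 23 / 10 * s * (23 / 10) <= expR (23 / 10 * s - 4 / 25).
  have -> : 23 / 10 * s - 4 / 25 = (23 / 10 * s - 1) + 21 / 25 by lra.
  have p1 : 0 <= 23 / 10 * s by lra.
  rewrite expRD; apply: ler_pM => //.
    by apply: le_trans (expR_ge1Dx _); lra.
  have /expR_ge_taylor4 : 0 <= 21 / 25 :> R by lra.
  lra.
have e5 : 7 / 5 <= expR ((2 - 2^-1) * s + s ^+ 2).
  apply: le_trans (_ : expR (2 / 5) <= _).
    by apply: le_trans (expR_ge1Dx _); lra.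
  by rewrite ler_expR; lra.
have e6 : 39 / 28 <= 2 - expR (- 2^-1) :> R by lra.
have h1 : 39 / 28 * (7 / 5) <= (2 - expR (- 2^-1)) * expR ((2 - 2^-1) * s + s ^+ 2).
  by apply: ler_pM => //; lra.
have h2 : 39 / 28 * (23 / 10 * s * (23 / 10)) <=
    (2 - expR (- 2^-1)) * expR ((2 - 2^-1) * s + s ^+ 2).
  by apply: ler_pM => //; lra.
by split; lra.
Qed.

(* Evaluated at the multiple [e^-c / 2] of the right-hand side. *)
Lemma balancing s lam sB E p : 0 < s -> 0 <= lam -> 0 < sB ->
  (forall x, 0 < x -> p <= x + x `^ (- s) *
    (Num.sqrt (2 * pi) / (18 / 5) * (s^-1 + 100 / 9 * lam) / sB
     * expR (- ((1 + s) * E)))) ->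
  p <= 2 * expR (1 + s) *
    ((expR 1 * sB)^-1 * ((Num.sqrt (2 * pi))^-1 + 2 * ((56 / 100) * lam)) / s)
      `^ ((1 + s)^-1) * expR (- E).
Proof.
move=> s0 lam0 sB0 H.
have [c c0 hc] := balancing_constant s0 lam0.
set K := _^-1 + _ in hc *; set D := _ / s in H *.
have q0 : 0 < Num.sqrt (2 * pi) :> R by rewrite sqrtr_gt0 mulr_gt0// pi_gt0.
have K0 : 0 < K by rewrite ltr_wpDr ?invr_gt0// mulr_ge0// mulr_ge0//; lra.
have D0 : 0 < D by rewrite !mulr_gt0 ?invr_gt0// mulr_gt0// expR_gt0.
set T := _ * expR (- E).
have T0 : 0 < T by rewrite !mulr_gt0 ?expR_gt0 ?powR_gt0.
have al0 : 1 + s != 0 by lra.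
have lnT : ln T = ln 2 + (1 + s) + (1 + s)^-1 * ln D - E.
  have -> : T = expR (ln 2 + (1 + s) + (1 + s)^-1 * ln D - E).
    by rewrite /T expRB !expRD lnK ?posrE// [in RHS]mulrC; rewrite /powR gt_eqF// expRN; ring.
  by rewrite expRK.
have ec1 : expR (- c) <= 1 by rewrite expR_le1; lra.
have ec0 : 0 < expR (- c) := expR_gt0 _.
have x0 : 0 < expR (- c) / 2 * T by rewrite mulr_gt0 ?divr_gt0.
apply: le_trans (H _ x0) _.
suff h : (expR (- c) / 2 * T) `^ (- s) *
    (Num.sqrt (2 * pi) / (18 / 5) * (s^-1 + 100 / 9 * lam) / sB
     * expR (- ((1 + s) * E))) <= (1 - expR (- c) / 2) * T by lra.
rewrite {1}/powR gt_eqF// lnM ?posrE ?divr_gt0// lnM ?posrE ?invr_gt0//.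
rewrite expRK lnV ?posrE//.
have -> : Num.sqrt (2 * pi) / (18 / 5) * (s^-1 + 100 / 9 * lam) / sB =
    Num.sqrt (2 * pi) / (18 / 5) * (1 + 100 / 9 * (s * lam)) / (s * sB).
  by field; rewrite ?gt_eqF.
(* By [lnT], the power [T^(1 + s)] is [(2 e^(1 + s))^(1 + s) K / (e sB s)] times [e^(-(1 + s) E)].
   Hence [T^-s e^(-(1 + s) E)] is a multiple of [T], and the factor [(e^-c / 2)^-s] completes the
   exponent to [(2 - c) s + s^2]. *)
have key : expR (- s * (- c - ln 2 + ln T)) * expR (- ((1 + s) * E)) =
    s * sB / K / 2 * expR (- ((2 - c) * s + s ^+ 2)) * T.
  have -> : s * sB / K / 2 = expR (- 1 - ln D - ln 2).
    rewrite !expRD !expRN !lnK ?posrE//.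
    by rewrite /D; field; rewrite ?gt_eqF// expR_gt0.
  rewrite -[X in _ = _ * X](lnK (x := T)) ?posrE// -!expRD; congr expR.
  by rewrite lnT; field.
set A := _ / (18 / 5) * _ in hc *; set e1 := expR (- s * _) in key *; set e2 := expR (- ((1 + s) * E)) in key *.
have -> : e1 * (A / (s * sB) * e2) = A / K / 2 * expR (- ((2 - c) * s + s ^+ 2)) * T.
  have -> : e1 * (A / (s * sB) * e2) = A / (s * sB) * (e1 * e2) by ring.
  by rewrite key; field; rewrite ?gt_eqF.
rewrite ler_pM2r// expRN ler_pdivrMr ?expR_gt0// ler_pdivrMr// ler_pdivrMr//.
by apply: le_trans hc _; rewrite le_eqVlt; apply/orP; left; apply/eqP; field.
Qed.

End balancing.

(** * Densities and Renyi divergences *)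

Section measure_copies.
Context d (Y : measurableType d) (R : realType).
Variable m : {measure set Y -> \bar R}.

(** A plain measure of known total mass, declared again with the richer structure: Radon-Nikodym
    derivatives are taken of finite measures, and the Augustin infimum ranges over probabilities. *)
Definition finite_copy of (m setT < +oo)%E : set Y -> \bar R := m.
Definition prob_copy of m setT = 1%E : set Y -> \bar R := m.

Section finite.
Hypothesis moo : (m setT < +oo)%E.
Let fc0 : finite_copy moo set0 = 0%E. Proof. exact: measure0. Qed.
Let fc_ge0 A : (0 <= finite_copy moo A)%E. Proof. exact: measure_ge0. Qed.
Let fc_ssa : semi_sigma_additive (finite_copy moo).
Proof. exact: measure_semi_sigma_additive. Qed.
HB.instance Definition _ :=
  isMeasure.Build _ _ _ (finite_copy moo) fc0 fc_ge0 fc_ssa.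
Let fc_fin : fin_num_fun (finite_copy moo).
Proof. exact: lty_fin_num_fun. Qed.
HB.instance Definition _ := Measure_isFinite.Build _ _ _ (finite_copy moo) fc_fin.
End finite.

Section prob.
Hypothesis m1 : m setT = 1%E.
Let pc0 : prob_copy m1 set0 = 0%E. Proof. exact: measure0. Qed.
Let pc_ge0 A : (0 <= prob_copy m1 A)%E. Proof. exact: measure_ge0. Qed.
Let pc_ssa : semi_sigma_additive (prob_copy m1).
Proof. exact: measure_semi_sigma_additive. Qed.
HB.instance Definition _ :=
  isMeasure.Build _ _ _ (prob_copy m1) pc0 pc_ge0 pc_ssa.
HB.instance Definition _ := Measure_isProbability.Build _ _ _ (prob_copy m1) m1.
End prob.

Lemma probability_copy : m setT = 1%E ->
  exists p : probability Y R, p = m :> (set Y -> \bar R).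
Proof. by move=> m1; exists (prob_copy m1). Qed.

Lemma finite_measure_copy : (m setT < +oo)%E ->
  exists p : {finite_measure set Y -> \bar R}, p = m :> (set Y -> \bar R).
Proof. by move=> moo; exists (finite_copy moo). Qed.

End measure_copies.

Section densities.
Context d (Y : measurableType d) (R : realType).
Local Notation meas := {measure set Y -> \bar R}.
Implicit Types (Q W U : meas) (f g r : Y -> R) (h : Y -> \bar R).

(** The real-valued form of [is_dens], so that field and order reasoning applies pointwise. *)
Definition has_dens Q W f :=
  [/\ measurable_fun setT f, (forall y, 0 <= f y) &
      forall A, measurable A -> W A = (\int[Q]_(y in A) (f y)%:E)%E].

Lemma has_dens_measurable Q W f : has_dens Q W f -> measurable_fun setT f.
Proof. by case. Qed.

Lemma has_dens_ge0 Q W f : has_dens Q W f -> forall y, 0 <= f y.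
Proof. by case. Qed.

Lemma has_dens_setT Q W f : has_dens Q W f ->
  (\int[Q]_y (f y)%:E)%E = W setT.
Proof. by case=> _ _ ->. Qed.

Lemma eq_integral_measure (m1 m2 : meas) D h : m1 = m2 :> (set Y -> \bar R) ->
  (\int[m1]_(y in D) h y = \int[m2]_(y in D) h y)%E.
Proof. by move=> m12; apply: eq_measure_integral => A _ _; rewrite m12. Qed.

Lemma has_dens_integrable Q W f : (W setT < +oo)%E -> has_dens Q W f ->
  Q.-integrable setT (EFin \o f).
Proof.
move=> Woo [mf f0 fE]; apply/integrableP; split; first exact/measurable_EFinP.
under eq_integral do rewrite gee0_abs ?lee_fin ?f0//.
by rewrite -fE.
Qed.

Lemma has_dens_dominates Q W f : has_dens Q W f -> W `<< Q.
Proof.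
move=> [mf f0 fE]; apply/null_content_dominatesP => A mA QA; rewrite fE//.
apply: null_set_integral => //.
by apply: measurable_funTS; exact/measurable_EFinP.
Qed.

Lemma dominates_has_dens Q W : (W setT < +oo)%E -> (Q setT < +oo)%E ->
  W `<< Q -> exists f, has_dens Q W f.
Proof.
move=> /finite_measure_copy[w wW] /finite_measure_copy[q qQ].
move=> WQ; have wq : w `<< q by rewrite wW qQ.
pose f := Radon_Nikodym_SigmaFinite.f w q.
have f0 := Radon_Nikodym_SigmaFinite.f_ge0 wq.
have ff := Radon_Nikodym_SigmaFinite.f_fin_num wq.
have mf := measurable_int _ (Radon_Nikodym_SigmaFinite.f_integrable wq).
exists (fine \o f); split.
- exact: measurableT_comp.
- by move=> y /=; apply: fine_ge0; exact: f0.
- move=> A mA; rewrite -wW (Radon_Nikodym_SigmaFinite.f_integral wq)//.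
  rewrite (eq_integral_measure A _ qQ); apply: eq_integral => y _ /=.
  by rewrite fineK.
Qed.

(** The density [f] agrees almost everywhere with the Radon-Nikodym derivative, for which the change
    of variables is available. *)
Lemma ge0_integral_has_dens Q W f h : (W setT < +oo)%E -> (Q setT < +oo)%E ->
  has_dens Q W f -> measurable_fun setT h -> (forall y, 0 <= h y)%E ->
  (\int[W]_y h y = \int[Q]_y (h y * (f y)%:E))%E.
Proof.
move=> Woo Qoo fWQ mh h0.
have WQ := has_dens_dominates fWQ.
have /finite_measure_copy[w wW] := Woo.
have /finite_measure_copy[q qQ] := Qoo.
have wq : w `<< q by rewrite wW qQ.
have mf := has_dens_measurable fWQ.
have f0 := has_dens_ge0 fWQ.
have mr := measurable_int _ (Radon_Nikodym_SigmaFinite.f_integrable wq).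
rewrite -(eq_integral_measure setT h wW) -(eq_integral_measure setT _ qQ).
rewrite -(Radon_Nikodym_SigmaFinite.change_of_variables wq h0)//.
apply: ge0_ae_eq_integral => //.
- exact: emeasurable_funM.
- by apply: emeasurable_funM => //; exact/measurable_EFinP.
- by move=> y _; rewrite mule_ge0// Radon_Nikodym_SigmaFinite.f_ge0.
- by move=> y _; rewrite mule_ge0// lee_fin.
- apply: ae_eqe_mul2l; apply: integral_ae_eq => //.
  + exact: Radon_Nikodym_SigmaFinite.f_integrable.
  + exact/measurable_EFinP.
  + move=> A _ mA; rewrite -(Radon_Nikodym_SigmaFinite.f_integral wq)//.
    by rewrite (eq_integral_measure A _ qQ); case: fWQ => _ _ <- //; rewrite wW.
Qed.

Lemma has_dens_chain Q W U f r : (W setT < +oo)%E -> (Q setT < +oo)%E ->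
  (U setT < +oo)%E ->
  has_dens Q W f -> has_dens U Q r -> has_dens U W (fun y => f y * r y).
Proof.
move=> Woo Qoo Uoo fWQ rQU.
have mf := has_dens_measurable fWQ; have mr := has_dens_measurable rQU.
have f0 := has_dens_ge0 fWQ; have r0 := has_dens_ge0 rQU.
split; [exact: measurable_funM|by move=> y; rewrite mulr_ge0|].
move=> A mA; case: fWQ => _ _ ->//.
rewrite integral_mkcond (ge0_integral_has_dens Qoo Uoo rQU).
- rewrite [RHS]integral_mkcond; apply: eq_integral => y _.
  by rewrite !patchE; case: ifPn => _; rewrite ?mul0e// EFinM.
- by apply/measurable_restrict => //; apply: measurable_funTS; exact/measurable_EFinP.
- by move=> y; rewrite patchE; case: ifPn => // _; rewrite lee_fin.
Qed.

End densities.

Section renyi_densities.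
Context d (Y : measurableType d) (R : realType).
Local Notation meas := {measure set Y -> \bar R}.
Implicit Types (Q W : meas) (f : Y -> R) (h : Y -> \bar R) (a : R).

Lemma is_dens_dens (mu W : meas) h : is_dens mu W h -> is_dens mu W (dens mu W).
Proof. by move=> H; rewrite /dens; case: pselect => [e|[]]; [case: cid|exists h]. Qed.

Lemma is_dens_ae_eq (mu W : meas) (h g : Y -> \bar R) : (W setT < +oo)%E ->
  is_dens mu W h -> is_dens mu W g -> ae_eq mu setT h g.
Proof.
move=> Woo [mh h0 hE] [mg g0 gE]; apply: integral_ae_eq => //.
- apply/integrableP; split => //.
  by under eq_integral do rewrite gee0_abs//; rewrite -hE.
- by move=> A _ mA; rewrite -hE// -gE.
Qed.

Lemma has_dens_is_dens (mu W : meas) f : has_dens mu W f ->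
  is_dens mu W (EFin \o f).
Proof. by case=> mf f0 fE; split => //; exact/measurable_EFinP. Qed.

Lemma fine_dens_ae (mu W : meas) f : (W setT < +oo)%E -> has_dens mu W f ->
  ae_eq mu setT (fine \o dens mu W) f.
Proof.
move=> Woo /has_dens_is_dens fW.
have := is_dens_ae_eq Woo (is_dens_dens fW) fW.
by apply: filterS => y /(_ I) /= ->.
Qed.

Lemma ge0_integral_measure_add_dens Q W f h : (W setT < +oo)%E ->
  (Q setT < +oo)%E -> has_dens Q W f ->
  measurable_fun setT h -> (forall y, 0 <= h y)%E ->
  (\int[measure_add W Q]_y h y = \int[Q]_y (h y * (1 + f y)%:E))%E.
Proof.
move=> Woo Qoo fWQ mh h0; have mf := has_dens_measurable fWQ.
have f0 := has_dens_ge0 fWQ.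
rewrite ge0_integral_measure_add// (ge0_integral_has_dens Woo Qoo fWQ)//.
rewrite -ge0_integralD//; last first.
- by apply: emeasurable_funM => //; exact/measurable_EFinP.
- by move=> y _; rewrite mule_ge0// lee_fin.
by apply: eq_integral => y _; rewrite EFinD ge0_muleDr ?lee_fin// mule1 addeC.
Qed.

Lemma measurable_powR_comp (g : Y -> R) a : measurable_fun setT g ->
  measurable_fun setT (fun y => g y `^ a).
Proof. by move=> mg; exact: (measurableT_comp (measurable_powR a) mg). Qed.

Lemma measurable_ln_comp (g : Y -> R) : measurable_fun setT g ->
  measurable_fun setT (fun y => ln (g y)).
Proof. by move=> mg; exact: (measurableT_comp (@measurable_ln R) mg). Qed.

Lemma measurable_fun_inv1D f : measurable_fun setT f -> (forall y, 0 <= f y) ->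
  measurable_fun setT (fun y => (1 + f y)^-1).
Proof.
move=> mf f0; under eq_fun do rewrite -powR_inv1 ?addr_ge0//.
by apply: measurable_powR_comp; exact: measurable_funD.
Qed.

Section with_density.
Variables (Q W : meas) (f : Y -> R).
Hypotheses (Woo : (W setT < +oo)%E) (Qoo : (Q setT < +oo)%E).
Hypothesis fWQ : has_dens Q W f.
Let mf := has_dens_measurable fWQ.
Let f0 := has_dens_ge0 fWQ.
Let nu := measure_add W Q.
Let f1 y : 0 < 1 + f y. Proof. by rewrite ltr_pwDl. Qed.

(** The measure [nu = W + Q] has density [1 + f] with respect to [Q]. The versions picked by [dens]
    agree almost everywhere with the explicit densities found here and in [has_dens_addr], which
    turns the definitions, all stated through [nu], into integrals against [Q]. *)
Lemma has_dens_addl : has_dens nu W (fun y => f y * (1 + f y)^-1).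
Proof.
split.
- by apply: measurable_funM => //; exact: measurable_fun_inv1D.
- by move=> y; rewrite mulr_ge0// invr_ge0 ltW.
move=> A mA; rewrite integral_mkcond (ge0_integral_measure_add_dens Woo Qoo fWQ).
- case: fWQ => _ _ ->//; rewrite integral_mkcond; apply: eq_integral => y _.
  by rewrite !patchE; case: ifPn; rewrite ?mul0e// -EFinM -mulrA mulVf ?mulr1// gt_eqF.
- apply/measurable_restrict => //; apply: measurable_funTS; apply/measurable_EFinP.
  by apply: measurable_funM => //; exact: measurable_fun_inv1D.
- move=> y; rewrite patchE; case: ifPn => // _.
  by rewrite lee_fin mulr_ge0// invr_ge0 ltW.
Qed.

Lemma has_dens_addr : has_dens nu Q (fun y => (1 + f y)^-1).
Proof.
split.
- exact: measurable_fun_inv1D.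
- by move=> y; rewrite invr_ge0 ltW.
move=> A mA; rewrite integral_mkcond (ge0_integral_measure_add_dens Woo Qoo fWQ).
- rewrite -[LHS]mul1e -integral_cst//= [LHS]integral_mkcond; apply: eq_integral => y _.
  by rewrite !patchE; case: ifPn; rewrite ?mul0e// -EFinM mulVf// gt_eqF.
- apply/measurable_restrict => //; apply: measurable_funTS; apply/measurable_EFinP.
  exact: measurable_fun_inv1D.
- by move=> y; rewrite patchE; case: ifPn => // _; rewrite lee_fin invr_ge0 ltW.
Qed.

Lemma ae_nu_Q (P : Y -> Prop) : {ae nu, forall y, P y} -> {ae Q, forall y, P y}.
Proof.
move=> [A [mA A0 PA]]; exists A; split => //; apply/eqP; rewrite eq_le measure_ge0 andbT.
by rewrite -A0 [leRHS]measure_addE leeDr.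
Qed.

Lemma fine_dens_addl : ae_eq nu setT (fine \o dens nu W) (fun y => f y * (1 + f y)^-1).
Proof. exact: fine_dens_ae has_dens_addl. Qed.

Lemma fine_dens_addr : ae_eq nu setT (fine \o dens nu Q) (fun y => (1 + f y)^-1).
Proof. exact: fine_dens_ae has_dens_addr. Qed.

Let mW : measurable_fun setT (fine \o dens nu W).
Proof.
apply: measurableT_comp => //.
by case: (is_dens_dens (has_dens_is_dens has_dens_addl)).
Qed.

Let mQ : measurable_fun setT (fine \o dens nu Q).
Proof.
apply: measurableT_comp => //.
by case: (is_dens_dens (has_dens_is_dens has_dens_addr)).
Qed.

Lemma measurable_fine_ac_dens : measurable_fun setT (fine \o ac_dens W Q).
Proof.
rewrite [X in measurable_fun _ X](_ : _ = fun y =>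
  if 0 < (fine \o dens nu Q) y then (fine \o dens nu W) y * ((fine \o dens nu Q) y) `^ (-1) else 0).
  apply: measurable_fun_ifT => //.
    exact: measurable_fun_ltr.
  apply: measurable_funM => //.
  exact: measurable_powR_comp.
by apply/funext => y /=; rewrite /ac_dens; case: ifPn => // g0; rewrite powR_inv1 1?ltW.
Qed.

Lemma ac_dens_ae : ae_eq Q setT (fine \o ac_dens W Q) f.
Proof.
have := ae_nu_Q fine_dens_addl; have := ae_nu_Q fine_dens_addr.
apply: filterS2 => y /(_ I) /= hQ /(_ I) /= hW _.
rewrite /ac_dens -/nu hQ hW invr_gt0 f1/= invrK -mulrA mulVf ?mulr1//.
by rewrite gt_eqF.
Qed.

Lemma fine_ac_dens_ge0 y : 0 <= fine (ac_dens W Q y).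
Proof.
rewrite /ac_dens; case: ifPn => // g0 /=; apply: divr_ge0; last exact: ltW.
by apply: fine_ge0; case: (is_dens_dens (has_dens_is_dens has_dens_addl)).
Qed.

Lemma has_dens_ac_dens : has_dens Q W (fine \o ac_dens W Q).
Proof.
split; first exact: measurable_fine_ac_dens.
- exact: fine_ac_dens_ge0.
- move=> A mA; case: fWQ => _ _ ->//; apply: ge0_ae_eq_integral => //.
  + by apply: measurable_funTS; exact/measurable_EFinP.
  + by apply: measurable_funTS; apply/measurable_EFinP; exact: measurable_fine_ac_dens.
  + by move=> y _; rewrite lee_fin.
  + by move=> y _; rewrite lee_fin; exact: fine_ac_dens_ge0.
  + have := ac_dens_ae; apply: filterS => y /(_ I)/= h _.
    by rewrite h.
Qed.

Let renyi_integrandE a (u : R) : 0 <= u -> 0 < a ->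
  renyi_integrand a (u * (1 + u)^-1) (1 + u)^-1 = (u `^ a * (1 + u)^-1)%:E.
Proof.
move=> u0 a0; have u1 : 0 < (1 + u)^-1 by rewrite invr_gt0 ltr_pwDl.
rewrite /renyi_integrand u1; congr EFin.
rewrite powRM// 1?ltW// -mulrA -powRD ?(gt_eqF u1) ?implybT//.
by rewrite [a + _]addrC subrK powRr1// ltW.
Qed.

Lemma measurable_renyi_integrand a (u v : Y -> R) : measurable_fun setT u ->
  measurable_fun setT v -> measurable_fun setT (fun y => renyi_integrand a (u y) (v y)).
Proof.
move=> mu mv; rewrite /renyi_integrand; apply: measurable_fun_ifT.
- exact: measurable_fun_ltr.
- by apply/measurable_EFinP; apply: measurable_funM; exact: measurable_powR_comp.
- apply: measurable_fun_ifT => //.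
  by apply: measurable_and => //; exact: measurable_fun_ltr.
Qed.

Lemma renyi_integrand_ge0 a (u v : R) : (0 <= renyi_integrand a u v)%E.
Proof.
rewrite /renyi_integrand; case: ifPn => _; last by case: ifPn.
by rewrite lee_fin mulr_ge0 ?powR_ge0.
Qed.

Lemma renyi_has_dens a : 0 < a -> a != 1 ->
  renyi a W Q = (((a - 1)^-1)%:E * eln (\int[Q]_y (f y `^ a)%:E))%E.
Proof.
move=> a0 a1; rewrite /renyi (negbTE a1); congr (_ * eln _)%E.
transitivity (\int[nu]_y (f y `^ a * (1 + f y)^-1)%:E)%E.
  apply: ge0_ae_eq_integral => //.
  - exact: measurable_renyi_integrand.
  - apply/measurable_EFinP; apply: measurable_funM.
      exact: measurable_powR_comp.
    exact: measurable_fun_inv1D.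
  - by move=> y _; exact: renyi_integrand_ge0.
  - by move=> y _; rewrite lee_fin mulr_ge0 ?powR_ge0 ?invr_ge0 ?(ltW (f1 y)).
  - have := fine_dens_addl; have := fine_dens_addr.
    apply: filterS2 => y /(_ I) /= hQ /(_ I) /= hW _.
    by rewrite hQ hW renyi_integrandE.
rewrite (ge0_integral_measure_add_dens Woo Qoo fWQ).
- by apply: eq_integral => y _; rewrite -EFinM -mulrA mulVf ?mulr1// gt_eqF.
- apply/measurable_EFinP; apply: measurable_funM.
    exact: measurable_powR_comp.
  exact: measurable_fun_inv1D.
- by move=> y; rewrite lee_fin mulr_ge0 ?powR_ge0 ?invr_ge0 ?(ltW (f1 y)).
Qed.

Lemma measurable_kl_integrand (u v : Y -> R) : measurable_fun setT u ->
  measurable_fun setT v -> measurable_fun setT (fun y => kl_integrand (u y) (v y)).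
Proof.
move=> mu mv; rewrite /kl_integrand; apply: measurable_fun_ifT => //.
- exact: measurable_fun_ltr.
- apply: measurable_fun_ifT => //.
    exact: measurable_fun_ltr.
  apply/measurable_EFinP; apply: measurable_funM => //.
  by apply: measurable_funB; exact: measurable_ln_comp.
Qed.

Let kl_integrandE (u : R) : 0 <= u ->
  kl_integrand (u * (1 + u)^-1) (1 + u)^-1 = (u * ln u * (1 + u)^-1)%:E.
Proof.
move=> u0; have u1 : 0 < (1 + u)^-1 by rewrite invr_gt0 ltr_pwDl.
rewrite /kl_integrand u1 pmulr_lgt0//.
have [u_gt0|] := ltP 0 u; last first.
  move=> u_le0; have -> : u = 0 by apply/eqP; rewrite eq_le u0 u_le0.
  by rewrite !mul0r.
congr EFin; rewrite lnM ?posrE// addrK; ring.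
Qed.

Lemma renyi1_has_dens : renyi 1 W Q = (\int[Q]_y (f y * ln (f y))%:E)%E.
Proof.
rewrite /renyi eqxx.
have mfl : measurable_fun setT (fun y => (f y * ln (f y))).
  by apply: measurable_funM => //; exact: measurable_ln_comp.
have mi : measurable_fun setT (fun y => (f y * ln (f y) * (1 + f y)^-1)%:E).
  by apply/measurable_EFinP; apply: measurable_funM => //; exact: measurable_fun_inv1D.
transitivity (\int[nu]_y (f y * ln (f y) * (1 + f y)^-1)%:E)%E.
  apply: ae_eq_integral => //.
  - exact: measurable_kl_integrand.
  - have := fine_dens_addl; have := fine_dens_addr.
    apply: filterS2 => y /(_ I) /= hQ /(_ I) /= hW _.
    by rewrite hQ hW kl_integrandE.
have posE (u w : R) : 0 < w -> (maxe (u * w^-1)%:E 0 * w%:E = maxe u%:E 0)%E.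
  move=> w0; rewrite -!EFin_max -EFinM maxr_pMl 1?ltW// mul0r -mulrA mulVf ?mulr1//.
  by rewrite gt_eqF.
(* The integrand has no sign, and the integral may be infinite, so the two parts are transported
   separately. *)
rewrite [LHS]integralE [RHS]integralE; congr (_ - _)%E.
- rewrite (ge0_integral_measure_add_dens Woo Qoo fWQ)//.
    by apply: eq_integral => y _; rewrite !funeposE posE.
  exact: measurable_funepos.
- rewrite (ge0_integral_measure_add_dens Woo Qoo fWQ)//.
    by apply: eq_integral => y _; rewrite !funenegE -!EFinN -mulNr posE.
  exact: measurable_funeneg.
Qed.

End with_density.
End renyi_densities.

(** * Absolute continuity from finite divergence, and densities of tilted measures *)

Section finite_divergence.
Context d (Y : measurableType d) (R : realType).
Local Notation meas := {measure set Y -> \bar R}.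
Implicit Types (Q W : meas) (f : Y -> R) (h : Y -> \bar R) (a : R).

Lemma mdens_has_dens Q h f : measurable_fun setT f -> (forall y, 0 <= f y) ->
  (forall y, h y = (f y)%:E) -> has_dens Q (mdens Q h) f.
Proof.
move=> mf f0 /funext ->; split => // A mA /=; rewrite /mdens /dens_guard.
by case: pselect => // -[]; split; [exact/measurable_EFinP|move=> y; rewrite lee_fin].
Qed.

(** From [ln (v / u) <= v / u - 1]. It dominates the negative part of the order-one integrand by the
    density of [Q]. *)
Lemma kl_integrand_neg (u v : R) : 0 <= u -> 0 <= v ->
  (- kl_integrand u v <= v%:E)%E.
Proof.
move=> u0 v0; rewrite /kl_integrand; case: ifPn => [ugt0|]; last by rewrite oppe0 lee_fin.
case: ifPn => [vgt0|_]; last by rewrite leNye.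
rewrite -EFinN lee_fin -mulrN opprB -ln_div ?posrE//.
have : ln (v / u) <= v / u - 1.
  rewrite -[in leLHS](subrK 1 (v / u)) [in leLHS]addrC le_ln1Dx//.
  by rewrite ltrBrDr addNr divr_gt0.
move=> /(ler_wpM2l u0) /le_trans; apply.
by rewrite mulrBr mulrC divfK ?gt_eqF// mulr1 gerBl.
Qed.

Section dominates.
Variables (Q W : meas).
Hypotheses (Woo : (W setT < +oo)%E) (Qoo : (Q setT < +oo)%E).
Let nu := measure_add W Q.
Let nuoo : (nu setT < +oo)%E.
Proof. by rewrite -[nu setT]/(measure_add W Q setT) measure_addE lte_add_pinfty. Qed.

Let densW : exists f, has_dens nu W f.
Proof.
apply: dominates_has_dens => //; apply/null_content_dominatesP => A mA nuA.
apply/eqP; rewrite eq_le measure_ge0 andbT.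
by rewrite -nuA [leRHS]measure_addE leeDl.
Qed.

Let densQ : exists f, has_dens nu Q f.
Proof.
apply: dominates_has_dens => //; apply/null_content_dominatesP => A mA nuA.
apply/eqP; rewrite eq_le measure_ge0 andbT.
by rewrite -nuA [leRHS]measure_addE leeDr.
Qed.

Let F := fine \o dens nu W.
Let G := fine \o dens nu Q.

Let hF : has_dens nu W F.
Proof.
have [f hf] := densW; have := is_dens_dens (has_dens_is_dens hf).
move=> [mD D0 DE]; split.
- exact: measurableT_comp.
- by move=> y; exact: fine_ge0.
- move=> A mA; rewrite DE//; apply: ge0_ae_eq_integral => //.
  + exact: measurable_funTS.
  + by apply: measurable_funTS; apply/measurable_EFinP; exact: measurableT_comp.
  + by move=> y _; rewrite lee_fin fine_ge0.
  + have := is_dens_ae_eq Woo (And3 mD D0 DE) (has_dens_is_dens hf).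
    by apply: filterS => y /(_ I) /= h _; rewrite /F /= h.
Qed.

Let hG : has_dens nu Q G.
Proof.
have [f hf] := densQ; have := is_dens_dens (has_dens_is_dens hf).
move=> [mD D0 DE]; split.
- exact: measurableT_comp.
- by move=> y; exact: fine_ge0.
- move=> A mA; rewrite DE//; apply: ge0_ae_eq_integral => //.
  + exact: measurable_funTS.
  + by apply: measurable_funTS; apply/measurable_EFinP; exact: measurableT_comp.
  + by move=> y _; rewrite lee_fin fine_ge0.
  + have := is_dens_ae_eq Qoo (And3 mD D0 DE) (has_dens_is_dens hf).
    by apply: filterS => y /(_ I) /= h _; rewrite /G /= h.
Qed.

Let dominated : {ae nu, forall y, ~ (0 < F y /\ G y <= 0)} -> W `<< Q.
Proof.
move=> H; apply/null_content_dominatesP => A mA QA.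
have [mF F0 FE] := hF; have [mG G0 GE] := hG.
have GA : ae_eq nu A (EFin \o G) (cst 0%E).
  apply/ae_eq_integral_abs => //.
    by apply: measurable_funTS; exact/measurable_EFinP.
  transitivity (Q A); last exact: QA.
  rewrite GE//; apply: eq_integral => y _.
  by rewrite gee0_abs// lee_fin.
transitivity (W A) => //; rewrite FE//; transitivity (\int[nu]_(y in A) (cst 0 y))%E; last exact: integral0.
apply: ge0_ae_eq_integral => //.
- by apply: measurable_funTS; exact/measurable_EFinP.
- by move=> y _; rewrite lee_fin.
- move: H GA; apply: filterS2 => y FG /[apply] /= -[g0].
  congr EFin; apply/eqP; rewrite eq_le F0 andbT leNgt; apply/negP => FF.
  by apply: FG; rewrite g0.
Qed.

Let pinfty_integrand (h : Y -> \bar R) : measurable_fun setT h ->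
  (forall y, 0 <= h y)%E -> (forall y, 0 < F y -> G y <= 0 -> h y = +oo%E) ->
  (\int[nu]_y h y < +oo)%E -> W `<< Q.
Proof.
move=> mh h0 hy hoo; apply: dominated.
have : nu.-integrable setT h.
  by apply/integrableP; split => //; under eq_integral do rewrite gee0_abs//.
move=> /integrable_ae => /(_ measurableT).
by apply: filterS => y /(_ I) hfin [Fy Gy]; move: hfin; rewrite hy.
Qed.

(** Where [F] is positive and [G] vanishes the integrand is [+oo], so a finite integral makes this
    set null. At order one the integrand is signed, but its negative part has finite integral and
    cannot offset an infinite positive part. *)
Lemma renyi_lty_dominates a : 1 <= a -> (renyi a W Q < +oo)%E -> W `<< Q.
Proof.
have [mF F0 FE] := hF; have [mG G0 GE] := hG.
rewrite le_eqVlt => /predU1P[<-|a1].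
  rewrite /renyi eqxx -/nu -/F -/G => hoo.
  have mk : measurable_fun setT (fun y => kl_integrand (F y) (G y)).
    exact: measurable_kl_integrand.
  apply: (pinfty_integrand (h := (fun y => kl_integrand (F y) (G y))^\+%E)).
  - exact: measurable_funepos.
  - by move=> y; exact: funepos_ge0.
  - by move=> y Fy Gy; rewrite funeposE /kl_integrand Fy ltNge Gy/=.
  - rewrite ltNge leye_eq; apply/negP => /eqP ioo; move: hoo.
    rewrite integralE -[X in (X - _)%E]/(\int[nu]_y (fun y => kl_integrand (F y) (G y))^\+ y)%E ioo.
    have : (\int[nu]_y (fun y => kl_integrand (F y) (G y))^\- y < +oo)%E.
      apply: le_lt_trans Qoo; rewrite -(has_dens_setT hG).
      apply: ge0_le_integral => //.
      + exact: measurable_funeneg.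
      + exact/measurable_EFinP.
      + move=> y _; rewrite funenegE ge_max lee_fin G0 andbT.
        exact: kl_integrand_neg.
    case: (\int[nu]_y _^\- y)%E => //.
rewrite /renyi gt_eqF// -/nu -/F -/G => hoo.
apply: (pinfty_integrand (h := fun y => renyi_integrand a (F y) (G y))).
- exact: measurable_renyi_integrand.
- by move=> y; exact: renyi_integrand_ge0.
- by move=> y Fy Gy; rewrite /renyi_integrand Fy a1 ltNge Gy.
- rewrite ltNge leye_eq; apply/negP => /eqP ioo; move: hoo.
  rewrite -[X in eln X]/(\int[nu]_y renyi_integrand a (F y) (G y))%E ioo /=.
  by rewrite gt0_muley ?ltxx// lte_fin invr_gt0 subr_gt0.
Qed.

End dominates.

Section tilting.
Variables (Q W : meas).
Hypotheses (W1 : W setT = 1%E) (Q1 : Q setT = 1%E).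
Hypothesis WQ : W `<< Q.
Let Woo : (W setT < +oo)%E. Proof. by rewrite W1 ltry. Qed.
Let Qoo : (Q setT < +oo)%E. Proof. by rewrite Q1 ltry. Qed.
Let f := fine \o ac_dens W Q.

Lemma dominates_has_dens_ac_dens : has_dens Q W f.
Proof.
have [g hg] := dominates_has_dens Woo Qoo WQ.
exact: has_dens_ac_dens hg.
Qed.

Let tilt1_has_dens : has_dens Q (tilt1 W Q) f.
Proof.
have hf := dominates_has_dens_ac_dens; have [mf f0 fE] := hf.
have e : (fun y => ac_dens W Q y * ((fine (\int[Q]_z ac_dens W Q z))^-1)%:E)%E =1 EFin \o f.
  have E y : ac_dens W Q y = (f y)%:E by rewrite /f /= /ac_dens; case: ifP.
  move=> y; rewrite E (_ : fine _ = 1) ?invr1 ?mule1//.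
  by under eq_integral do rewrite E; rewrite -fE// W1.
exact: mdens_has_dens.
Qed.

(** Under [W << Q] the normalised absolutely continuous part is [W] itself, and the factor
    [e^((1 - a) D_a)] is the inverse of the normalisation [z]. *)
Lemma tilted_has_dens a (z : R) : 0 < a -> a != 1 -> 0 < z ->
  (\int[Q]_y (f y `^ a)%:E)%E = z%:E ->
  has_dens Q (tilted a W Q) (fun y => z^-1 * f y `^ a).
Proof.
move=> a0 a1 z0 fz; have tf := tilt1_has_dens; have [mf f0 fE] := tf.
have t1 : tilt1 W Q setT = 1%E.
  by rewrite -(has_dens_setT tf) (has_dens_setT dominates_has_dens_ac_dens) W1.
have too : (tilt1 W Q setT < +oo)%E by rewrite t1 ltry.
have r : fine (renyi a (tilt1 W Q) Q) = (a - 1)^-1 * ln z.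
  by rewrite (renyi_has_dens too Qoo tf)// fz /= z0.
have e1 : expR ((1 - a) * fine (renyi a (tilt1 W Q) Q)) = z^-1.
  rewrite r mulrA -opprB mulNr divff ?subr_eq0// mulN1r expRN lnK//.
have mg : measurable_fun setT (fine \o dens Q (tilt1 W Q)).
  by apply: measurableT_comp => //; case: (is_dens_dens (has_dens_is_dens tf)).
rewrite /tilted e1.
have m1 : measurable_fun setT (fun y => z^-1 * fine (dens Q (tilt1 W Q) y) `^ a).
  by apply: measurable_funM => //; exact: (measurable_powR_comp a mg).
have p1 y : 0 <= z^-1 * fine (dens Q (tilt1 W Q) y) `^ a.
  by rewrite mulr_ge0 ?powR_ge0 ?invr_ge0 ?(ltW z0).
have [_ _ E] := @mdens_has_dens Q _ _ m1 p1 (fun=> erefl).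
split.
- by apply: measurable_funM => //; exact: measurable_powR_comp.
- by move=> y; rewrite mulr_ge0 ?powR_ge0 ?invr_ge0 ?(ltW z0).
move=> A mA; apply: etrans (E A mA) _; apply: ge0_ae_eq_integral => //.
- apply: measurable_funTS; apply/measurable_EFinP.
  by apply: measurable_funM => //; exact: measurable_powR_comp.
- apply: measurable_funTS; apply/measurable_EFinP.
  by apply: measurable_funM => //; exact: measurable_powR_comp.
- by move=> y _; rewrite lee_fin mulr_ge0 ?powR_ge0 ?invr_ge0 ?(ltW z0).
- by move=> y _; rewrite lee_fin mulr_ge0 ?powR_ge0 ?invr_ge0 ?(ltW z0).
- by have := fine_dens_ae too tf; apply: filterS => y /(_ I) /= -> _.
Qed.

End tilting.
End finite_divergence.

(** * Young's and Bernoulli's inequalities for real exponents *)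

Section powR_inequalities.
Context {R : realType}.
Implicit Types z s t u : R.

(** Weighted mean inequality for [1] and [z]: the bound [1 + x <= e^x] is used at [(1 - t) ln z] and
    [- t ln z], and the weights [t] and [1 - t] cancel the logarithms. *)
Lemma powR_le_affine t z : 0 <= t <= 1 -> 0 <= z -> z `^ t <= 1 - t + t * z.
Proof.
move=> /andP[t0 t1]; rewrite le_eqVlt => /predU1P[<-|z0].
  rewrite mulr0 addr0 /powR eqxx; have [->|tn0] := eqVneq t 0; first by rewrite subr0.
  by rewrite subr_ge0.
have h1 : z `^ t * (1 + (1 - t) * ln z) <= z.
  rewrite -[leRHS](lnK (x := z)) ?posrE// (_ : ln z = t * ln z + (1 - t) * ln z); last by ring.
  rewrite [in leRHS]expRD /powR gt_eqF// -mulrDl (_ : t + (1 - t) = 1) ?mul1r; last by ring.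
  by rewrite ler_wpM2l ?expR_ge0// expR_ge1Dx.
have h2 : z `^ t * (1 - t * ln z) <= 1.
  rewrite /powR gt_eqF// -[leRHS](expRxMexpNx_1 (t * ln z)).
  by rewrite ler_wpM2l ?expR_ge0// expR_ge1Dx.
have t1' : 0 <= 1 - t by rewrite subr_ge0.
have := lerD (ler_wpM2l t0 h1) (ler_wpM2l t1' h2).
have -> : t * (z `^ t * (1 + (1 - t) * ln z)) + (1 - t) * (z `^ t * (1 - t * ln z)) = z `^ t by ring.
lra.
Qed.

(** The previous inequality with exponent [1 / s], applied to [z^s]. *)
Lemma powR_ge_affine s z : 1 <= s -> 0 <= z -> 1 + s * (z - 1) <= z `^ s.
Proof.
move=> s1 z0; have s0 : 0 < s by lra.
have := @powR_le_affine s^-1 (z `^ s).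
rewrite -powRrM mulfV ?gt_eqF// powRr1// powR_ge0 invr_ge0 (ltW s0) invf_le1//.
move=> /(_ s1 isT) /(ler_wpM2l (ltW s0)).
have -> : s * (1 - s^-1 + s^-1 * z `^ s) = s - 1 + z `^ s by field; rewrite gt_eqF.
lra.
Qed.

Lemma ln_le_subr1 z : 0 < z -> ln z <= z - 1.
Proof.
move=> z0; rewrite -[in leLHS](subrK 1 z) [in leLHS]addrC le_ln1Dx//.
by rewrite ltrBrDr addNr.
Qed.

Lemma ln_eq_subr1 z : 0 < z -> ln z = z - 1 -> z = 1.
Proof.
move=> z0 h; apply/eqP; apply: contraT => z1.
have := @expR_gt1Dx R (z - 1); rewrite subr_eq0 => /(_ z1).
by rewrite -h lnK ?posrE// addrC h subrK ltxx.
Qed.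

Lemma mul_ln_ge z : 0 <= z -> z - 1 <= z * ln z.
Proof.
rewrite le_eqVlt => /predU1P[<-|z0]; first by rewrite mul0r; lra.
have := @ln_le_subr1 z^-1; rewrite invr_gt0 => /(_ z0).
rewrite lnV ?posrE// => /(ler_wpM2l (ltW z0)); rewrite mulrBr mulfV ?gt_eqF//.
lra.
Qed.

End powR_inequalities.

Section integrals.
Context d (Y : measurableType d) (R : realType).
Local Notation meas := {measure set Y -> \bar R}.
Implicit Types (Q W : meas) (f g : Y -> R) (a : R).

Lemma integral_fin_num_integrable Q g : measurable_fun setT g ->
  (\int[Q]_y (g y)%:E)%E \is a fin_num -> Q.-integrable setT (EFin \o g).
Proof.
move=> mg; rewrite -integral_fin_num_abs// => h.
by apply/integrableP; split => //; exact/measurable_EFinP.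
Qed.

Lemma integrable_realZ Q a f : Q.-integrable setT (EFin \o f) ->
  Q.-integrable setT (EFin \o (fun y => a * f y)).
Proof. by move=> j; exact: (integrableZl measurableT a j). Qed.

Lemma integrable_realD Q f g : Q.-integrable setT (EFin \o f) ->
  Q.-integrable setT (EFin \o g) -> Q.-integrable setT (EFin \o (fun y => f y + g y)).
Proof. by move=> jf jg; exact: (integrableD measurableT jf jg). Qed.

Lemma integrable_realB Q f g : Q.-integrable setT (EFin \o f) ->
  Q.-integrable setT (EFin \o g) -> Q.-integrable setT (EFin \o (fun y => f y - g y)).
Proof. by move=> jf jg; exact: (integrableB measurableT jf jg). Qed.

Lemma integrable_has_dens Q W f g : (W setT < +oo)%E -> (Q setT < +oo)%E ->
  has_dens Q W f -> W.-integrable setT (EFin \o g) ->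
  Q.-integrable setT (EFin \o (fun y => g y * f y)) /\
  (\int[W]_y (g y)%:E = \int[Q]_y (g y * f y)%:E)%E.
Proof.
move=> Woo Qoo fWQ ig; have mf := has_dens_measurable fWQ; have f0 := has_dens_ge0 fWQ.
have mg : measurable_fun setT g by apply/measurable_EFinP; exact: measurable_int ig.
have posE (u w : R) : 0 <= w -> (maxe u%:E 0 * w%:E = maxe (u * w)%:E 0)%E.
  by move=> w0; rewrite -!EFin_max -EFinM maxr_pMl// mul0r.
split.
  apply/integrableP; split; first by apply/measurable_EFinP; exact: measurable_funM.
  have /integrableP[_] := ig.
  rewrite (ge0_integral_has_dens Woo Qoo fWQ)//; last first.
    by apply: measurableT_comp => //; exact/measurable_EFinP.
  by under eq_integral do rewrite /= -EFinM -{1}(ger0_norm (f0 _)) -normrM.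
rewrite [LHS]integralE [RHS]integralE; congr (_ - _)%E.
- rewrite (ge0_integral_has_dens Woo Qoo fWQ)//.
    by apply: eq_integral => y _; rewrite !funeposE posE.
  by apply: measurable_funepos; exact/measurable_EFinP.
- rewrite (ge0_integral_has_dens Woo Qoo fWQ)//.
    by apply: eq_integral => y _; rewrite !funenegE -!EFinN posE// mulNr.
  by apply: measurable_funeneg; exact/measurable_EFinP.
Qed.

Lemma bounded_integrable Q g (C : R) : (Q setT < +oo)%E -> measurable_fun setT g ->
  (forall y, `|g y| <= C) -> Q.-integrable setT (EFin \o g).
Proof.
move=> Qoo mg gC; apply: measurable_bounded_integrable => //.
exists C; split; first exact: num_real.
by move=> M CM y _ /=; rewrite (le_trans (gC y))// ltW.
Qed.

Lemma ae_bounded_integrable Q g (C : R) : (Q setT < +oo)%E -> measurable_fun setT g ->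
  {ae Q, forall y, `|g y| <= C} -> Q.-integrable setT (EFin \o g).
Proof.
move=> Qoo mg gC; apply/integrableP; split; first exact/measurable_EFinP.
apply: (@le_lt_trans _ _ ((`|C|)%R%:E * Q setT)%E); last first.
  by rewrite ltey_eq fin_numM// ge0_fin_numE.
apply: integral_le_bound => //.
- exact/measurable_EFinP.
- apply: filterS gC => y gy _ /=.
  by rewrite lee_fin (le_trans gy)// ler_norm.
Qed.

Lemma Rintegral_ae_le Q g f : Q.-integrable setT (EFin \o f) ->
  Q.-integrable setT (EFin \o g) -> {ae Q, forall y, f y <= g y} ->
  \int[Q]_y f y <= \int[Q]_y g y.
Proof.
move=> jf jg fg; rewrite -subr_ge0 -RintegralB//.
have mB : measurable_fun setT (fun y => g y - f y).
  apply: measurable_funB; apply/measurable_EFinP.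
    exact: measurable_int jg.
  exact: measurable_int jf.
have -> : \int[Q]_y (g y - f y) = \int[Q]_y (Num.max (g y - f y) 0).
  rewrite /Rintegral; congr fine; apply: ae_eq_integral => //.
  - exact/measurable_EFinP.
  - by apply/measurable_EFinP; exact: measurable_maxr.
  - by apply: filterS fg => y fgy _; rewrite max_l// subr_ge0.
by apply: Rintegral_ge0 => y _; rewrite le_max lexx orbT.
Qed.

Lemma Rintegral_ae_eq Q g f : Q.-integrable setT (EFin \o f) ->
  Q.-integrable setT (EFin \o g) -> {ae Q, forall y, f y = g y} ->
  \int[Q]_y f y = \int[Q]_y g y.
Proof.
move=> jf jg fg; apply/eqP; rewrite eq_le; apply/andP; split; apply: Rintegral_ae_le => //;
  by apply: filterS fg => y ->.
Qed.

Lemma Rintegral_le0_ae Q g : Q.-integrable setT (EFin \o g) ->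
  {ae Q, forall y, 0 <= g y} -> \int[Q]_y g y <= 0 -> {ae Q, forall y, g y = 0}.
Proof.
move=> jg g0 g_le0.
have mg := measurable_int _ jg.
have : ae_eq Q setT (EFin \o g) (cst 0%E).
  apply/(ae_eq_integral_abs _ measurableT mg).
  transitivity (\int[Q]_y (g y)%:E)%E.
    apply: ae_eq_integral => //; first exact: measurableT_comp.
    by apply: filterS g0 => y gy _; rewrite /= ger0_norm.
  rewrite -[LHS]fineK ?integrable_fin_num//; congr EFin.
  apply/eqP; rewrite eq_le g_le0/=.
  have := @Rintegral_ae_le Q g (cst 0) (integrable0 _ _) jg g0.
  by rewrite Rintegral_cst// mul0r.
by apply: filterS => y /(_ I) /= [].
Qed.

Lemma Rintegral_sum Q (I : finType) (h : I -> Y -> R) :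
  (forall i, Q.-integrable setT (EFin \o h i)) ->
  Q.-integrable setT (EFin \o (fun y => \sum_i h i y)) /\
  \int[Q]_y (\sum_i h i y) = \sum_i \int[Q]_y h i y.
Proof.
move=> jh.
have E : EFin \o (fun y => \sum_i h i y) = (fun y => \sum_(i <- index_enum I) (h i y)%:E)%E.
  by apply/funext => y /=; rewrite sumEFin.
split.
  rewrite E; have := @integrable_sum _ _ _ Q _ measurableT I (index_enum I) xpredT (fun i => EFin \o h i).
  by apply=> i _; exact: jh.
rewrite /Rintegral.
have -> : (\int[Q]_y (\sum_i h i y)%R%:E = \int[Q]_y \sum_(i <- index_enum I) (EFin \o h i) y)%E.
  by apply: eq_integral => y _; rewrite sumEFin.
rewrite (@integral_sum _ _ _ Q _ measurableT I (fun i => EFin \o h i)); last exact: jh.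
by rewrite -sum_fine// => i _; exact: integrable_fin_num (jh i).
Qed.

End integrals.

Section renyi_ge0.
Context d (Y : measurableType d) (R : realType).
Implicit Types (f : Y -> R) (a : R).

Lemma measure1_lty (Q : {measure set Y -> \bar R}) : Q setT = 1%E -> (Q setT < +oo)%E.
Proof. by move=> ->; rewrite ltry. Qed.

Variables Q W : {measure set Y -> \bar R}.
Hypotheses (Q1 : Q setT = 1%E) (W1 : W setT = 1%E).
Let Qoo := measure1_lty Q1.
Let Woo := measure1_lty W1.

Lemma has_dens_Rintegral f : has_dens Q W f -> \int[Q]_y f y = 1.
Proof. by move=> h; rewrite /Rintegral (has_dens_setT h) W1. Qed.

Lemma Rintegral_prob_cst (c : R) : \int[Q]_y c = c.
Proof. by rewrite Rintegral_cst// Q1 mulr1. Qed.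

Lemma prob_integrable_cst (c : R) : Q.-integrable setT (EFin \o cst c).
Proof.
apply/integrableP; split; first exact/measurable_EFinP.
rewrite (_ : (fun y => _) = cst (`|c|)%R%:E)// integral_cst// Q1 mule1.
exact: ltry.
Qed.

(** Bernoulli's inequality integrated, since [f] has mean one. *)
Lemma integral_powR_ge1 f a : 1 <= a -> has_dens Q W f ->
  (1 <= \int[Q]_y (f y `^ a)%:E)%E.
Proof.
move=> a1 h; have mf := has_dens_measurable h; have f0 := has_dens_ge0 h.
have jf := has_dens_integrable Woo h.
have [oo|fin] := eqVneq (\int[Q]_y (f y `^ a)%:E)%E +oo%E; first by rewrite oo leey.
have mp := measurable_powR_comp a mf.
have fin' : (\int[Q]_y (f y `^ a)%:E)%E \is a fin_num.
  rewrite ge0_fin_numE; first by rewrite ltey.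
  by apply: integral_ge0 => y _; rewrite lee_fin powR_ge0.
have jp := integral_fin_num_integrable mp fin'.
rewrite -(fineK fin') lee_fin -/(Rintegral Q setT (fun y => f y `^ a)).
have jc := prob_integrable_cst.
have jaf : Q.-integrable setT (EFin \o (fun y => a * f y)) by exact: integrable_realZ.
apply: le_trans (_ : \int[Q]_y ((1 - a) + a * f y) <= _).
  have := RintegralD measurableT (jc (1 - a)) jaf => ->.
  rewrite Rintegral_prob_cst RintegralZl// (has_dens_Rintegral h); lra.
apply: le_Rintegral => //.
  exact: (integrable_realD (jc (1 - a)) jaf).
by move=> y _; have := powR_ge_affine a1 (f0 y); lra.
Qed.

Lemma renyi_ge0 a : 1 <= a -> (0 <= renyi a W Q)%E.
Proof.
move=> a1; have [|oo] := ltP (renyi a W Q) +oo%E; last by rewrite (le_trans _ oo).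
move=> /(renyi_lty_dominates Woo Qoo a1).
move=> /(dominates_has_dens Woo Qoo)[f h].
have f0 := has_dens_ge0 h; have mf := has_dens_measurable h.
have jf := has_dens_integrable Woo h.
move: a1; rewrite le_eqVlt => /predU1P[<-|a1].
  rewrite (renyi1_has_dens Woo Qoo h).
  have [oo|fin] := boolP ((\int[Q]_y (f y * ln (f y))%:E)%E \is a fin_num).
    have j := integral_fin_num_integrable _ oo.
    rewrite -(fineK oo) lee_fin -/(Rintegral Q setT (fun y => f y * ln (f y))).
    apply: le_trans (_ : \int[Q]_y (f y - 1) <= _).
      have := RintegralB measurableT jf (prob_integrable_cst 1) => ->.
      by rewrite (has_dens_Rintegral h) Rintegral_prob_cst subrr.
    apply: le_Rintegral => //.
    - exact: (integrable_realB jf (prob_integrable_cst 1)).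
    - by apply: j; apply: measurable_funM => //; exact: measurable_ln_comp.
    - by move=> y _; exact: mul_ln_ge.
  (* A non-finite integral can only be [+oo]: the negative part of [z ln z] is at most [1]. *)
  rewrite integralE.
  have negfin : (\int[Q]_y (fun y => (f y * ln (f y))%:E)^\- y < +oo)%E.
    apply: le_lt_trans Qoo; rewrite -[leRHS]mul1e -integral_cst//.
    apply: ge0_le_integral => //.
    - apply: measurable_funeneg; apply/measurable_EFinP.
      by apply: measurable_funM => //; exact: measurable_ln_comp.
    - move=> y _; rewrite funenegE -EFinN -EFin_max lee_fin ge_max ler01 andbT.
      by have := mul_ln_ge (f0 y); have := f0 y; lra.
  move: fin; rewrite integralE.
  have : (0 <= \int[Q]_y (fun y => (f y * ln (f y))%:E)^\+ y)%E.
    by apply: integral_ge0 => y _; exact: funepos_ge0.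
  have : (0 <= \int[Q]_y (fun y => (f y * ln (f y))%:E)^\- y)%E.
    by apply: integral_ge0 => y _; exact: funeneg_ge0.
  by move: negfin; case: (integral _ _ _) => [u| |]//; case: (integral _ _ _) => [w| |].
have a0 : 0 < a by lra.
rewrite (renyi_has_dens Woo Qoo h a0) ?gt_eqF//.
apply: mule_ge0; first by rewrite lee_fin invr_ge0; lra.
have := integral_powR_ge1 (ltW a1) h.
case: integral => [u| |]//=; rewrite lee_fin => u1.
by rewrite (lt_le_trans ltr01 u1) lee_fin ln_ge0.
Qed.

End renyi_ge0.

(** * Augustin means and tilted channels *)

Section conditional_renyi.
Context d (Y : measurableType d) (R : realType) (I : finType) (p : I -> R).
Local Notation meas := {measure set Y -> \bar R}.
Hypotheses (p0 : forall i, 0 < p i) (p1 : \sum_i p i = 1).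

(** The counterpart of [renyi_cond] over a finite index type. The weights are strictly positive
    throughout, so no product [0 * +oo] arises and a finite sum has finite terms. *)
Definition cond_renyi (a : R) (W : I -> meas) (Q : meas) : \bar R :=
  (\sum_i (p i)%:E * renyi a (W i) Q)%E.

Section lty.
Variables (a : R) (W : I -> meas) (Q : meas).
Hypotheses (a1 : 1 <= a) (W1 : forall i, W i setT = 1%E) (Q1 : Q setT = 1%E).

Lemma cond_renyi_ge0 : (0 <= cond_renyi a W Q)%E.
Proof.
apply: sume_ge0 => i _; apply: mule_ge0; first by rewrite lee_fin ltW.
exact: renyi_ge0.
Qed.

Lemma cond_renyi_lty i : (cond_renyi a W Q < +oo)%E -> (renyi a (W i) Q < +oo)%E.
Proof.
rewrite /cond_renyi (bigD1 i)//= => h; rewrite ltNge leye_eq; apply/negP => /eqP roo.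
move: h; rewrite roo gt0_muley ?lte_fin// addye ?ltxx//.
rewrite gt_eqF// (lt_le_trans ltNy0)//; apply: sume_ge0 => j _.
by apply: mule_ge0; [rewrite lee_fin ltW|exact: renyi_ge0].
Qed.

Lemma cond_renyi_fin (D : I -> R) : (forall i, renyi a (W i) Q = (D i)%:E) ->
  cond_renyi a W Q = (\sum_i p i * D i)%:E.
Proof.
move=> WD; rewrite /cond_renyi -sumEFin; apply: eq_bigr => i _.
by rewrite WD EFinM.
Qed.

End lty.

Lemma ae_has_dens (Q q : meas) (r : Y -> R) (P : Y -> Prop) : has_dens Q q r ->
  {ae q, forall y, P y} -> {ae Q, forall y, r y != 0 -> P y}.
Proof.
move=> [mr r0 rE] [N [mN N0 NP]].
have : ae_eq Q N (EFin \o r) (cst 0%E).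
  apply/ae_eq_integral_abs => //.
    by apply: measurable_funTS; exact/measurable_EFinP.
  transitivity (q N) => //; rewrite rE//; apply: eq_integral => y _.
  by rewrite gee0_abs// lee_fin.
apply: filterS => y Ny ry; apply: contrapT => nPy.
have /Ny /= [] : N y by exact: NP.
by move=> ry0; rewrite ry0 eqxx in ry.
Qed.

Lemma has_dens_ae_gt0 (Q q : meas) (r : Y -> R) : has_dens Q q r ->
  {ae q, forall y, 0 < r y}.
Proof.
move=> [mr r0 rE]; exists (r @^-1` [set 0]); split.
- by rewrite -[X in measurable X]setTI; exact: mr.
- rewrite rE; last by rewrite -[X in measurable X]setTI; exact: mr.
  apply: integral0_eq => y /= ->; by [].
- by move=> y /= /negP; rewrite -leNgt => ry; apply/eqP; rewrite eq_le ry r0.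
Qed.

Section mixture.
Variables (V : I -> meas) (q Q : meas) (v : I -> Y -> R).
Hypotheses (V1 : forall i, V i setT = 1%E) (q1 : q setT = 1%E) (Q1 : Q setT = 1%E).
Hypothesis hv : forall i, has_dens q (V i) (v i).
Hypothesis fix_q : {ae q, forall y, \sum_i p i * v i y = 1}.

(** By [fix_q], the measure [q] is the mixture of the [V i] with weights [p i]. *)
Lemma mixture_dominates : (forall i, V i `<< Q) -> q `<< Q.
Proof.
move=> VQ; apply/null_content_dominatesP => A mA QA.
have VA i : V i A = 0%E by move/null_content_dominatesP : (VQ i); apply.
transitivity (\int[q]_(y in A) cst 1 y)%E.
  by rewrite integral_cst// mul1e.
transitivity (\int[q]_(y in A) \sum_(i <- index_enum I) ((p i)%:E * (v i y)%:E))%E.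
  apply: ge0_ae_eq_integral => //.
  - apply: emeasurable_sum => i; apply: measurable_funeM.
    apply: measurable_funTS; apply/measurable_EFinP; exact: has_dens_measurable (hv i).
  - move=> y _; apply: sume_ge0 => i _.
    by rewrite -EFinM lee_fin mulr_ge0 ?(ltW (p0 i))//; exact: has_dens_ge0 (hv i) y.
  - apply: filterS fix_q => y <- _; rewrite -sumEFin.
    by apply: eq_bigr => i _; rewrite EFinM.
rewrite ge0_integral_sum//; last 2 first.
- move=> i; apply: measurable_funeM.
  apply: measurable_funTS; apply/measurable_EFinP; exact: has_dens_measurable (hv i).
- move=> i y _.
  by rewrite -EFinM lee_fin mulr_ge0 ?(ltW (p0 i))//; exact: has_dens_ge0 (hv i) y.
apply: big1 => i _; rewrite ge0_integralZl//; last 3 first.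
- apply: measurable_funTS; apply/measurable_EFinP; exact: has_dens_measurable (hv i).
- by move=> y _; rewrite lee_fin; exact: has_dens_ge0 (hv i) y.
- by rewrite lee_fin ltW.
by have [_ _ <-//] := hv i; rewrite VA mule0.
Qed.

(* The compensation identity sum_i p_i D(V_i|Q) = sum_i p_i D(V_i|q) + D(q|Q),
   with the last term bounded below through r ln r >= r - 1. *)
Lemma mixture_minimizes_kl :
  (forall i, q.-integrable setT (EFin \o (fun y => v i y * ln (v i y)))) ->
  ((\sum_i p i * \int[q]_y (v i y * ln (v i y)))%:E <= cond_renyi 1 V Q)%E.
Proof.
move=> jv; have [foo|foo] := ltP (cond_renyi 1 V Q) +oo%E; last first.
  by rewrite (le_trans _ foo)// leey.
have qoo := measure1_lty q1; have Qoo := measure1_lty Q1.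
have Voo i := measure1_lty (V1 i).
have fin i := cond_renyi_lty (lexx 1) V1 Q1 i foo.
have VQ i : V i `<< Q := renyi_lty_dominates (Voo i) Qoo (lexx 1) (fin i).
have [r hr] := dominates_has_dens qoo Qoo (mixture_dominates VQ).
have hu i := has_dens_chain (Voo i) qoo Qoo (hv i) hr.
pose D i := \int[Q]_y (v i y * r y * ln (v i y * r y)).
have finD i : renyi 1 (V i) Q \is a fin_num.
  by rewrite ge0_fin_numE//; exact: renyi_ge0.
have RD i : renyi 1 (V i) Q = (D i)%:E.
  rewrite -[LHS]fineK//; congr EFin.
  by rewrite (renyi1_has_dens (Voo i) Qoo (hu i)).
have mv i := has_dens_measurable (hv i).
have mr := has_dens_measurable hr.
have v0 i := has_dens_ge0 (hv i); have r0 := has_dens_ge0 hr.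
have ju i : Q.-integrable setT (EFin \o (fun y => v i y * r y * ln (v i y * r y))).
  apply: integral_fin_num_integrable.
    by apply: measurable_funM; [|apply: measurable_ln_comp]; exact: measurable_funM.
  by rewrite -(renyi1_has_dens (Voo i) Qoo (hu i)).
rewrite (cond_renyi_fin RD) lee_fin.
have jvr i := integrable_has_dens qoo Qoo hr (jv i).
have -> : \sum_i p i * \int[q]_y (v i y * ln (v i y)) =
    \sum_i \int[Q]_y (p i * (v i y * ln (v i y) * r y)).
  apply: eq_bigr => i _; rewrite RintegralZl//; last exact: (jvr i).1.
  by congr (_ * _); exact: (congr1 fine (jvr i).2).
have -> : \sum_i p i * D i =
    \sum_i \int[Q]_y (p i * (v i y * r y * ln (v i y * r y))).
  by apply: eq_bigr => i _; rewrite RintegralZl//; exact: ju.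
have [jA EA] := Rintegral_sum (fun i => integrable_realZ (p i) (jvr i).1).
have [jB EB] := Rintegral_sum (fun i => integrable_realZ (p i) (ju i)).
rewrite -EA -EB.
have jr := has_dens_integrable qoo hr.
have jr1 := integrable_realB jr (prob_integrable_cst Q1 1).
have E0 : \int[Q]_y (r y - 1) = 0.
  have := RintegralB measurableT jr (prob_integrable_cst Q1 1) => ->.
  by rewrite (has_dens_Rintegral q1 hr) (Rintegral_prob_cst Q1) subrr.
have EAr := RintegralD measurableT jA jr1.
rewrite -[leLHS]addr0 -[X in _ + X]E0 -[leLHS]EAr.
apply: (Rintegral_ae_le (integrable_realD jA jr1) jB).
have := ae_has_dens hr fix_q; apply: filterS => y fy /=.
(* Almost everywhere for [Q], the fixed point relation is known only where [r] is positive;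
   elsewhere both sums vanish and [r - 1] is negative. *)
have := r0 y; rewrite le_eqVlt => /predU1P[ry|ry].
  rewrite -ry big1 => [|i _]; last by rewrite !mulr0.
  rewrite big1 => [|i _]; last by rewrite mulr0 mul0r mulr0.
  by rewrite !add0r lerN10.
have {}fy : \sum_i p i * v i y = 1 by apply: fy; rewrite gt_eqF.
have -> : \sum_i p i * (v i y * r y * ln (v i y * r y)) =
    \sum_i p i * (v i y * ln (v i y) * r y) + r y * ln (r y).
  rewrite -[X in _ + X]mul1r -fy mulr_suml -big_split/=; apply: eq_bigr => i _.
  have := v0 i y; rewrite le_eqVlt => /predU1P[<-|vy]; first by rewrite !(mul0r,mulr0) addr0.
  by rewrite lnM ?posrE//; ring.
by rewrite lerD2l; exact: mul_ln_ge.
Qed.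

End mixture.

End conditional_renyi.

(** * Variational bound for a channel tilted towards a fixed point *)

Section tilted_channel.
Context d (Y : measurableType d) (R : realType) (I : finType) (p : I -> R).
Local Notation meas := {measure set Y -> \bar R}.
Hypotheses (p0 : forall i, 0 < p i) (p1 : \sum_i p i = 1).

Lemma norm_powR_ln_le (a x B : R) : 1 <= a -> 0 <= x -> x <= B -> 1 <= B ->
  `|x `^ a * ln x| <= B `^ a * B + 1.
Proof.
move=> a1 x0 xB B1; have B0 : 0 <= B by lra.
have BB : 0 <= B `^ a * B by rewrite mulr_ge0 ?powR_ge0.
move: x0; rewrite le_eqVlt => /predU1P[<-|x0].
  by rewrite powR0 ?mul0r ?normr0; lra.
rewrite normrM ger0_norm ?powR_ge0//.
have [x1|x1] := leP x 1.
  rewrite ler0_norm ?ln_le0// mulrN.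
  have : x `^ a <= x by rewrite ge1r_powR// x0.
  have l0 : 0 <= - ln x by rewrite oppr_ge0 ln_le0.
  move=> /(ler_wpM2r l0); have := mul_ln_ge (ltW x0); lra.
rewrite ger0_norm ?ln_ge0 ?(ltW x1)//.
apply: le_trans (_ : B `^ a * B <= _); last by lra.
apply: ler_pM; rewrite ?powR_ge0 ?ln_ge0 ?(ltW x1)//.
  by rewrite ge0_ler_powR ?nnegrE//; lra.
by rewrite (le_trans (ltW (ln_sublinear x0))).
Qed.

Variables (W V : I -> meas) (q : meas) (f : I -> Y -> R) (al : R) (c : I -> R).
Hypotheses (W1 : forall i, W i setT = 1%E) (V1 : forall i, V i setT = 1%E).
Hypotheses (q1 : q setT = 1%E) (al1 : 1 < al) (c0 : forall i, 0 < c i).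
Let v i y := c i * f i y `^ al.
Hypothesis hf : forall i, has_dens q (W i) (f i).
Hypothesis hv : forall i, has_dens q (V i) (v i).
Hypothesis fix_q : {ae q, forall y, \sum_i p i * v i y = 1}.

Let f0 i : forall y, 0 <= f i y := has_dens_ge0 (hf i).
Let mf i := has_dens_measurable (hf i).
Let v0 i : forall y, 0 <= v i y := has_dens_ge0 (hv i).
Let mv i := has_dens_measurable (hv i).
Let qoo := measure1_lty q1.
Let Woo i := measure1_lty (W1 i).
Let Voo i := measure1_lty (V1 i).

(** The fixed point equation bounds each [p i * v i] by [1], hence [f i ^ al] by [1 / (p i c i)].
    The summand [1] in [B] covers [f i <= 1], where [f i <= f i ^ al] may fail. *)
Lemma tilted_density_bounded :
  exists2 B, 1 <= B & {ae q, forall y, forall i, f i y <= B}.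
Proof.
pose B := 1 + \sum_i (p i * c i)^-1.
have pc i : 0 < p i * c i by rewrite mulr_gt0.
have B1 : 1 <= B by rewrite lerDl sumr_ge0// => i _; rewrite invr_ge0 ltW.
exists B => //; apply: filterS fix_q => y fy i.
have pv : p i * v i y <= 1.
  rewrite -fy (bigD1 i)//= lerDl sumr_ge0// => j _.
  by rewrite mulr_ge0// ltW.
have fB : f i y `^ al <= B.
  apply: le_trans (_ : (p i * c i)^-1 <= _).
    by rewrite -[leRHS]mul1r ler_pdivlMr// mulrC -mulrA.
  rewrite /B (bigD1 i)//= addrCA lerDl addr_ge0// sumr_ge0// => j _.
  by rewrite invr_ge0 ltW.
have [f1|f1] := leP (f i y) 1; first exact: le_trans B1.
by apply: le_trans fB; rewrite le1r_powR// ltW.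
Qed.

Lemma integrable_tilted_ln i :
  q.-integrable setT (EFin \o (fun y => v i y * ln (f i y))).
Proof.
have [B B1 fB] := tilted_density_bounded.
apply: (@ae_bounded_integrable _ _ _ _ _ (c i * (B `^ al * B + 1))) => //.
  by apply: measurable_funM => //; exact: measurable_ln_comp.
apply: filterS fB => y /(_ i) fy.
rewrite /v -mulrA normrM gtr0_norm// ler_pM2l//.
by apply: norm_powR_ln_le => //; exact: ltW.
Qed.

Let E i := \int[q]_y (v i y * ln (f i y)).

Let al0 : 0 < al. Proof. exact: lt_trans ltr01 al1. Qed.

Let v_eq0 i y : 0 = f i y -> v i y = 0.
Proof. by rewrite /v => <-; rewrite powR0 ?mulr0// gt_eqF. Qed.

Let v_ln_v i y : v i y * ln (v i y) = ln (c i) * v i y + al * (v i y * ln (f i y)).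
Proof.
have := f0 i y; rewrite le_eqVlt => /predU1P[fy|fy].
  by rewrite v_eq0// !(mulr0, mul0r) addr0.
by rewrite [in ln (v i y)]/v lnM ?posrE ?powR_gt0// ln_powR; ring.
Qed.

Let jv i : q.-integrable setT (EFin \o v i).
Proof. exact: has_dens_integrable (hv i). Qed.

Let iv i : \int[q]_y v i y = 1.
Proof. exact: (has_dens_Rintegral (V1 i) (hv i)). Qed.

Lemma integrable_tilted_entropy i :
  q.-integrable setT (EFin \o (fun y => v i y * ln (v i y))).
Proof.
have -> : (fun y => v i y * ln (v i y)) =
    fun y => ln (c i) * v i y + al * (v i y * ln (f i y)).
  by apply/funext => y; exact: v_ln_v.
apply: integrable_realD; first exact: (integrable_realZ _ (jv i)).
exact: (integrable_realZ _ (integrable_tilted_ln i)).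
Qed.

Lemma Rintegral_tilted_entropy i :
  \int[q]_y (v i y * ln (v i y)) = ln (c i) + al * E i.
Proof.
transitivity (\int[q]_y (ln (c i) * v i y + al * (v i y * ln (f i y)))).
  by apply: eq_Rintegral => y _; exact: v_ln_v.
have j1 := integrable_realZ (ln (c i)) (jv i).
have j2 := integrable_realZ al (integrable_tilted_ln i).
rewrite (RintegralD measurableT j1 j2) (RintegralZl _ measurableT (jv i)).
by rewrite (RintegralZl _ measurableT (integrable_tilted_ln i)) iv mulr1.
Qed.

(** The order-one conditional divergence of [V] from [q], written out with
    [ln v_i = ln c_i + al ln f_i]. *)
Definition tilted_information := \sum_i p i * (ln (c i) + al * E i).

Lemma cond_renyi_tilted : cond_renyi p 1 V q = tilted_information%:E.
Proof.
apply: cond_renyi_fin => i; rewrite (renyi1_has_dens (Voo i) qoo (hv i)).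
rewrite -Rintegral_tilted_entropy /Rintegral fineK//.
exact: (integrable_fin_num measurableT (integrable_tilted_entropy i)).
Qed.

Lemma tilted_information_le (Q : meas) : Q setT = 1%E ->
  (tilted_information%:E <= cond_renyi p 1 V Q)%E.
Proof.
move=> Q1; have := mixture_minimizes_kl p0 V1 q1 Q1 hv fix_q integrable_tilted_entropy.
apply: le_trans; rewrite lee_fin le_eqVlt; apply/orP; left; apply/eqP.
by apply: eq_bigr => i _; rewrite Rintegral_tilted_entropy.
Qed.

(* Convex duality: pointwise, [ln z <= z - 1] is applied to the density ratio
   of the tilted measures and to [1 / r], where [r = dq/dQ]. Equality forces both
   to be trivial, so that [f i] is constant on its support. *)
Lemma tilted_variational (b : R) (Q : meas) : Q setT = 1%E -> 1 < b ->
  ((\sum_i p i * ((b - al) * E i - ln (c i)))%:E <=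
     (b - 1)%:E * cond_renyi p b W Q)%E /\
  (b != al ->
   ((b - 1)%:E * cond_renyi p b W Q <=
     (\sum_i p i * ((b - al) * E i - ln (c i)))%:E)%E ->
   forall i, {ae q, forall y, v i y = f i y}).
Proof.
move=> Q1 b1; have b0 : 0 < b by lra.
have [foo|foo] := ltP (cond_renyi p b W Q) +oo%E; last first.
  have -> : cond_renyi p b W Q = +oo%E by apply/eqP; rewrite -leye_eq.
  rewrite gt0_muley; last by rewrite lte_fin subr_gt0.
  by rewrite leey; split => // _; rewrite leye_eq.
have Qoo := measure1_lty Q1.
have rfin i := cond_renyi_lty p0 (ltW b1) W1 Q1 i foo.
have WQ i : W i `<< Q := renyi_lty_dominates (Woo i) Qoo (ltW b1) (rfin i).
(* The density [v i] vanishes with [f i], so [V i] is dominated by [W i]. *)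
have VQ i : V i `<< Q.
  apply: null_dominates_trans (WQ i); apply/null_content_dominatesP => A mA WA.
  have [_ _ fE] := hf i; have [_ _ vE] := hv i.
  have fA0 : ae_eq q A (EFin \o f i) (cst 0%E).
    apply/ae_eq_integral_abs => //.
      by apply: measurable_funTS; exact/measurable_EFinP.
    transitivity (W i A) => //; rewrite fE//; apply: eq_integral => y _.
    by rewrite gee0_abs// lee_fin.
  transitivity (V i A) => //; rewrite vE//.
  transitivity (\int[q]_(y in A) (cst 0 y))%E; last exact: integral0.
  apply: ge0_ae_eq_integral => //.
  - by apply: measurable_funTS; exact/measurable_EFinP/mv.
  - by move=> y _; rewrite lee_fin v0.
  - apply: filterS fA0 => y /[apply] -[fy].
    by rewrite /= v_eq0.
have [r hr] := dominates_has_dens qoo Qoo (mixture_dominates p0 hv fix_q VQ).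
have mr := has_dens_measurable hr; have r0 := has_dens_ge0 hr.
have hw i := has_dens_chain (Woo i) qoo Qoo (hf i) hr.
(* With respect to [Q], [W i] has density [f i * r]; the power [b] of it, integrated against [Q],
   becomes [F i] integrated against [q]. *)
pose F i y := f i y `^ b * r y `^ (b - 1).
have F0 i y : 0 <= F i y by rewrite mulr_ge0 ?powR_ge0.
have mF i : measurable_fun setT (F i).
  by apply: measurable_funM; exact: measurable_powR_comp.
have FE i : (\int[q]_y (F i y)%:E = \int[Q]_y ((f i y * r y) `^ b)%:E)%E.
  rewrite (ge0_integral_has_dens qoo Qoo hr).
  - apply: eq_integral => y _; rewrite -EFinM; congr EFin.
    by rewrite /F -mulrA [X in _ * X]mulrC mulr_powRB1// powRM.
  - exact/measurable_EFinP.
  - by move=> y; rewrite lee_fin.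
have bn1 : b != 1 by rewrite gt_eqF.
have rE i := renyi_has_dens (Woo i) Qoo (hw i) b0 bn1.
have Z1 i : (1 <= \int[q]_y (F i y)%:E)%E.
  by rewrite FE; exact: (integral_powR_ge1 Q1 (W1 i) (ltW b1) (hw i)).
have bb : 0 < (b - 1)^-1 by rewrite invr_gt0 subr_gt0.
have Zoo i : (\int[q]_y (F i y)%:E < +oo)%E.
  rewrite ltNge leye_eq; apply/negP => /eqP Zy; have := rfin i.
  by rewrite rE -FE Zy /= gt0_muley ?lte_fin// ltxx.
have Zfin i : (\int[q]_y (F i y)%:E)%E \is a fin_num.
  by rewrite ge0_fin_numE// (le_trans _ (Z1 i)).
pose Z i := \int[q]_y F i y.
have ZE i : (\int[q]_y (F i y)%:E)%E = (Z i)%:E by rewrite /Z /Rintegral fineK.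
have Zge1 i : 1 <= Z i by rewrite -lee_fin -ZE.
have Z0 i : 0 < Z i by apply: lt_le_trans (Zge1 i).
have renyiZ i : renyi b (W i) Q = ((b - 1)^-1 * ln (Z i))%:E.
  by rewrite rE -FE ZE /= Z0 EFinM.
rewrite (cond_renyi_fin p renyiZ) -EFinM.
have -> : (b - 1) * (\sum_i p i * ((b - 1)^-1 * ln (Z i))) = \sum_i p i * ln (Z i).
  rewrite mulr_sumr; apply: eq_bigr => i _.
  by field; rewrite subr_eq0.
have jF i : q.-integrable setT (EFin \o F i).
  by apply: integral_fin_num_integrable.
(* The integral is the [Q]-mass of the set where [r] is positive; it can be less than one because
   [q] need not dominate [Q]. *)
have [jri ri1] : q.-integrable setT (EFin \o (fun y => (r y)^-1)) /\
    \int[q]_y (r y)^-1 <= 1.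
  have mri : measurable_fun setT (fun y => (r y)^-1).
    under eq_fun do rewrite -powR_inv1//.
    exact: measurable_powR_comp.
  have h : (\int[q]_y ((r y)^-1)%:E <= 1)%E.
    rewrite (ge0_integral_has_dens qoo Qoo hr)//.
    - rewrite -[leRHS]Q1 -[leRHS]mul1e -integral_cst//.
      apply: ge0_le_integral => //.
      + by move=> y _; rewrite -EFinM lee_fin mulr_ge0// invr_ge0.
      + apply: emeasurable_funM; exact/measurable_EFinP.
      + move=> y _; rewrite -EFinM lee_fin.
        by have [->|ry] := eqVneq (r y) 0; rewrite ?mulr0// mulVf.
    - exact/measurable_EFinP.
    - by move=> y; rewrite lee_fin invr_ge0.
  have hfin : (\int[q]_y ((r y)^-1)%:E)%E \is a fin_num.
    rewrite ge0_fin_numE; first exact: le_lt_trans (ltry 1).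
    by apply: integral_ge0 => y _; rewrite lee_fin invr_ge0.
  split; first exact: integral_fin_num_integrable.
  by rewrite -lee_fin /Rintegral fineK.
pose T i y := F i y / Z i - v i y + v i y * ln (Z i)
              - (v i y * ((b - al) * ln (f i y)) - ln (c i) * v i y).
pose Phi y := \sum_i p i * T i y + (b - 1) * ((r y)^-1 - 1).
have j1 i := integrable_realZ ((Z i)^-1) (jF i).
have j2 i := integrable_realZ (ln (Z i) - 1 + ln (c i)) (jv i).
have j3 i := integrable_realZ (b - al) (integrable_tilted_ln i).
have TE i : T i = fun y => (Z i)^-1 * F i y + (ln (Z i) - 1 + ln (c i)) * v i y
    - (b - al) * (v i y * ln (f i y)).
  by apply/funext => y; rewrite /T; ring.
have jT i : q.-integrable setT (EFin \o T i).
  by rewrite TE; exact: (integrable_realB (integrable_realD (j1 i) (j2 i)) (j3 i)).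
have iT i : \int[q]_y T i y = ln (Z i) - ((b - al) * E i - ln (c i)).
  rewrite TE (RintegralB measurableT (integrable_realD (j1 i) (j2 i)) (j3 i)).
  rewrite (RintegralD measurableT (j1 i) (j2 i)) (RintegralZl _ measurableT (jF i)).
  rewrite (RintegralZl _ measurableT (jv i)) (RintegralZl _ measurableT (integrable_tilted_ln i)).
  by rewrite iv -/(Z i) mulVf ?gt_eqF// -/(E i); ring.
have [jS iS] := Rintegral_sum (fun i => integrable_realZ (p i) (jT i)).
have jr1 := integrable_realB jri (prob_integrable_cst q1 1).
have jr2 := integrable_realZ (b - 1) jr1.
have jPhi : q.-integrable setT (EFin \o Phi) := integrable_realD jS jr2.
have iPhi : \int[q]_y Phi y <= \sum_i p i * ln (Z i)
    - \sum_i p i * ((b - al) * E i - ln (c i)).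
  rewrite (RintegralD measurableT jS jr2) iS (RintegralZl _ measurableT jr1).
  have -> := RintegralB measurableT jri (prob_integrable_cst q1 1).
  rewrite (Rintegral_prob_cst q1) -sumrB.
  have -> : \sum_i \int[q]_y (p i * T i y) =
      \sum_i (p i * ln (Z i) - p i * ((b - al) * E i - ln (c i))).
    by apply: eq_bigr => i _; rewrite (RintegralZl _ measurableT (jT i)) iT mulrBr.
  have : (b - 1) * (\int[q]_y (r y)^-1 - 1) <= 0.
    by rewrite mulr_ge0_le0 ?subr_le0//; lra.
  by move=> h; rewrite -[leRHS]addr0 lerD2l.
(* This is [T] with the term [(b - 1) v_i ln r] subtracted; it is nonnegative by [ln x <= x - 1] at
   the ratio of the order [b] tilt to [V i]. *)
pose T' i y := F i y / Z i - v i y - v i y * ln (F i y / (Z i * v i y)).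
have T'0 i y : 0 < r y -> 0 <= T' i y.
  move=> ry; have := f0 i y; rewrite le_eqVlt => /predU1P[fy|fy].
    by rewrite /T' v_eq0// /F -fy powR0 ?gt_eqF// !(mulr0, mul0r) !subr0.
  have vy : 0 < v i y by rewrite mulr_gt0 ?powR_gt0.
  have Fy : 0 < F i y by rewrite mulr_gt0 ?powR_gt0.
  have FZv : 0 < F i y / (Z i * v i y) by apply: divr_gt0 => //; exact: mulr_gt0.
  have := ler_wpM2l (ltW vy) (ln_le_subr1 FZv).
  rewrite mulrBr mulr1 (_ : v i y * (F i y / (Z i * v i y)) = F i y / Z i); last first.
    by field; rewrite !gt_eqF.
  rewrite /T'; lra.
have T0 y : 0 < r y -> 0 <= (r y)^-1 - 1 + ln (r y).
  move=> ry; have := @ln_le_subr1 R (r y)^-1.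
  by rewrite invr_gt0 => /(_ ry); rewrite lnV ?posrE//; lra.
have PhiE : {ae q, forall y, 0 < r y /\ Phi y =
    \sum_i p i * T' i y + (b - 1) * ((r y)^-1 - 1 + ln (r y))}.
  have := has_dens_ae_gt0 hr; move: fix_q; apply: filterS2 => y fy ry; split => //.
  have -> : (b - 1) * ((r y)^-1 - 1 + ln (r y)) =
      \sum_i p i * v i y * ((b - 1) * ln (r y)) + (b - 1) * ((r y)^-1 - 1).
    by rewrite -mulr_suml fy; ring.
  rewrite /Phi addrA -big_split/=; congr (_ + _); apply: eq_bigr => i _.
  rewrite -mulrA -mulrDr; congr (_ * _).
  have := f0 i y; rewrite le_eqVlt => /predU1P[fy0|fy0].
    by rewrite /T' /T v_eq0//; ring.
  have vy : 0 < v i y by rewrite mulr_gt0 ?powR_gt0.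
  have Fy : 0 < F i y by rewrite mulr_gt0 ?powR_gt0.
  have e1 : ln (F i y) = b * ln (f i y) + (b - 1) * ln (r y).
    by rewrite /F lnM ?ln_powR// posrE powR_gt0.
  have e2 : ln (v i y) = ln (c i) + al * ln (f i y).
    by rewrite /v lnM ?ln_powR// posrE ?powR_gt0.
  have e3 : ln (Z i * v i y) = ln (Z i) + ln (v i y) by apply: lnM; rewrite posrE.
  have e4 : ln (F i y / (Z i * v i y)) = ln (F i y) - ln (Z i * v i y).
    by apply: ln_div; rewrite posrE//; exact: mulr_gt0.
  by rewrite /T' e4 e3 e2 e1 /T; ring.
have Phi0 : {ae q, forall y, 0 <= Phi y}.
  apply: filterS PhiE => y [ry ->]; apply: addr_ge0.
    by apply: sumr_ge0 => i _; rewrite mulr_ge0 ?T'0// ltW.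
  by apply: mulr_ge0; [lra|exact: T0].
have iPhi0 : 0 <= \int[q]_y Phi y.
  have := Rintegral_ae_le (prob_integrable_cst q1 0) jPhi Phi0.
  by rewrite (Rintegral_prob_cst q1).
split; first by rewrite lee_fin; lra.
move=> bal; rewrite lee_fin => Eq i.
have Phi_eq0 : {ae q, forall y, Phi y = 0}.
  by apply: Rintegral_le0_ae => //; lra.
(* Equality gives [r = 1] and [f_i^b = Z_i v_i] where [f_i > 0], hence [f_i^(b - al) = Z_i c_i]
   there. So [v_i = c_i f_i^(al - 1) f_i] is the multiple [m] of [f_i], and [m = 1] since both have
   mean one. *)
pose m := c i * (Z i * c i) `^ ((b - al)^-1 * (al - 1)).
have vm : {ae q, forall y, v i y = m * f i y}.
  move: PhiE Phi_eq0; apply: filterS2 => y [ry ->] Phiy0.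
  have := f0 i y; rewrite le_eqVlt => /predU1P[fy|fy].
    by rewrite v_eq0// -fy mulr0.
  have S0 : 0 <= \sum_i p i * T' i y.
    by apply: sumr_ge0 => j _; rewrite mulr_ge0 ?T'0// ltW.
  have R0 : 0 <= (b - 1) * ((r y)^-1 - 1 + ln (r y)).
    by rewrite mulr_ge0 ?T0//; lra.
  have r1 : r y = 1.
    have : (b - 1) * ((r y)^-1 - 1 + ln (r y)) = 0 by lra.
    move=> /eqP; rewrite mulf_eq0 subr_eq0 (negbTE bn1)/= => /eqP h.
    have : (r y)^-1 = 1.
      by apply: ln_eq_subr1; rewrite ?invr_gt0// lnV ?posrE//; lra.
    by move=> /(congr1 (@GRing.inv _)); rewrite invrK invr1.
  have T'i : T' i y = 0.
    have : \sum_i p i * T' i y = 0 by lra.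
    move=> /eqP; rewrite psumr_eq0 => [/allP|j _]; last by rewrite mulr_ge0 ?T'0// ltW.
    move=> /(_ i); rewrite mem_index_enum => /(_ isT)/=.
    by rewrite mulf_eq0 gt_eqF//= => /eqP.
  have vy : 0 < v i y by rewrite mulr_gt0 ?powR_gt0.
  have Fy : 0 < F i y by rewrite mulr_gt0 ?powR_gt0.
  have FZ : F i y / (Z i * v i y) = 1.
    apply: ln_eq_subr1; first by apply: divr_gt0 => //; exact: mulr_gt0.
    apply: (mulfI (lt0r_neq0 vy)).
    have -> : v i y * (F i y / (Z i * v i y) - 1) = F i y / Z i - v i y.
      by field; rewrite !gt_eqF.
    by move: T'i; rewrite /T'; lra.
  have fb : f i y `^ (b - al) = Z i * c i.
    have : F i y = Z i * v i y.
      by rewrite -[RHS]mul1r -FZ divfK// mulf_neq0// gt_eqF.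
    rewrite /F r1 powR1 mulr1 /v mulrA => h.
    apply: (mulIf (_ : f i y `^ al != 0)); first by rewrite gt_eqF// powR_gt0.
    by rewrite -powRD ?subrK// (gt_eqF fy) implybT.
  rewrite /m -fb -powRrM mulrA mulfV ?subr_eq0// mul1r -mulrA.
  by rewrite [X in _ * X]mulrC mulr_powRB1 ?f0//; lra.
have m1 : m = 1.
  have := Rintegral_ae_eq (jv i) (integrable_realZ m (has_dens_integrable (Woo i) (hf i))) vm.
  rewrite iv (RintegralZl _ measurableT (has_dens_integrable (Woo i) (hf i))).
  by rewrite (has_dens_Rintegral (W1 i) (hf i)) mulr1.
by apply: filterS vm => y ->; rewrite m1 mul1r.
Qed.

End tilted_channel.

(** * First order condition for the Augustin mean *)

Section augustin_fixed_point.
Context d (Y : measurableType d) (R : realType) (I : finType) (p : I -> R).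
Local Notation meas := {measure set Y -> \bar R}.
Hypotheses (p0 : forall i, 0 < p i) (p1 : \sum_i p i = 1).

Lemma has_dens_div (q Q W : meas) (m f : Y -> R) : (q setT < +oo)%E ->
  (Q setT < +oo)%E -> has_dens q Q m -> (forall y, m y = 0 -> f y = 0) ->
  has_dens q W f -> has_dens Q W (fun y => f y * (m y)^-1).
Proof.
move=> qoo Qoo hm fm0 hf; have mm := has_dens_measurable hm.
have m0 := has_dens_ge0 hm.
have mf := has_dens_measurable hf; have f0 := has_dens_ge0 hf.
have mfm : measurable_fun setT (fun y => f y * (m y)^-1).
  apply: measurable_funM => //; under eq_fun do rewrite -powR_inv1 ?m0//.
  exact: measurable_powR_comp.
split => //; first by move=> y; rewrite divr_ge0.
move=> A mA; rewrite integral_mkcond (ge0_integral_has_dens Qoo qoo hm).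
- have [_ _ ->//] := hf; rewrite integral_mkcond; apply: eq_integral => y _.
  rewrite !patchE; case: ifPn; rewrite ?mul0e// -EFinM => _; congr EFin.
  by have [my|my] := eqVneq (m y) 0; [rewrite my mulr0 fm0|rewrite divfK].
- by apply/measurable_restrict => //; apply: measurable_funTS; exact/measurable_EFinP.
- by move=> y; rewrite patchE; case: ifPn => // _; rewrite lee_fin divr_ge0.
Qed.

(** For [s <= 1] Young's inequality at [c = 1 / 2], for [s > 1] Bernoulli's at [c = 1 / (2 s)], so
    that the harmonic expression [2 x / (1 + x)] appears either way. It lies below [(1 + x) / 2] by
    exactly [(x - 1)^2 / (2 (1 + x))], and this deficit detects [x != 1]. *)
Lemma perturbation_bound (s : R) : 0 < s -> exists k c : R,
  [/\ 0 < k <= 1, 0 < c < 1 & forall x, 0 <= x ->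
    x * (1 - c + c * x) `^ (- s) <= (1 - k) * x + k * (2 * x / (1 + x))].
Proof.
move=> s0; have [s1|s1] := leP s 1.
  exists s, 2^-1; split; [by rewrite s0|by apply/andP; split; lra|move=> x x0].
  have m0 : 0 < 1 - 2^-1 + 2^-1 * x by lra.
  have := @powR_le_affine R s (1 - 2^-1 + 2^-1 * x)^-1.
  rewrite (ltW s0) s1 invr_ge0 (ltW m0) => /(_ isT isT) /(ler_wpM2l x0).
  set m := 1 - _ + _ in m0 *.
  have -> : m `^ (- s) = m^-1 `^ s by rewrite -[m^-1]powR_inv1 1?ltW// -powRrM mulN1r.
  move=> h; apply: le_trans h _; rewrite /m le_eqVlt; apply/orP; left; apply/eqP.
  by field; rewrite !gt_eqF//; lra.
exists 1, (2 * s)^-1.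
have ss : (2 * s)^-1 * s = 2^-1 by field; rewrite gt_eqF.
have c0 : 0 < (2 * s)^-1 by rewrite invr_gt0; lra.
have c1 : (2 * s)^-1 < 1 by rewrite invf_lt1; lra.
split; [by apply/andP; split; lra|by rewrite c0|move=> x x0].
rewrite subrr mul0r add0r mul1r.
set c := (2 * s)^-1 in ss c0 c1 *.
have cx : 0 <= c * x by rewrite mulr_ge0// ltW.
have m0 : 0 < 1 - c + c * x by lra.
have := powR_ge_affine (ltW s1) (ltW m0).
have -> : 1 + s * (1 - c + c * x - 1) = 2^-1 * (1 + x).
  by rewrite -[RHS]/(2^-1 * (1 + x)) -ss; lra.
move=> h; rewrite powRN ler_pdivrMr ?powR_gt0//.
have -> : 2 * x / (1 + x) * (1 - c + c * x) `^ s =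
    (x / (1 + x)) * (2 * (1 - c + c * x) `^ s) by ring.
have x1 : 0 < 1 + x by lra.
apply: le_trans (_ : (x / (1 + x)) * (1 + x) <= _).
  by rewrite divfK// gt_eqF.
by apply: ler_wpM2l; [rewrite divr_ge0// ltW|lra].
Qed.

Variables (W : I -> meas) (q : meas) (f : I -> Y -> R) (al : R) (z : I -> R).
Hypotheses (W1 : forall i, W i setT = 1%E) (q1 : q setT = 1%E) (al1 : 1 < al).
Hypothesis hf : forall i, has_dens q (W i) (f i).
Hypothesis hz : forall i, (\int[q]_y (f i y `^ al)%:E)%E = (z i)%:E.
Hypothesis q_min : forall Q : probability Y R,
  (cond_renyi p al W q <= cond_renyi p al W Q)%E.
Let v i y := (z i)^-1 * f i y `^ al.

Let qoo := measure1_lty q1.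
Let Woo i := measure1_lty (W1 i).
Let f0 i : forall y, 0 <= f i y := has_dens_ge0 (hf i).
Let mf i := has_dens_measurable (hf i).

Lemma tilt_normalization_ge1 i : 1 <= z i.
Proof.
rewrite -lee_fin -hz.
exact: (integral_powR_ge1 q1 (W1 i) (ltW al1) (hf i)).
Qed.

Let z0 i : 0 < z i. Proof. exact: lt_le_trans (tilt_normalization_ge1 i). Qed.
Let mv i : measurable_fun setT (v i).
Proof. by apply: measurable_funM => //; exact: measurable_powR_comp. Qed.
Let v0 i y : 0 <= v i y.
Proof. by rewrite mulr_ge0 ?powR_ge0 ?invr_ge0 ?(ltW (z0 i)). Qed.
Let al0 : 0 < al. Proof. exact: lt_trans ltr01 al1. Qed.

Let jf i : q.-integrable setT (EFin \o (fun y => f i y `^ al)).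
Proof.
apply: integral_fin_num_integrable; first exact: measurable_powR_comp.
by rewrite hz.
Qed.
Let jv i : q.-integrable setT (EFin \o v i).
Proof. exact: integrable_realZ. Qed.
Let iv i : \int[q]_y v i y = 1.
Proof.
rewrite (RintegralZl _ measurableT (jf i)) [X in _ * X](_ : _ = z i).
  by rewrite mulVf// gt_eqF.
by rewrite /Rintegral hz.
Qed.

(* Otherwise [((1 - c) + c * phi) q], with [phi = sum_i p_i v_i], would have a
   smaller conditional divergence than [q] for some [c]. *)
Lemma augustin_fixed_point : {ae q, forall y, \sum_i p i * v i y = 1}.
Proof.
have s0 : 0 < al - 1 by rewrite subr_gt0.
have [k [c [/andP[k0 k1] /andP[c0 c1] H]]] := perturbation_bound s0.
pose phi y := \sum_i p i * v i y.
have phi0 y : 0 <= phi y by apply: sumr_ge0 => i _; rewrite mulr_ge0// ltW.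
have [jphi iphi] := Rintegral_sum (fun i => integrable_realZ (p i) (jv i)).
have {}iphi : \int[q]_y phi y = 1.
  rewrite iphi -p1; apply: eq_bigr => i _.
  by rewrite (RintegralZl _ measurableT (jv i)) iv mulr1.
have {}jphi : q.-integrable setT (EFin \o phi) := jphi.
have mphi : measurable_fun setT phi by apply/measurable_EFinP; exact: measurable_int jphi.
pose m y := 1 - c + c * phi y.
have m0 y : 0 < m y by rewrite ltr_pwDl ?mulr_ge0 ?(ltW c0)// subr_gt0.
have mm : measurable_fun setT m by apply: measurable_funD => //; exact: measurable_funM.
have hm := @mdens_has_dens _ _ _ q (EFin \o m) m mm (fun y => ltW (m0 y)) (fun=> erefl).
have jc a := prob_integrable_cst q1 a.
have jm : q.-integrable setT (EFin \o m).
  exact: (integrable_realD (jc (1 - c)) (integrable_realZ c jphi)).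
have im : \int[q]_y m y = 1.
  rewrite (RintegralD measurableT (jc (1 - c)) (integrable_realZ c jphi)).
  by rewrite (Rintegral_prob_cst q1) (RintegralZl _ measurableT jphi) iphi; lra.
have [Q QE] : exists Q : probability Y R, Q = mdens q (EFin \o m) :> (set Y -> \bar R).
  apply: probability_copy; rewrite -(has_dens_setT hm).
  rewrite -[LHS]fineK ?(integrable_fin_num measurableT jm)//.
  by rewrite -[X in X%:E]/(\int[q]_y m y) im.
have hQ : has_dens q Q m.
  by case: hm => h1 h2 h3; split => // A mA; rewrite -h3//; exact: (congr1 (fun F : set Y -> \bar R => F A) QE).
have Q1 : Q setT = 1%E := probability_setT Q.
have Qoo := measure1_lty Q1.
have mn0 i y : m y = 0 -> f i y = 0 by move=> my; have := m0 y; rewrite my ltxx.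
have hW i := has_dens_div qoo Qoo hQ (mn0 i) (hf i).
have mpow a : measurable_fun setT (fun y => m y `^ a) by exact: measurable_powR_comp.
(* The negative power is bounded since [m >= 1 - c > 0]. *)
have jvm i : q.-integrable setT (EFin \o (fun y => v i y * m y `^ (- (al - 1)))).
  apply: (@le_integrable _ _ _ _ _ measurableT _
      (EFin \o (fun y => (1 - c) `^ (- (al - 1)) * v i y))).
  - by apply/measurable_EFinP; exact: measurable_funM.
  - move=> y _ /=; rewrite lee_fin ger0_norm; last first.
      by apply: mulr_ge0 => //; exact: powR_ge0.
    rewrite ger0_norm; last by apply: mulr_ge0 => //; exact: powR_ge0.
    rewrite mulrC; apply: ler_wpM2r => //.
    rewrite !powRN lef_pV2 ?posrE ?powR_gt0 ?subr_gt0//.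
    apply: ge0_ler_powR; rewrite ?nnegrE ?(ltW s0) ?(ltW (m0 y)) ?subr_ge0 ?(ltW c1)//.
    by rewrite lerDl mulr_ge0// ltW.
  - exact: (integrable_realZ ((1 - c) `^ (- (al - 1))) (jv i)).
(* The factor by which the power integral [z i] changes when [q] is replaced by [Q]. *)
pose B i := \int[q]_y (v i y * m y `^ (- (al - 1))).
have EB i : (\int[Q]_y ((f i y * (m y)^-1) `^ al)%:E)%E = (z i * B i)%:E.
  rewrite (ge0_integral_has_dens Qoo qoo hQ).
  - rewrite EFinM /B /Rintegral fineK ?(integrable_fin_num measurableT (jvm i))//.
    rewrite -ge0_integralZl//.
    + apply: eq_integral => y _; rewrite -!EFinM; congr EFin.
      rewrite /v -mulrA mulVKf ?gt_eqF// powRM ?invr_ge0 ?(ltW (m0 y))//.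
      rewrite -mulrA; congr (_ * _); rewrite -powR_inv1 ?(ltW (m0 y))// -powRrM.
      rewrite -[X in _ * X](@powRr1 R (m y)) ?(ltW (m0 y))// -powRD ?(gt_eqF (m0 y)) ?implybT//.
      by congr (_ `^ _); ring.
    + by apply/measurable_EFinP; exact: measurable_funM.
    + by move=> y _; rewrite lee_fin; apply: mulr_ge0 => //; exact: powR_ge0.
    + by rewrite lee_fin ltW.
  - by apply/measurable_EFinP; apply: measurable_powR_comp; exact: has_dens_measurable (hW i).
  - by move=> y; rewrite lee_fin powR_ge0.
have B0 i : 0 < B i.
  have := integral_powR_ge1 Q1 (W1 i) (ltW al1) (hW i).
  by rewrite EB lee_fin => /(lt_le_trans ltr01); rewrite pmulr_rgt0.
have aln1 : al != 1 by rewrite gt_eqF.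
have rQ i : renyi al (W i) Q = ((al - 1)^-1 * (ln (z i) + ln (B i)))%:E.
  rewrite (renyi_has_dens (Woo i) Qoo (hW i) al0 aln1) EB /=.
  by rewrite mulr_gt0// lnM ?posrE// EFinM.
have rq i : renyi al (W i) q = ((al - 1)^-1 * ln (z i))%:E.
  by rewrite (renyi_has_dens (Woo i) qoo (hf i) al0 aln1) hz /= z0 EFinM.
have := q_min Q; rewrite (cond_renyi_fin p rQ) (cond_renyi_fin p rq) lee_fin => qQ.
have lnB : 0 <= \sum_i p i * ln (B i).
  have : \sum_i p i * ((al - 1)^-1 * (ln (z i) + ln (B i))) =
     \sum_i p i * ((al - 1)^-1 * ln (z i)) + (al - 1)^-1 * \sum_i p i * ln (B i).
    by rewrite mulr_sumr -big_split/=; apply: eq_bigr => i _; ring.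
  move=> e; move: qQ; rewrite e lerDl pmulr_rge0// invr_gt0//.
have B1 : 1 <= \sum_i p i * B i.
  have : \sum_i p i * ln (B i) <= \sum_i p i * (B i - 1).
    by apply: ler_sum => i _; rewrite ler_wpM2l ?(ltW (p0 i))// ln_le_subr1.
  have -> : \sum_i p i * (B i - 1) = \sum_i p i * B i - 1.
    by rewrite -[X in _ = _ - X]p1 -sumrB; apply: eq_bigr => i _; ring.
  by lra.
have [jS iS] := Rintegral_sum (fun i => integrable_realZ (p i) (jvm i)).
have iSB : \int[q]_y (phi y * m y `^ (- (al - 1))) = \sum_i p i * B i.
  have -> : \sum_i p i * B i = \sum_i \int[q]_y (p i * (v i y * m y `^ (- (al - 1)))).
    by apply: eq_bigr => i _; rewrite (RintegralZl _ measurableT (jvm i)).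
  rewrite -iS; apply: eq_Rintegral => y _; rewrite mulr_suml.
  by apply: eq_bigr => i _; rewrite -mulrA.
have jpm : q.-integrable setT (EFin \o (fun y => phi y * m y `^ (- (al - 1)))).
  have -> : (fun y => phi y * m y `^ (- (al - 1))) =
    fun y => \sum_i p i * (v i y * m y `^ (- (al - 1))).
    by apply/funext => y; rewrite mulr_suml; apply: eq_bigr => i _; rewrite -mulrA.
  exact: jS.
(* Minimality of [q] gives [sum_i p_i ln B_i >= 0], hence [sum_i p_i B_i >= 1], whereas
   [perturbation_bound] at [x = phi] gives [sum_i p_i B_i <= 1 - (k / 2) int h]. So [h] vanishes
   almost everywhere. *)
pose h y := (phi y - 1) ^+ 2 * (1 + phi y)^-1.
have ph1 y : 0 < 1 + phi y by rewrite ltr_pwDl.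
have mh : measurable_fun setT h.
  apply: measurable_funM; last exact: measurable_fun_inv1D.
  by apply: measurable_funX; exact: measurable_funB.
have h0 y : 0 <= h y by rewrite mulr_ge0 ?sqr_ge0// invr_ge0 ltW.
have jh : q.-integrable setT (EFin \o h).
  apply: (@le_integrable _ _ _ _ _ measurableT _ (EFin \o (fun y => 1 + phi y))).
  - exact/measurable_EFinP.
  - move=> y _ /=; rewrite lee_fin !ger0_norm ?(ltW (ph1 y))//.
    rewrite /h ler_pdivrMr// -expr2 -subr_ge0.
    by rewrite (_ : _ - _ = 4 * phi y) ?mulr_ge0//; ring.
  - exact: (integrable_realD (jc 1) jphi).
have j2 : q.-integrable setT (EFin \o (fun y => 1 - k / 2 + (- (k / 2) * h y))).
  exact: (integrable_realD (jc (1 - k / 2)) (integrable_realZ (- (k / 2)) jh)).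
have j3 := integrable_realD (integrable_realZ (1 - k / 2) jphi)
  (integrable_realD (jc (k / 2)) (integrable_realZ (- (k / 2)) jh)).
have := @Rintegral_ae_le _ _ _ q _ _ jpm j3.
rewrite iSB (RintegralD measurableT (integrable_realZ (1 - k / 2) jphi)
  (integrable_realD (jc (k / 2)) (integrable_realZ (- (k / 2)) jh))).
rewrite (RintegralD measurableT (jc (k / 2)) (integrable_realZ (- (k / 2)) jh)).
rewrite (RintegralZl _ measurableT jphi) (RintegralZl _ measurableT jh).
rewrite (Rintegral_prob_cst q1) iphi => le.
have ih : \int[q]_y h y <= 0.
  have : \sum_i p i * B i <= (1 - k / 2) * 1 + (k / 2 + - (k / 2) * \int[q]_y h y).
    apply: le; apply: aeW => y /=; have := H _ (phi0 y); rewrite -/(m y).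
    move=> /le_trans; apply; rewrite le_eqVlt; apply/orP; left; apply/eqP.
    by rewrite /h /cst/=; move: (phi y) (ph1 y) => u u1; field; rewrite gt_eqF.
  move=> le'; rewrite leNgt; apply/negP => ih0.
  have := le_trans B1 le'; rewrite mulr1 mulNr addrA subrK lerBrDr gerDl leNgt.
  by rewrite mulr_gt0// divr_gt0.
have := Rintegral_le0_ae jh (aeW _ h0) ih.
apply: filterS => y /eqP; rewrite mulf_eq0 invr_eq0 (gt_eqF (ph1 y)) orbF.
by rewrite sqrf_eq0 subr_eq0 => /eqP.
Qed.

End augustin_fixed_point.

Section power_expansion.
Context {R : realType}.

Lemma expR_le_quadratic (y : R) : expR y <= 1 + y + y ^+ 2 * expR `|y|.
Proof.
have h (x : R) : expR x - 1 <= x * expR x.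
  have := expR_ge1Dx (- x); rewrite -(ler_pM2r (expR_gt0 x)) -expRD addNr expR0; lra.
have [y0|y0] := leP 0 y.
  rewrite ger0_norm//; have := ler_wpM2l y0 (h y); have := h y; lra.
have y0' : 0 <= - y by lra.
have := expR_ge1Dx y => h1; have := ler_wpM2l y0' h1; have := h y.
have : y ^+ 2 * 1 <= y ^+ 2 * expR `|y|.
  by rewrite ler_wpM2l ?sqr_ge0// -expR0 ler_expR.
lra.
Qed.

(** The remainder is [x^a l^2 e^|t l|] with [l = ln x]. Below [1], [l^2 <= 16 e^(- l / 2)] and
    [e^|t l| <= e^(- l / 4)], and [x^a <= e^l] absorbs both, whence [16]. Above [1], [l <= B] and
    [e^|t l| <= x <= B], whence the second term. *)
Lemma powR_le_expansion (a t x B : R) : 1 <= a -> `|t| <= 4^-1 -> 0 <= x -> x <= B ->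
  1 <= B -> x `^ (a + t) <= x `^ a + t * (x `^ a * ln x) + (16 + B `^ a * B ^+ 3) * t ^+ 2.
Proof.
move=> a1 t4 x0 xB B1; have B0 : 0 <= B by lra.
have K0 : 0 <= B `^ a * B ^+ 3 by rewrite mulr_ge0 ?powR_ge0 ?exprn_ge0.
have at0 : a + t != 0 by move: t4; rewrite ler_norml => /andP[? ?]; rewrite gt_eqF//; lra.
have t2 : 0 <= t ^+ 2 := sqr_ge0 t.
move: x0; rewrite le_eqVlt => /predU1P[<-|x0].
  have an0 : a != 0 by rewrite gt_eqF//; lra.
  by rewrite !powR0// mul0r mulr0 !add0r mulr_ge0//; lra.
rewrite powRD; last by rewrite (gt_eqF x0) implybT.
set l := ln x.
have xa : 0 < x `^ a by rewrite powR_gt0.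
have -> : x `^ t = expR (t * l) by rewrite /powR gt_eqF.
have := ler_wpM2l (ltW xa) (expR_le_quadratic (t * l)).
move=> /le_trans; apply.
suff : x `^ a * (l ^+ 2 * expR `|t * l|) <= 16 + B `^ a * B ^+ 3.
  by move=> /(ler_wpM2l t2); rewrite exprMn; lra.
have e20 : 0 <= l ^+ 2 * expR `|t * l|.
  by apply: mulr_ge0; [exact: sqr_ge0|exact: expR_ge0].
have [x1|x1] := leP x 1.
  have l0 : l <= 0 by rewrite /l ln_le0.
  have xE : expR l = x by rewrite /l lnK ?posrE.
  apply: le_trans (_ : expR l * (16 * expR (- l / 4) ^+ 2 * expR (- l / 4)) <= _).
    apply: ler_pM => //; first exact: powR_ge0.
      by rewrite xE ge1r_powR// x0.
    apply: ler_pM; [exact: sqr_ge0|exact: expR_ge0| |].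
      have h : - l / 4 <= expR (- l / 4) by apply: le_trans (expR_ge1Dx _); lra.
      have h0 : 0 <= - l / 4 by lra.
      have : (- l / 4) ^+ 2 <= expR (- l / 4) ^+ 2 by rewrite ler_sqr ?nnegrE ?expR_ge0.
      lra.
    rewrite ler_expR normrM (ler0_norm l0).
    have : 0 <= - l by lra.
    by move=> /(ler_wpM2r) /(_ _ _ t4); lra.
  have : expR l * (16 * expR (- l / 4) ^+ 2 * expR (- l / 4)) = 16 * expR (l / 4).
    rewrite expr2 (_ : expR l * _ = 16 * (expR l * (expR (- l / 4) * expR (- l / 4) * expR (- l / 4)))); last by ring.
    by rewrite -!expRD; congr (_ * expR _); field.
  have : expR (l / 4) <= 1 by rewrite expR_le1; lra.
  lra.
have l0 : 0 <= l by rewrite /l ln_ge0// ltW.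
have lB : l <= B by apply: le_trans xB; rewrite /l ltW// ln_sublinear.
apply: le_trans (_ : B `^ a * (B ^+ 2 * B) <= _); last by rewrite -exprSr; lra.
apply: ler_pM => //; first exact: powR_ge0.
  by rewrite ge0_ler_powR ?nnegrE//; lra.
apply: ler_pM; [exact: sqr_ge0|exact: expR_ge0| |].
  by rewrite ler_sqr ?nnegrE.
apply: le_trans xB; rewrite -[leRHS](lnK (x := x)) ?posrE// -/l ler_expR normrM (ger0_norm l0).
have := ler_wpM2r l0 t4; lra.
Qed.

End power_expansion.

(** * Duality between rate and order *)

Section legendre.
Context {R : realType}.
(* [J] plays the role of the derivative of [g], and [e] is the convex conjugate. *)
Variables (g J e : R -> R) (r0 : R).
Local Notation I01 x := (0 < x < 1).
Hypothesis subgradient : forall x y : R, I01 x -> I01 y -> g x + (y - x) * J x <= g y.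
Hypothesis g_ge0 : forall x, I01 x -> 0 <= g x.
Hypothesis below : exists2 x, I01 x & g x < x * r0.
Hypothesis above : exists2 x, I01 x & r0 < J x.
Hypothesis smooth : forall x, I01 x -> exists K del, [/\ 0 <= K, 0 < del &
  forall y, I01 y -> `|y - x| < del -> g y <= g x + (y - x) * J x + K * (y - x) ^+ 2].
Hypothesis strict : forall x y, I01 x -> I01 y -> x != y -> J x = r0 ->
  g x + (y - x) * J x < g y.
Hypothesis e_ub : forall r x, I01 x -> x * r - g x <= e r.
Hypothesis e_lub : forall r u, (forall x, I01 x -> x * r - g x <= u) -> e r <= u.

(** Squeezed between the supporting line and the quadratic upper bound at [x]. *)
Let g_continuous x : I01 x -> {for x, continuous g}.
Proof.
move=> x01; have [K [del [K0 del0 H]]] := smooth x01; have /andP[x0 x1] := x01.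
apply/cvgrPdist_le => /= eps eps0.
pose L := `|J x| + K + 1.
have L0 : 0 < L by rewrite /L ltr_wpDl// addr_ge0.
pose d := Num.min (Num.min del (eps / L)) (Num.min (Num.min x (1 - x)) 1).
have d0 : 0 < d by rewrite !lt_min del0 divr_gt0//= x0 subr_gt0 x1 ltr01.
near=> y.
have : `|x - y| < d by near: y; apply/nbhs_ballP; exists d.
rewrite !lt_min -andbA => /andP[xy1 /andP[xy2 /andP[/andP[xy3 xy4] xy5]]].
have y01 : I01 y.
  move: xy3 xy4; clear -subgradient g_ge0 below above smooth strict e_ub e_lub; rewrite !ltr_norml => /andP[? ?] /andP[? ?].
  by apply/andP; split; lra.
have h1 := subgradient x01 y01.
have h2 : g y <= g x + (y - x) * J x + K * (y - x) ^+ 2 by apply: H => //; rewrite distrC.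
have K2 : K * (y - x) ^+ 2 <= K * `|x - y|.
  rewrite ler_wpM2l// -real_normK ?num_real// distrC expr2.
  by rewrite -[leRHS]mul1r ler_wpM2r// ltW.
have JJ : `|(y - x) * J x| <= `|x - y| * `|J x| by rewrite normrM distrC.
apply: le_trans (_ : `|x - y| * L <= _).
  move: (mulr_ge0 K0 (normr_ge0 (x - y))) (normr_ge0 (x - y)) h1 h2 K2 JJ; clear -subgradient g_ge0 below above smooth strict e_ub e_lub.
  rewrite /L mulrDr mulrDr !ler_norml => ? ? ? ? ? /andP[? ?]; apply/andP; split; lra.
by rewrite -ler_pdivlMr// ltW.
Unshelve. all: by end_near. Qed.

(** Compactness of [[eps, b]]. To its left [g >= 0] keeps the value below the positive one at [a];
    to its right the supporting line at [b] is steeper than [r0]. *)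
Let maximum : exists2 x, I01 x & forall y, I01 y -> y * r0 - g y <= x * r0 - g x.
Proof.
have [a a01 ga] := below; have [b b01 Jb] := above.
have /andP[a0 a1] := a01; have /andP[b0 b1] := b01.
pose h x := x * r0 - g x.
have ha : 0 < h a by rewrite subr_gt0.
have hb x : I01 x -> b <= x -> h x <= h b.
  move=> x01 bx; have := subgradient b01 x01.
  have : (x - b) * r0 <= (x - b) * J b by rewrite ler_wpM2l ?subr_ge0// ltW.
  rewrite /h; lra.
pose eps := Num.min (Num.min a b) (h a / (1 + `|r0|)).
have r1 : 0 < 1 + `|r0| by rewrite ltr_pwDl.
have eps0 : 0 < eps by rewrite !lt_min a0 b0 divr_gt0.
have epsb : eps <= b by rewrite !ge_min lexx orbT.
have epsa : eps <= a by rewrite !ge_min lexx.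
have heps x : I01 x -> x <= eps -> h x <= h a.
  move=> x01 xe; have /andP[x0 x1] := x01.
  have xr : x * r0 <= x * (1 + `|r0|).
    by rewrite ler_wpM2l ?(ltW x0)//; have := ler_norm r0; lra.
  have : x * (1 + `|r0|) <= h a.
    by rewrite -ler_pdivlMr//; apply: le_trans xe _; rewrite ge_min lexx orbT.
  have g0 := g_ge0 x01; have : h x <= x * r0 by rewrite /h; lra.
  lra.
have hcont : {within `[eps, b], continuous h}.
  apply: continuous_in_subspaceT => x; rewrite inE/= in_itv/= => /andP[ex xb].
  have x01 : I01 x by apply/andP; split; lra.
  rewrite /h /prop_for /continuous_at; apply: cvgB; last exact: g_continuous.
  by apply: cvgM; [exact: cvg_id|exact: cvg_cst].
have [c cab hc] := EVT_max epsb hcont.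
move: cab; rewrite in_itv/= => /andP[ec cb].
have c01 : I01 c by apply/andP; split; lra.
have hab : h a <= h c.
  have [ab|ab] := leP a b; first by apply: hc; rewrite in_itv/= epsa.
  apply: le_trans (hb _ a01 (ltW ab)) _; apply: hc.
  by rewrite in_itv/= epsb lexx.
exists c => // y y01; rewrite -/(h y) -/(h c).
have [ye|ye] := leP y eps; first exact: le_trans (heps _ y01 ye) hab.
have [yb|yb] := leP y b; first by apply: hc; rewrite in_itv/= yb ltW.
apply: le_trans (hb _ y01 (ltW yb)) _; apply: hc.
by rewrite in_itv/= epsb lexx.
Qed.

(** Strictness at the maximiser [x] gives [J (x - t) < r0 < J (x + t)]. For rates between these two
    values, [e] lies between the lines through [r0] of slopes [x] and [x + t] or [x - t], so the
    difference quotients tend to [x]. *)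
Lemma legendre_derivative : exists x, [/\ I01 x, J x = r0, e r0 = x * r0 - g x,
  derivable e r0 1 & derive1 e r0 = x].
Proof.
have [x x01 xmax] := maximum; have /andP[x0 x1] := x01.
have eE : e r0 = x * r0 - g x.
  by apply/eqP; rewrite eq_le; apply/andP; split; [exact: e_lub|exact: e_ub].
have Jx : J x = r0.
  have [K [del [K0 del0 H]]] := smooth x01.
  apply/eqP; apply: contraT => Jr.
  pose D := `|r0 - J x|.
  have D0 : 0 < D by rewrite normr_gt0 subr_eq0 eq_sym.
  (* If [J x] differs from [r0], a step [t] in the right direction gains [t D] to first order and
     loses at most [K t^2], which is less. *)
  pose t := Num.min (Num.min (del / 2) (D / (2 * (K + 1)))) (Num.min (x / 2) ((1 - x) / 2)).
  have t0 : 0 < t.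
    rewrite !lt_min; apply/andP; split; apply/andP; split; try lra.
    by rewrite divr_gt0// mulr_gt0//; lra.
  have [t1 t2 t3 t4] : [/\ t <= del / 2, t <= D / (2 * (K + 1)), t <= x / 2 & t <= (1 - x) / 2].
    by split; rewrite !ge_min lexx ?orbT.
  have K1 : 0 < 2 * (K + 1) by lra.
  have tD : t * (2 * (K + 1)) <= D by rewrite -ler_pdivlMr.
  have key (y : R) : `|y - x| = t -> (y - x) * (r0 - J x) = t * D -> False.
    move=> yt yD; have yx : y - x <= t /\ - t <= y - x.
      by move: (lexx t); rewrite -{1}yt ler_norml => /andP[].
    have y01 : I01 y by apply/andP; split; lra.
    have h1 := xmax _ y01; have h2 : g y <= _ := H _ y01 (_ : `|y - x| < del).
    have {}h2 := h2 ltac:(rewrite yt; lra).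
    have y2 : (y - x) ^+ 2 = t ^+ 2 by rewrite -yt real_normK ?num_real.
    have h3 : t * D <= K * t ^+ 2 by rewrite -y2 -yD; lra.
    have : t * (t * (2 * (K + 1))) <= t * D by rewrite ler_wpM2l// ltW.
    have : 0 < t ^+ 2 by rewrite exprn_gt0.
    have : 0 <= K * t ^+ 2 by rewrite mulr_ge0// sqr_ge0.
    lra.
  exfalso; have [rJ|rJ] := leP (J x) r0.
    apply: (key (x + t)); rewrite addrC addKr ?ger0_norm ?(ltW t0)//.
    by rewrite /D ger0_norm// subr_ge0.
  apply: (key (x - t)); rewrite addrC addKr ?normrN ?ger0_norm ?(ltW t0)//.
  by rewrite /D ler0_norm ?subr_le0 ?(ltW rJ)//; ring.
(* At a rate below [J z] no point above [z] beats [z], so from [r0] to [r] the conjugate grows with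
   slope at most [z]; the second case is the mirror image. *)
have upper (z r : R) : I01 z -> (x < z -> r0 <= r -> r < J z -> e r <= e r0 + z * (r - r0))
    /\ (z < x -> r <= r0 -> J z < r -> e r <= e r0 + z * (r - r0)).
  move=> z01; split=> zx rr Jz; apply: e_lub => y y01.
    have h1 := e_ub r0 y01; have h2 := e_ub r0 z01.
    have [yz|yz] := leP y z.
      have : y * (r - r0) <= z * (r - r0) by rewrite ler_wpM2r// subr_ge0.
      lra.
    have := subgradient z01 y01.
    have : (y - z) * r <= (y - z) * J z by rewrite ler_wpM2l ?subr_ge0// ltW.
    lra.
  have h1 := e_ub r0 y01; have h2 := e_ub r0 z01.
  have [yz|yz] := leP z y.
    have : (y - z) * (r - r0) <= 0 by rewrite mulr_ge0_le0// ?subr_ge0// subr_le0.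
    lra.
  have := subgradient z01 y01.
  have : (y - z) * r <= (y - z) * J z by rewrite ler_wnM2l ?subr_le0// ltW.
  lra.
have lower r : e r0 + x * (r - r0) <= e r by have := e_ub r x01; rewrite eE; lra.
have cv : h^-1 *: (e (h *: (1 : R) + r0) - e r0) @[h --> 0^'] --> x.
  apply/cvgrPdist_le => /= eps eps0.
  pose t := Num.min eps (Num.min (x / 2) ((1 - x) / 2)).
  have t0 : 0 < t by rewrite !lt_min eps0; apply/andP; split; [lra|apply/andP; split; lra].
  have [t1 t2 t3] : [/\ t <= eps, t <= x / 2 & t <= (1 - x) / 2].
    by split; rewrite !ge_min lexx ?orbT.
  have p01 : I01 (x + t) by apply/andP; split; lra.
  have m01 : I01 (x - t) by apply/andP; split; lra.
  (* The strict supporting inequality at [x] added to the one at [x + t]. *)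
  have Jp : r0 < J (x + t).
    have h1 := subgradient p01 x01.
    have h2 := strict x01 p01 (_ : x != x + t) Jx.
    have {}h2 := h2 ltac:(rewrite lt_eqF// ltrDl//).
    rewrite Jx in h2; rewrite -(ltr_pM2l t0); lra.
  have Jm : J (x - t) < r0.
    have h1 := subgradient m01 x01.
    have h2 := strict x01 m01 (_ : x != x - t) Jx.
    have {}h2 := h2 ltac:(rewrite gt_eqF// gtrBl//).
    rewrite Jx in h2; rewrite -(ltr_pM2l t0); lra.
  pose d := Num.min (J (x + t) - r0) (r0 - J (x - t)).
  have d0 : 0 < d by rewrite lt_min !subr_gt0 Jp.
  near=> h.
  have hn0 : h != 0 by near: h; exact: nbhs_dnbhs_neq.
  have hd : `|h| < d.
    by near: h; apply: dnbhs0_lt.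
  move: hd; rewrite lt_min !ltr_norml => /andP[/andP[_ hp] /andP[hm _]].
  rewrite /GRing.scale/= mulr1.
  have lo := lower (h + r0).
  have [h0|h0] := ltP 0 h.
    have up := (upper _ (h + r0) p01).1 (_ : x < x + t) (_ : r0 <= h + r0) (_ : h + r0 < J (x + t)).
    have {}up := up ltac:(by rewrite ltrDl) ltac:(by rewrite lerDr ltW) ltac:(by rewrite -ltrBrDr).
    have u1 : x <= h^-1 * (e (h + r0) - e r0) by rewrite ler_pdivlMl//; lra.
    have u2 : h^-1 * (e (h + r0) - e r0) <= x + t by rewrite ler_pdivrMl//; lra.
    by rewrite ler_norml; apply/andP; split; lra.
  have {}h0 : h < 0 by rewrite lt_neqAle hn0.
  have up := (upper _ (h + r0) m01).2 (_ : x - t < x) (_ : h + r0 <= r0) (_ : J (x - t) < h + r0).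
  have {}up := up ltac:(by rewrite gtrBl) ltac:(by rewrite gerDr ltW) ltac:(by lra).
  have u1 : h^-1 * (e (h + r0) - e r0) <= x by rewrite ler_ndivrMl//; lra.
  have u2 : x - t <= h^-1 * (e (h + r0) - e r0) by rewrite ler_ndivlMl//; lra.
  by rewrite ler_norml; apply/andP; split; lra.
exists x; split => //.
  by apply/cvg_ex; exists x; move: cv; rewrite /= => cv; apply: cvg_trans cv.
rewrite derive1E; exact: (cvg_lim (@Rhausdorff R) cv).
Unshelve. all: by end_near. Qed.

End legendre.

Section expansion.
Context d (Y : measurableType d) (R : realType).
Variables (W Q : {measure set Y -> \bar R}) (f : Y -> R).
Hypotheses (W1 : W setT = 1%E) (Q1 : Q setT = 1%E) (hf : has_dens Q W f).
Let Woo := measure1_lty W1.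
Let Qoo := measure1_lty Q1.
Let mf := has_dens_measurable hf.
Let f0 := has_dens_ge0 hf.

Lemma bounded_powR_integrable (B a : R) : 0 <= a -> {ae Q, forall y, f y <= B} ->
  Q.-integrable setT (EFin \o (fun y => f y `^ a)).
Proof.
move=> a0 fB; apply: (@ae_bounded_integrable _ _ _ _ _ (B `^ a)) => //.
  exact: measurable_powR_comp.
apply: filterS fB => y fy; rewrite ger0_norm ?powR_ge0// ge0_ler_powR// ?nnegrE//.
exact: le_trans fy.
Qed.

Lemma bounded_powR_ln_integrable (B a : R) : 1 <= a -> 1 <= B ->
  {ae Q, forall y, f y <= B} ->
  Q.-integrable setT (EFin \o (fun y => f y `^ a * ln (f y))).
Proof.
move=> a1 B1 fB; apply: (@ae_bounded_integrable _ _ _ _ _ (B `^ a * B + 1)) => //.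
  by apply: measurable_funM; [exact: measurable_powR_comp|exact: measurable_ln_comp].
by apply: filterS fB => y fy; exact: norm_powR_ln_le.
Qed.

Lemma Rintegral_powR_expansion (B a : R) : 1 <= a -> 1 <= B ->
  {ae Q, forall y, f y <= B} -> exists K, 0 <= K /\ forall t, `|t| <= 4^-1 ->
  \int[Q]_y (f y `^ (a + t)) <=
  \int[Q]_y (f y `^ a) + t * \int[Q]_y (f y `^ a * ln (f y)) + K * t ^+ 2.
Proof.
move=> a1 B1 fB; have B0 : 0 <= B by lra.
exists (16 + B `^ a * B ^+ 3); split.
  by rewrite addr_ge0// mulr_ge0 ?powR_ge0 ?exprn_ge0.
move=> t t4; have j1 : Q.-integrable setT (EFin \o (fun y => f y `^ a)).
  by apply: (bounded_powR_integrable _ fB); lra.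
have j2 := integrable_realZ t (bounded_powR_ln_integrable a1 B1 fB).
have jc := prob_integrable_cst Q1 ((16 + B `^ a * B ^+ 3) * t ^+ 2).
have := RintegralD measurableT (integrable_realD j1 j2) jc.
rewrite (Rintegral_prob_cst Q1) (RintegralD measurableT j1 j2).
rewrite (RintegralZl _ measurableT (bounded_powR_ln_integrable a1 B1 fB)) => <-.
apply: Rintegral_ae_le.
- apply: (bounded_powR_integrable _ fB).
  by move: t4; rewrite ler_norml => /andP[? ?]; lra.
- exact: (integrable_realD (integrable_realD j1 j2) jc).
- by apply: filterS fB => y fy; exact: powR_le_expansion.
Qed.

Lemma renyi_bounded (B a : R) : 1 < a -> {ae Q, forall y, f y <= B} ->
  1 <= \int[Q]_y (f y `^ a) /\
  renyi a W Q = ((a - 1)^-1 * ln (\int[Q]_y (f y `^ a)))%:E.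
Proof.
move=> a1 fB; have a0 : 0 < a by lra.
have j : Q.-integrable setT (EFin \o (fun y => f y `^ a)).
  by apply: (bounded_powR_integrable _ fB); lra.
have zE : (\int[Q]_y (f y `^ a)%:E)%E = (\int[Q]_y (f y `^ a))%:E.
  by rewrite /Rintegral fineK// (integrable_fin_num measurableT j).
have z1 : 1 <= \int[Q]_y (f y `^ a).
  by rewrite -lee_fin -zE; exact: (integral_powR_ge1 Q1 W1 (ltW a1) hf).
split => //; rewrite (renyi_has_dens Woo Qoo hf a0) ?gt_eqF// zE /=.
by rewrite (lt_le_trans ltr01 z1) EFinM.
Qed.

End expansion.

Section augustin_order.
Context d (Y : measurableType d) (R : realType) (I : finType) (p : I -> R).
Local Notation meas := {measure set Y -> \bar R}.
Hypotheses (p0 : forall i, 0 < p i) (p1 : \sum_i p i = 1).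
Variables (W : I -> meas).
Hypothesis W1 : forall i, W i setT = 1%E.

Definition augustin (a : R) (V : I -> meas) : \bar R :=
  ereal_inf [set cond_renyi p a V Q | Q in [set: probability Y R]].

Lemma augustin_le a V (Q : probability Y R) : (augustin a V <= cond_renyi p a V Q)%E.
Proof. by apply: ereal_inf_lbound; exists Q. Qed.

(* The average output distribution [sum_i p_i W_i] serves as reference measure:
   the densities with respect to it are bounded by [1 / p_i]. *)
Lemma average_output (r : R) : (augustin 1 W < r%:E)%E ->
  exists (U : probability Y R) (F : I -> Y -> R) (B : R),
  [/\ 1 <= B, forall i, has_dens U (W i) (F i),
      {ae U, forall y, forall i, F i y <= B} &
      \sum_i p i * \int[U]_y (F i y `^ 1 * ln (F i y)) < r].
Proof.
move=> /ereal_inf_lt[_ [Q _ <-] Qr].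
have Q1 : Q setT = 1%E := probability_setT Q.
have Qoo := measure1_lty Q1.
have foo : (cond_renyi p 1 W Q < +oo)%E by apply: lt_trans Qr (ltry _).
have WQ i : W i `<< Q.
  apply: (renyi_lty_dominates (measure1_lty (W1 i)) Qoo (lexx 1)).
  exact: (cond_renyi_lty p0 (lexx 1) W1 Q1).
have /choice[f hf] i := dominates_has_dens (measure1_lty (W1 i)) Qoo (WQ i).
pose m y := \sum_i p i * f i y.
have f0 i := has_dens_ge0 (hf i).
have jf i := has_dens_integrable (measure1_lty (W1 i)) (hf i).
have m0 y : 0 <= m y by apply: sumr_ge0 => i _; rewrite mulr_ge0 ?f0// ltW.
have [jm im] := Rintegral_sum (fun i => integrable_realZ (p i) (jf i)).
have {}jm : Q.-integrable setT (EFin \o m) := jm.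
have {}im : \int[Q]_y m y = 1.
  rewrite im -p1; apply: eq_bigr => i _.
  by rewrite (RintegralZl _ measurableT (jf i)) (has_dens_Rintegral (W1 i) (hf i)) mulr1.
have mm : measurable_fun setT m by apply/measurable_EFinP; exact: measurable_int jm.
have hm := @mdens_has_dens _ _ _ Q (EFin \o m) m mm m0 (fun=> erefl).
have [U UE] : exists U : probability Y R, U = mdens Q (EFin \o m) :> (set Y -> \bar R).
  apply: probability_copy; rewrite -(has_dens_setT hm).
  rewrite -[LHS]fineK ?(integrable_fin_num measurableT jm)//.
  by rewrite -[X in X%:E]/(\int[Q]_y m y) im.
have hU : has_dens Q U m.
  case: hm => h1 h2 h3; split => // A mA; rewrite -h3//.
  exact: (congr1 (fun F : set Y -> \bar R => F A) UE).
have U1 : U setT = 1%E := probability_setT U.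
have pm i y : p i * f i y <= m y.
  by rewrite /m (bigD1 i)//= lerDl sumr_ge0// => j _; rewrite mulr_ge0 ?f0// ltW.
have fm0 i y : m y = 0 -> f i y = 0.
  move=> my; apply/eqP; rewrite eq_le f0 andbT -(pmulr_rle0 _ (p0 i)).
  by rewrite -my pm.
have hF i := has_dens_div Qoo (measure1_lty U1) hU (fm0 i) (hf i).
pose F i y := f i y * (m y)^-1.
have F0 i y : 0 <= F i y := has_dens_ge0 (hF i) y.
have FB i y : F i y <= (p i)^-1.
  rewrite /F; have := m0 y; rewrite le_eqVlt => /predU1P[my|my].
    by rewrite -my invr0 mulr0 invr_ge0 ltW.
  by rewrite ler_pdivrMr// ler_pdivlMl// pm.
pose B := 1 + \sum_i (p i)^-1.
have B1 : 1 <= B by rewrite lerDl sumr_ge0// => i _; rewrite invr_ge0 ltW.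
have FB' i y : F i y <= B.
  apply: le_trans (FB i y) _; rewrite /B (bigD1 i)//= addrCA lerDl addr_ge0//.
  by rewrite sumr_ge0// => j _; rewrite invr_ge0 ltW.
have FBae : {ae U, forall y, forall i, F i y <= B} by apply: aeW => y i; exact: FB'.
exists U, F, B; split => //.
have fixU : {ae U, forall y, \sum_i p i * F i y = 1}.
  have [N [mN N0 sN]] : {ae U, forall y, m y != 0}.
    exists (m @^-1` [set 0]); have mS : measurable (m @^-1` [set 0]).
      by rewrite -[X in measurable X]setTI; exact: mm.
    split => //; last by move=> y /= /negP; rewrite negbK => /eqP.
    by have [_ _ ->//] := hU; apply: integral0_eq => y /= ->.
  exists N; split => // y /= Fy; apply: sN => /= my; apply: Fy.
  rewrite -[RHS](divff my) mulr_suml; apply: eq_bigr => i _.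
  by rewrite mulrA.
have e1 i y : F i y `^ 1 = F i y by rewrite powRr1.
have jFl i : U.-integrable setT (EFin \o (fun y => F i y * ln (F i y))).
  have Fi : {ae U, forall y, F i y <= B} by apply: aeW => y; exact: FB'.
  rewrite (_ : (fun y => _) = fun y => F i y `^ 1 * ln (F i y)).
    exact: (bounded_powR_ln_integrable U1 (hF i) (lexx 1) B1 Fi).
  by apply/funext => y; rewrite e1.
(* The average output minimises the order-one conditional divergence, so it inherits the bound [r]
   from [Q]. *)
have := mixture_minimizes_kl p0 W1 U1 Q1 hF fixU jFl.
move=> /le_lt_trans /(_ Qr); rewrite lte_fin; apply: le_lt_trans.
rewrite le_eqVlt; apply/orP; left; apply/eqP.
by apply: eq_bigr => i _; congr (_ * _); apply: eq_Rintegral => y _; rewrite e1.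
Qed.

End augustin_order.

Section augustin_mean.
Context d (Y : measurableType d) (R : realType) (I : finType) (p : I -> R).
Local Notation meas := {measure set Y -> \bar R}.
Hypotheses (p0 : forall i, 0 < p i) (p1 : \sum_i p i = 1).
Variables (W : I -> meas).
Hypothesis W1 : forall i, W i setT = 1%E.
Local Notation augustin := (@augustin _ Y R I p).

(** Since [dens] chooses its value from the measure itself, agreement on measurable sets is passed
    through a common density; in its absence both sides are [+oo]. *)
Lemma eq_renyi1 (V U Q : meas) : V setT = 1%E -> U setT = 1%E -> Q setT = 1%E ->
  (forall A, measurable A -> V A = U A) -> renyi 1 V Q = renyi 1 U Q.
Proof.
move=> V1 U1 Q1 VU.
have Voo := measure1_lty V1; have Uoo := measure1_lty U1; have Qoo := measure1_lty Q1.
have [fin|inf] := ltP (renyi 1 V Q) +oo%E.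
  have [f hf] := dominates_has_dens Voo Qoo (renyi_lty_dominates Voo Qoo (lexx 1) fin).
  have hf' : has_dens Q U f by case: hf => h1 h2 h3; split => // A mA; rewrite -VU// h3.
  by rewrite (renyi1_has_dens Voo Qoo hf) (renyi1_has_dens Uoo Qoo hf').
have [fin|inf'] := ltP (renyi 1 U Q) +oo%E.
  have [f hf] := dominates_has_dens Uoo Qoo (renyi_lty_dominates Uoo Qoo (lexx 1) fin).
  have hf' : has_dens Q V f by case: hf => h1 h2 h3; split => // A mA; rewrite VU// h3.
  by rewrite (renyi1_has_dens Voo Qoo hf') (renyi1_has_dens Uoo Qoo hf).
by move: inf inf'; rewrite !leye_eq => /eqP -> /eqP ->.
Qed.

Lemma augustin_lty (r a : R) : (augustin 1 W < r%:E)%E -> 1 < a ->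
  (augustin a W < +oo)%E.
Proof.
move=> /(average_output p0 p1 W1)[U [F [B [B1 hF FB _]]]] a1.
have U1 : U setT = 1%E := probability_setT U.
apply: le_lt_trans (augustin_le p a W U) _.
have FBi i : {ae U, forall y, F i y <= B} by apply: filterS FB => y /(_ i).
have H i := (renyi_bounded (W1 i) U1 (hF i) a1 (FBi i)).2.
by rewrite (cond_renyi_fin p H) ltry.
Qed.

(** Upper semicontinuity at order one from the right: against the average output, whose densities
    are bounded, the divergence of order [1 + t] exceeds that of order one by at most [t K']. *)
Lemma augustin_near1 (r : R) : (augustin 1 W < r%:E)%E ->
  exists2 a, 1 < a & (augustin a W < r%:E)%E.
Proof.
move=> /(average_output p0 p1 W1)[U [F [B [B1 hF FB Er]]]].
have U1 : U setT = 1%E := probability_setT U.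
have FBi i : {ae U, forall y, F i y <= B} by apply: filterS FB => y /(_ i).
have H i := Rintegral_powR_expansion U1 (hF i) (lexx 1) B1 (FBi i).
have [K hK] := choice H.
pose K' := \sum_i p i * K i.
have K0 : 0 <= K'.
  by apply: sumr_ge0 => i _; case: (hK i) => k _; rewrite mulr_ge0// ltW.
set L := \sum_i _ in Er.
pose t := Num.min 4^-1 ((r - L) / (2 * (K' + 1))).
have k1 : 0 < 2 * (K' + 1) by lra.
have t0 : 0 < t by rewrite lt_min divr_gt0 ?subr_gt0//; apply/andP; split => //; lra.
have t4 : t <= 4^-1 by rewrite ge_min lexx.
have tK : t * (2 * (K' + 1)) <= r - L by rewrite -ler_pdivlMr// ge_min lexx orbT.
have a1 : 1 < 1 + t by lra.
exists (1 + t) => //; apply: le_lt_trans (augustin_le p _ W U) _.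
have Hr i := renyi_bounded (W1 i) U1 (hF i) a1 (FBi i).
rewrite (cond_renyi_fin p (fun i => (Hr i).2)) lte_fin.
apply: le_lt_trans (_ : L + t * K' < r); last first.
  have : 0 <= t * K' by rewrite mulr_ge0// ltW.
  by lra.
rewrite /L /K' mulr_sumr -big_split/=; apply: ler_sum => i _.
rewrite [X in _ <= _ + X]mulrCA -mulrDr ler_wpM2l ?(ltW (p0 i))//.
have [Ki0 /(_ t)] := hK i; rewrite ger0_norm ?(ltW t0)// => /(_ t4).
have -> : \int[U]_y (F i y `^ 1) = 1.
  transitivity (\int[U]_y F i y); last exact: (has_dens_Rintegral (W1 i) (hF i)).
  apply: eq_Rintegral => y _; rewrite powRr1//; exact: has_dens_ge0 (hF i) y.
move=> h; have -> : 1 + t - 1 = t by ring.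
rewrite ler_pdivrMl//; apply: le_trans (ln_le_subr1 _) _.
  exact: lt_le_trans ltr01 (Hr i).1.
lra.
Qed.

Section order.
Variables (a : R) (q : probability Y R).
Hypotheses (a1 : 1 < a) (q_mean : cond_renyi p a W q = augustin a W).
Hypothesis aug_lty : (augustin a W < +oo)%E.
Let f i y := fine (ac_dens (W i) q y).
Let z i := \int[q]_y (f i y `^ a).
Let v i y := (z i)^-1 * f i y `^ a.
Let V i : meas := tilted a (W i) q.
Let q1 : q setT = 1%E. Proof. exact: probability_setT. Qed.
Let qoo := measure1_lty q1.
Let Woo i := measure1_lty (W1 i).
Let a0 : 0 < a. Proof. exact: lt_trans ltr01 a1. Qed.
Let an1 : a != 1. Proof. by rewrite gt_eqF. Qed.

Let rfin i : (renyi a (W i) q < +oo)%E.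
Proof. by apply: (cond_renyi_lty p0 (ltW a1) W1 q1); rewrite q_mean. Qed.

Lemma augustin_mean_has_dens i : has_dens q (W i) (f i).
Proof.
apply: dominates_has_dens_ac_dens => //.
exact: (renyi_lty_dominates (Woo i) qoo (ltW a1) (rfin i)).
Qed.
Let hf := augustin_mean_has_dens.

Let zE i : (\int[q]_y (f i y `^ a)%:E)%E = (z i)%:E.
Proof.
rewrite /z /Rintegral fineK// ge0_fin_numE; last first.
  by apply: integral_ge0 => y _; rewrite lee_fin powR_ge0.
rewrite ltNge leye_eq; apply/negP => /eqP h; have := rfin i.
rewrite (renyi_has_dens (Woo i) qoo (hf i) a0 an1) h /= gt0_muley ?ltxx//.
by rewrite lte_fin invr_gt0 subr_gt0.
Qed.

Lemma augustin_normalization_ge1 i : 1 <= z i.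
Proof. exact: (tilt_normalization_ge1 W1 q1 a1 hf zE). Qed.
Let z0 i : 0 < z i. Proof. exact: lt_le_trans (augustin_normalization_ge1 i). Qed.

Lemma tilted_channel_has_dens i : has_dens q (V i) (v i).
Proof.
have Wq := renyi_lty_dominates (Woo i) qoo (ltW a1) (rfin i).
exact: (tilted_has_dens (W1 i) q1 Wq a0 an1 (z0 i) (zE i)).
Qed.
Let hv := tilted_channel_has_dens.

Lemma tilted_channel_setT i : V i setT = 1%E.
Proof.
rewrite -(has_dens_setT (hv i)).
under eq_integral do rewrite EFinM.
rewrite ge0_integralZl//.
- by rewrite zE -EFinM mulVf// gt_eqF.
- apply/measurable_EFinP; apply: measurable_powR_comp.
  exact: has_dens_measurable (hf i).
- by move=> y _; rewrite lee_fin powR_ge0.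
- by rewrite lee_fin invr_ge0 ltW.
Qed.
Let V1 := tilted_channel_setT.

Lemma augustin_mean_fixed_point : {ae q, forall y, \sum_i p i * v i y = 1}.
Proof.
apply: (augustin_fixed_point p0 p1 W1 q1 a1 hf zE) => Q.
by rewrite q_mean; exact: augustin_le.
Qed.
Let fix_q := augustin_mean_fixed_point.

Let c0 i : 0 < (z i)^-1. Proof. by rewrite invr_gt0. Qed.

Let E i := \int[q]_y (v i y * ln (f i y)).

Let renyiE i : renyi a (W i) q = ((a - 1)^-1 * ln (z i))%:E.
Proof. by rewrite (renyi_has_dens (Woo i) qoo (hf i) a0 an1) zE /= z0 EFinM. Qed.

Lemma augustin_infoE : augustin a W = ((a - 1)^-1 * \sum_i p i * ln (z i))%:E.
Proof.
rewrite -q_mean (cond_renyi_fin p renyiE); congr EFin.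
by rewrite mulr_sumr; apply: eq_bigr => i _; ring.
Qed.

(** By the fixed point equation [q] is the output distribution of the tilted channel, hence its
    order-one minimiser. *)
Lemma augustin1_tiltedE :
  augustin 1 V = (\sum_i p i * (a * E i - ln (z i)))%:E.
Proof.
have -> : \sum_i p i * (a * E i - ln (z i)) = tilted_information p q f a (fun i => (z i)^-1).
  by apply: eq_bigr => i _; rewrite lnV ?posrE//; congr (_ * _); rewrite -/(E i); ring.
apply/eqP; rewrite eq_le; apply/andP; split.
  by rewrite -(cond_renyi_tilted p0 V1 q1 a1 c0 hf hv fix_q); exact: augustin_le.
apply/ereal_infP => _ [Q _ <-].
exact: (tilted_information_le p0 V1 q1 a1 c0 hf hv fix_q (probability_setT Q)).
Qed.

(** The variational bound at [c i = 1 / z i]. Its equality case identifies [V i] with [W i] on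
    measurable sets, hence their order-one informations. *)
Lemma augustin_lower (b : R) (Q : probability Y R) : 1 < b ->
  ((\sum_i p i * ((b - a) * E i + ln (z i)))%:E <=
     (b - 1)%:E * cond_renyi p b W Q)%E /\
  (b != a ->
   ((b - 1)%:E * cond_renyi p b W Q <=
     (\sum_i p i * ((b - a) * E i + ln (z i)))%:E)%E ->
   augustin 1 V = augustin 1 W).
Proof.
move=> b1; have [h1 h2] :=
  tilted_variational p0 W1 V1 q1 a1 c0 hf hv fix_q (probability_setT Q) b1.
have e : \sum_i p i * ((b - a) * E i + ln (z i)) =
    \sum_i p i * ((b - a) * \int[q]_y ((z i)^-1 * f i y `^ a * ln (f i y)) - ln (z i)^-1).
  by apply: eq_bigr => i _; rewrite lnV ?posrE// opprK.
rewrite e; split; first exact: h1.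
move=> ba le; have vf := h2 ba le.
have VW i A : measurable A -> V i A = W i A.
  move=> mA; have [_ _ ->//] := hv i; have [_ _ ->//] := hf i.
  apply: ge0_ae_eq_integral => //.
  - apply: measurable_funTS; apply/measurable_EFinP; exact: has_dens_measurable (hv i).
  - apply: measurable_funTS; apply/measurable_EFinP; exact: has_dens_measurable (hf i).
  - by move=> y _; rewrite lee_fin; exact: has_dens_ge0 (hv i) y.
  - by move=> y _; rewrite lee_fin; exact: has_dens_ge0 (hf i) y.
  - by apply: filterS (vf i) => y vy _; congr EFin.
rewrite /augustin; congr ereal_inf; apply: eq_imagel => Q' _.
apply: eq_bigr => i _; congr (_ * _)%E.
exact: eq_renyi1 (V1 i) (W1 i) (probability_setT Q') (VW i).
Qed.

(** The mean [q] of order [a] serves as competitor at the order [b], and its bounded densities allow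
    an expansion in [b - a]. *)
Lemma augustin_upper : exists2 K, 0 <= K & forall b, 1 < b -> `|b - a| <= 4^-1 ->
  ((b - 1)%:E * augustin b W <=
   (\sum_i p i * ((b - a) * E i + ln (z i)) + K * (b - a) ^+ 2)%:E)%E.
Proof.
have [B B1 fB] := tilted_density_bounded p0 a1 c0 hv fix_q.
have fBi i : {ae q, forall y, f i y <= B} by apply: filterS fB => y /(_ i).
have H i := Rintegral_powR_expansion q1 (hf i) (ltW a1) B1 (fBi i).
have [K hK] := choice H.
exists (\sum_i p i * K i).
  by apply: sumr_ge0 => i _; case: (hK i) => k _; rewrite mulr_ge0// ltW.
move=> b b1 ba.
have b10 : 0 < b - 1 by rewrite subr_gt0.
have Hr i := renyi_bounded (W1 i) q1 (hf i) b1 (fBi i).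
apply: (@le_trans _ _ ((b - 1)%:E * cond_renyi p b W q)%E).
  by apply: lee_wpmul2l; [rewrite lee_fin ltW|exact: augustin_le].
rewrite (cond_renyi_fin p (fun i => (Hr i).2)) -EFinM lee_fin.
rewrite mulr_sumr mulr_suml -big_split/=; apply: ler_sum => i _.
have -> : (b - 1) * (p i * ((b - 1)^-1 * ln (\int[q]_y f i y `^ b))) =
   p i * ln (\int[q]_y f i y `^ b) by field; rewrite gt_eqF.
rewrite -mulrA -mulrDr ler_wpM2l ?(ltW (p0 i))//.
have [Ki0 /(_ (b - a) ba)] := hK i; rewrite addrC subrK -/(z i) => h.
have jl := bounded_powR_ln_integrable q1 (hf i) (ltW a1) B1 (fBi i).
have EE : \int[q]_y (f i y `^ a * ln (f i y)) = z i * E i.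
  rewrite /E /v.
  have -> : \int[q]_y ((z i)^-1 * f i y `^ a * ln (f i y)) =
      \int[q]_y ((z i)^-1 * (f i y `^ a * ln (f i y))).
    by apply: eq_Rintegral => y _; rewrite mulrA.
  by rewrite (RintegralZl _ measurableT jl) mulrA mulfV ?mul1r// gt_eqF.
have fb0 : 0 < \int[q]_y f i y `^ b := lt_le_trans ltr01 (Hr i).1.
have -> : ln (\int[q]_y f i y `^ b) = ln (z i) + ln ((\int[q]_y f i y `^ b) / z i).
  by rewrite -lnM ?posrE ?z0 ?(divr_gt0 fb0 (z0 i))// [_ * (_ / _)]mulrC divfK// gt_eqF.
have := ln_le_subr1 (divr_gt0 fb0 (z0 i)).
have : (\int[q]_y f i y `^ b) / z i <= 1 + (b - a) * E i + K i * (b - a) ^+ 2.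
  rewrite ler_pdivrMr//; move: h; rewrite EE.
  have : K i * (b - a) ^+ 2 * 1 <= K i * (b - a) ^+ 2 * z i.
    by rewrite ler_wpM2l ?augustin_normalization_ge1// mulr_ge0// sqr_ge0.
  lra.
lra.
Qed.

End order.

End augustin_mean.

(** * From the order [a] to [rho = (a - 1) / a] *)

Section strong_converse_exponent.
Context d (Y : measurableType d) (R : realType) (I : finType) (p : I -> R).
Local Notation meas := {measure set Y -> \bar R}.
Hypotheses (p0 : forall i, 0 < p i) (p1 : \sum_i p i = 1).
Variables (W : I -> meas) (q : R -> probability Y R) (r : R).
Hypothesis W1 : forall i, W i setT = 1%E.
Local Notation augustin := (@augustin _ Y R I p).
Hypothesis q_mean : forall a, 1 < a -> cond_renyi p a W (q a) = augustin a W.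
Let V a i : meas := tilted a (W i) (q a).
Hypothesis rate_gt : (augustin 1 W < r%:E)%E.
Hypothesis rate_lt : exists2 a, 1 < a & (r%:E < augustin 1 (V a))%E.

Let order x : R := (1 - x)^-1.
Let g x := x * fine (augustin (order x) W).
Let J x := fine (augustin 1 (V (order x))).
Let f a i y := fine (ac_dens (W i) (q a) y).
Let z a i := \int[q a]_y (f a i y `^ a).
Let E a i := \int[q a]_y ((z a i)^-1 * f a i y `^ a * ln (f a i y)).
(** [M a] is [(a - 1) I_a(P; W)], and [N a] is its slope in [a]. *)
Let M a := \sum_i p i * ln (z a i).
Let N a := \sum_i p i * E a i.
Local Notation I01 x := (0 < x < 1).

Let order_gt1 x : I01 x -> 1 < order x.
Proof.
by move=> /andP[x0 x1]; rewrite /order invf_gt1 ?subr_gt0// gtrBl.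
Qed.

Let orderK x : I01 x -> x = (order x - 1) / order x.
Proof. by move=> /andP[x0 x1]; rewrite /order; field; rewrite subr_eq0 gt_eqF. Qed.

Let order_I01 a : 1 < a -> I01 (1 - a^-1) /\ order (1 - a^-1) = a.
Proof.
move=> a1; have a0 : 0 < a by lra.
have -> : order (1 - a^-1) = a by rewrite /order (_ : 1 - (1 - a^-1) = a^-1) ?invrK//; ring.
split => //.
by rewrite subr_gt0 invf_lt1// a1 gtrBl invr_gt0.
Qed.

Let fin a : 1 < a -> (augustin a W < +oo)%E.
Proof. exact: augustin_lty rate_gt. Qed.

Let gE x : I01 x -> g x = M (order x) / order x.
Proof.
move=> x01; have a1 := order_gt1 x01.
rewrite /g (augustin_infoE p0 W1 a1 (q_mean a1) (fin a1))/= {1}(orderK x01).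
rewrite -/(M (order x)); field.
by rewrite subr_eq0 !gt_eqF//; lra.
Qed.

Let JE a : 1 < a -> augustin 1 (V a) = (a * N a - M a)%:E.
Proof.
move=> a1; rewrite /V (augustin1_tiltedE p0 p1 W1 a1 (q_mean a1) (fin a1)); congr EFin.
by rewrite /N /M mulr_sumr -sumrB; apply: eq_bigr => i _; rewrite mulrBr mulrCA.
Qed.

Let sumE a b : \sum_i p i * ((b - a) * E a i + ln (z a i)) = (b - a) * N a + M a.
Proof.
rewrite /N /M mulr_sumr -big_split/=; apply: eq_bigr => i _.
by rewrite mulrDr mulrCA.
Qed.

Let infoE a : 1 < a -> ((a - 1)%:E * cond_renyi p a W (q a) = (M a)%:E)%E.
Proof.
move=> a1; rewrite (q_mean a1) (augustin_infoE p0 W1 a1 (q_mean a1) (fin a1)).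
by rewrite -EFinM mulrA divff ?mul1r// subr_eq0 gt_eqF.
Qed.

Let lower a b : 1 < a -> 1 < b -> (b - a) * N a + M a <= M b /\
  (b != a -> M b <= (b - a) * N a + M a -> augustin 1 (V a) = augustin 1 W).
Proof.
move=> a1 b1; have [] := augustin_lower p0 p1 W1 a1 (q_mean a1) (fin a1) (q b) b1.
by rewrite sumE infoE// !lee_fin.
Qed.

Let order_inv x y : I01 x -> I01 y -> y - x = (order y - order x) / (order x * order y).
Proof.
move=> /andP[x0 x1] /andP[y0 y1]; rewrite /order; field.
by rewrite !subr_eq0 !gt_eqF.
Qed.

(** As [1 / order y = 1 - y], dividing an affine function of [order y] by [order y] gives an affine
    function of [y]. Supporting lines of [M] thus become supporting lines of [g], and their slope is
    [a N a - M a], the order-one information of the tilted channel. *)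
Let tangent x y : I01 x -> I01 y ->
  ((order y - order x) * N (order x) + M (order x)) / order y =
  g x + (y - x) * J x.
Proof.
move=> x01 y01; have a1 := order_gt1 x01; have b1 := order_gt1 y01.
rewrite gE// /J JE//= (order_inv x01 y01).
by field; rewrite !gt_eqF//; lra.
Qed.

Lemma augustin_legendre (e : R -> R) :
  (forall r x, I01 x -> x * r - g x <= e r) ->
  (forall r u, (forall x, I01 x -> x * r - g x <= u) -> e r <= u) ->
  exists x, [/\ I01 x, augustin 1 (V (order x)) = r%:E, e r = x * r - g x,
    derivable e r 1 & derive1 e r = x].
Proof.
move=> e_ub e_lub.
have JE' x : I01 x -> augustin 1 (V (order x)) = (J x)%:E.
  by move=> x01; rewrite /J JE// order_gt1.
have [||||||||x [x01 Jx ex edr ed]] := @legendre_derivative R g J e r.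
- move=> x y x01 y01; have a1 := order_gt1 x01; have b1 := order_gt1 y01.
  rewrite -tangent// gE// ler_pM2r ?invr_gt0//; last by lra.
  by case: (lower a1 b1).
- move=> x x01; have a1 := order_gt1 x01; rewrite gE// divr_ge0//; last by lra.
  apply: sumr_ge0 => i _; rewrite mulr_ge0 ?(ltW (p0 i))// ln_ge0//.
  exact: (augustin_normalization_ge1 p0 W1 a1 (q_mean a1) (fin a1) i).
- have [a a1 ar] := augustin_near1 p0 p1 W1 rate_gt.
  have [x01 xa] := order_I01 a1; exists (1 - a^-1) => //.
  rewrite /g xa ltr_pM2l; last by case/andP: x01.
  by move: ar; rewrite (augustin_infoE p0 W1 a1 (q_mean a1) (fin a1)) lte_fin.
- have [a a1 ar] := rate_lt.
  have [x01 xa] := order_I01 a1; exists (1 - a^-1) => //.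
  by move: ar; rewrite /J xa JE.
- move=> x x01; have a1 := order_gt1 x01; have /andP[x0 x1] := x01.
  set a := order x in a1.
  have a0 : 0 < a by lra.
  have [K K0 H] := augustin_upper p0 p1 W1 a1 (q_mean a1) (fin a1).
  (* From [b - a = a b (y - x)]: this radius ensures [b <= 2 a] and [|b - a| <= 1 / 4], and
     [K (b - a)^2 / b = K a^2 b (y - x)^2]. *)
  exists (K * (a ^+ 2 * (2 * a))), ((8 * a ^+ 2)^-1).
  have aa0 : 0 < a ^+ 2 by rewrite exprn_gt0.
  split.
  + by rewrite !mulr_ge0//; lra.
  + by rewrite invr_gt0; lra.
  move=> y y01 yx; have b1 := order_gt1 y01; set b := order y in b1.
  have b0 : 0 < b by lra.
  have yxE : b - a = a * b * (y - x).
    by rewrite (order_inv x01 y01) -/a -/b; field; rewrite !gt_eqF.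
  have ayx : a * `|y - x| <= 8^-1.
    have : `|y - x| * (8 * a ^+ 2) < 1 by rewrite -ltr_pdivlMr ?div1r//; lra.
    have : 0 <= a * `|y - x| by rewrite mulr_ge0// ltW.
    have : a * `|y - x| * 1 <= a * `|y - x| * a.
      by rewrite ler_wpM2l ?mulr_ge0 ?(ltW a0) ?(ltW a1).
    lra.
  have b2a : b <= 2 * a.
    have : b * (a * `|y - x|) <= b * 8^-1 by rewrite ler_wpM2l// ltW.
    have : b - a <= b * (a * `|y - x|).
      rewrite yxE -mulrA mulrCA ler_wpM2l ?(ltW b0)// ler_wpM2l ?(ltW a0)//.
      exact: ler_norm.
    lra.
  have ba4 : `|b - a| <= 4^-1.
    rewrite yxE normrM gtr0_norm ?mulr_gt0// (mulrC a) -mulrA.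
    have : `|y - x| * (8 * a ^+ 2) < 1 by rewrite -ltr_pdivlMr ?div1r//; lra.
    have : b * (a * `|y - x|) <= 2 * a * (a * `|y - x|).
      by rewrite ler_wpM2r// mulr_ge0// ltW.
    lra.
  have := H b b1 ba4.
  rewrite sumE -(q_mean b1) infoE// lee_fin => Mb.
  rewrite -tangent// -/a -/b gE// -/b.
  have : M b / b <= ((b - a) * N a + M a + K * (b - a) ^+ 2) / b.
    by rewrite ler_pM2r// invr_gt0.
  move=> /le_trans; apply; rewrite mulrDl lerD2l yxE.
  have -> : K * (a * b * (y - x)) ^+ 2 / b = K * (y - x) ^+ 2 * a ^+ 2 * b.
    by field; rewrite gt_eqF.
  have -> : K * (a ^+ 2 * (2 * a)) * (y - x) ^+ 2 = K * (y - x) ^+ 2 * a ^+ 2 * (2 * a) by ring.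
  rewrite ler_wpM2l//; apply: mulr_ge0; last exact: ltW.
  by apply: mulr_ge0 => //; exact: sqr_ge0.
(* Equality would give [r = J x = I_1(P; W)], against [rate_gt]. *)
- move=> x y x01 y01 xy Jr; have a1 := order_gt1 x01; have b1 := order_gt1 y01.
  rewrite -tangent// gE// ltr_pM2r ?invr_gt0//; last by lra.
  rewrite ltNge; apply/negP => le.
  have ba : order y != order x.
    by apply: contra xy => /eqP h; rewrite (orderK x01) (orderK y01) h.
  have := (lower a1 b1).2 ba le; rewrite (JE' _ x01) Jr => h.
  by move: rate_gt; rewrite -h ltxx.
- exact: e_ub.
- exact: e_lub.
by exists x; split => //; rewrite (JE' _ x01) Jx.
Qed.

End strong_converse_exponent.

(** * Exponential tails by Fejer smoothing *)

Section real_integrals.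
Context {R : realType}.
Let mu := @lebesgue_measure R.
Implicit Types (f F : R -> R) (a b c k s t u v x : R).

Lemma is_derive_continuous f df : (forall x, is_derive x (1 : R) f (df x)) ->
  continuous f.
Proof. by move=> fdf x; apply/differentiable_continuous/derivable1_diffP. Qed.

Lemma integral_derivative F f a b : a < b ->
  (forall x, is_derive x (1 : R) F (f x)) -> continuous f ->
  (\int[mu]_(x in `[a, b]) (f x)%:E = (F b - F a)%:E)%E.
Proof.
move=> ab dF cf; have cF := is_derive_continuous dF.
rewrite (@continuous_FTC2 _ f F)//.
- exact: continuous_subspaceT.
- split.
  + by move=> x _.
  + by apply: cvg_at_right_filter; exact: cF.
  + by apply: cvg_at_left_filter; exact: cF.
- by move=> x _; rewrite derive1E; exact: derive_val.
Qed.

Lemma integral_gauss_scaled k : 0 < k ->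
  (\int[mu]_(x in `[0%R, +oo[) (expR (- (k * x) ^+ 2))%:E = (Num.sqrt pi / 2 / k)%:E)%E.
Proof.
move=> k0; pose F x := k * x.
have dF x : is_derive x (1 : R) F k.
  by apply: is_derive_eq; rewrite /GRing.scale/= mulr1.
have F' : derive1 F = cst k.
  by apply/funext => x; rewrite derive1E; exact: derive_val.
have FE0 : F 0 = 0 by rewrite /F mulr0.
have key : (\int[mu]_(x in `[F 0%R, +oo[) (gauss_fun x)%:E =
    \int[mu]_(x in `[0%R, +oo[) (((gauss_fun \o F) * derive1 F)%R x)%:E)%E.
  apply: increasing_ge0_integration_by_substitutiony.
  - by move=> x y _ _ xy; rewrite /F ltr_pM2l.
  - by rewrite F' => x _; exact: cst_continuous.
  - by rewrite F'; exact: is_cvg_cst.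
  - by rewrite F'; exact: is_cvg_cst.
  - split; first by move=> x _.
    by apply: cvg_at_right_filter; exact: (is_derive_continuous dF).
  - by apply: gt0_cvgMry => //; exact: cvg_id.
  - exact/continuous_subspaceT/continuous_gauss_fun.
  - by move=> x _; exact: gauss_fun_ge0.
move: key; rewrite FE0 integral0y_gauss F'.
have -> : (\int[mu]_(x in `[0%R, +oo[) (((gauss_fun \o F) * cst k)%R x)%:E =
    k%:E * \int[mu]_(x in `[0%R, +oo[) (expR (- (k * x) ^+ 2))%:E)%E.
  rewrite -ge0_integralZl//.
  - by apply: eq_integral => x _; rewrite -EFinM mulrC.
  - apply: measurable_funTS; apply/measurable_EFinP.
    apply: measurableT_comp => //; apply: measurableT_comp => //.
    by apply: measurable_funX; exact: measurable_funM.
  - by rewrite lee_fin ltW.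
move=> /(congr1 (mule k^-1%:E)); rewrite muleA -!EFinM mulVf ?gt_eqF// mul1e => <-.
by rewrite mulrC.
Qed.

Lemma integral_exp_tail s a : 0 < s ->
  (\int[mu]_(y in `[a, +oo[) (expR (- (s * (y - a))))%:E = (s^-1)%:E)%E.
Proof.
move=> s0; pose F y := - (s^-1 * expR (- (s * (y - a)))).
have dF y : is_derive y (1 : R) F (expR (- (s * (y - a)))).
  by apply: is_derive_eq; rewrite /GRing.scale/=; field; rewrite gt_eqF.
have df y : is_derive y (1 : R) (fun y => expR (- (s * (y - a))))
    (- s * expR (- (s * (y - a)))).
  by apply: is_derive_eq; rewrite /GRing.scale/=; ring.
rewrite (@ge0_continuous_FTC2y _ _ F a 0).
- by rewrite /F subrr mulr0 oppr0 expR0 mulr1 -EFinB sub0r opprK.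
- by move=> x _; exact: expR_ge0.
- exact/continuous_subspaceT/(is_derive_continuous df).
- rewrite -[X in _ --> X]oppr0 -[X in _ --> - X](mulr0 s^-1).
  apply: cvgN; apply: cvgMl_tmp.
  apply: (@cvg_comp _ _ _ (fun y => s * (y - a)) (fun u => expR (- u)) _ (pinfty_nbhs R)).
    apply: gt0_cvgMry => //; apply: cvg_addrr.
  exact: cvgr_expR.
- by move=> x _.
- by apply: cvg_at_right_filter; exact: (is_derive_continuous dF).
- by move=> x _; rewrite derive1E; exact: derive_val.
Qed.

End real_integrals.

(** * The Fejer kernel and its localisation *)

Section fejer_kernel.
Context {R : realType}.
Let mu := @lebesgue_measure R.
Variable a : R.
Hypothesis a0 : 0 < a.
Implicit Types x u v : R.

(** The cosine transform of the triangle [1 - v / a] on [[0, a]], continued to [0] by its limit. *)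
Definition fejer x : R := if x == 0 then a / 2 else (1 - cos (a * x)) / (a * x ^+ 2).

Lemma fejer_ge0 x : 0 <= fejer x.
Proof.
rewrite /fejer; case: ifPn => x0; first by rewrite divr_ge0// ltW.
by rewrite divr_ge0 ?subr_ge0 ?cos_le1// mulr_ge0 ?(ltW a0)// sqr_ge0.
Qed.

Lemma fejer_ge_quad x : a / 2 - a ^+ 3 / 24 * x ^+ 2 <= fejer x.
Proof.
rewrite /fejer; have [->|x0] := eqVneq x 0; first by rewrite expr0n/= mulr0 subr0.
have x2 : 0 < x ^+ 2 by rewrite exprn_even_gt0.
have ax2 : 0 < a * x ^+ 2 := mulr_gt0 a0 x2.
rewrite ler_pdivlMr//; have := cos_le_quartic (a * x); rewrite !exprMn.
lra.
Qed.

Lemma measurable_fejer : measurable_fun setT fejer.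
Proof.
apply: measurable_fun_ifT => //; first exact: measurable_fun_eqr.
apply: measurable_funM.
  apply: measurable_funB => //; apply: measurableT_comp; last exact: measurable_funM.
  exact: (continuous_measurable_fun (@continuous_cos R)).
rewrite (_ : (fun x => (a * x ^+ 2)^-1) = fun x => (a * x ^+ 2) `^ (-1)); last first.
  by apply/funext => x; rewrite powR_inv1//; apply: mulr_ge0; [exact: ltW|exact: sqr_ge0].
by apply: measurable_powR_comp; apply: measurable_funM.
Qed.

(** The added [1] makes the integrand nonnegative, so that Tonelli applies later, at the price of
    the known term [a / 2]. *)
Lemma integral_fejer x :
  (\int[mu]_(v in `[0%R, a]) ((1 - v / a) * (1 + cos (v * x)))%:E =
   (a / 2 + fejer x)%:E)%E.
Proof.
have an0 : a != 0 by rewrite gt_eqF.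
have dg v : is_derive v (1 : R) (fun v => (1 - v / a) * (1 + cos (v * x)))
    (- a^-1 * (1 + cos (v * x)) - (1 - v / a) * (x * sin (v * x))).
  by apply: is_derive_eq; rewrite /GRing.scale/=; field.
have cg := is_derive_continuous dg.
have [x0|x0] := eqVneq x 0.
  pose F v := 2 * v - v ^+ 2 / a.
  have dF v : is_derive v (1 : R) F ((1 - v / a) * (1 + cos (v * x))).
    by apply: is_derive_eq; rewrite /GRing.scale/= x0 (mulr0 v) cos0; field.
  by rewrite (integral_derivative a0 dF cg) /fejer x0 eqxx /F; congr EFin; field.
pose F v := v - v ^+ 2 / (2 * a) + ((1 - v / a) * sin (v * x) / x - cos (v * x) / (a * x ^+ 2)).
have dF v : is_derive v (1 : R) F ((1 - v / a) * (1 + cos (v * x))).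
  by apply: is_derive_eq; rewrite /GRing.scale/=; field; rewrite an0 x0.
rewrite (integral_derivative a0 dF cg) /fejer (negbTE x0) /F; congr EFin.
by rewrite !mul0r sin0 cos0 expr0n/=; field; rewrite an0 x0.
Qed.

(** The quadratic lower bound integrated over the radius [3 / a] gives [3 - 3 / 4]. *)
Lemma integral_fejer_mass u :
  ((9 / 4)%:E <= \int[mu]_(y in `[(u - 3 / a)%R, (u + 3 / a)%R]) (fejer (u - y))%:E)%E.
Proof.
have an0 : a != 0 by rewrite gt_eqF.
have r0 : 0 < 3 / a by rewrite divr_gt0.
pose f y := a / 2 - a ^+ 3 / 24 * (u - y) ^+ 2.
pose F y := a / 2 * y - a ^+ 3 / 72 * (y - u) ^+ 3.
have dF y : is_derive y (1 : R) F (f y).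
  by apply: is_derive_eq; rewrite /GRing.scale/= /f; field.
have df y : is_derive y (1 : R) f (a ^+ 3 / 12 * (u - y)).
  by apply: is_derive_eq; rewrite /GRing.scale/= /f; field.
have ur : u - 3 / a < u + 3 / a by lra.
have -> : (9 / 4)%:E = (F (u + 3 / a) - F (u - 3 / a))%:E.
  by rewrite /F; congr EFin; field.
rewrite -(integral_derivative ur dF (is_derive_continuous df)).
apply: ge0_le_integral => //.
- move=> y /=; rewrite in_itv/= => /andP[y1 y2].
  have : (u - y) ^+ 2 <= (3 / a) ^+ 2.
    rewrite -ler_sqrt ?sqr_ge0// !sqrtr_sqr (ger0_norm (ltW r0)) ler_norml.
    by apply/andP; split; lra.
  have a3 : 0 <= a ^+ 3 / 24 by rewrite divr_ge0// exprn_ge0// ltW.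
  move=> /(ler_wpM2l a3).
  have -> : a ^+ 3 / 24 * (3 / a) ^+ 2 = a * (3 / 8) by field.
  move=> h; rewrite lee_fin subr_ge0; apply: le_trans h _; rewrite ler_pM2l//; lra.
- apply: measurable_funTS; apply/measurable_EFinP.
  exact: (continuous_measurable_fun (is_derive_continuous df)).
- apply: measurable_funTS; apply/measurable_EFinP.
  by apply: measurableT_comp; [exact: measurable_fejer|exact: measurable_funB].
- by move=> y _; rewrite lee_fin; exact: fejer_ge_quad.
Qed.

End fejer_kernel.

Section threshold.
Context d (T : measurableType d) (R : realType).

Lemma measurable_expR_affine (S : T -> R) s c : measurable_fun setT S ->
  measurable_fun setT (fun t => expR (- (s * (S t - c)))).
Proof.
move=> mS; apply: measurableT_comp => //; apply: measurableT_comp => //.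
by apply: measurable_funM => //; exact: measurable_funB.
Qed.

Lemma measurable_exponential_tail (S : T -> R) s c : measurable_fun setT S ->
  measurable_fun setT (fun t => expR (- (s * (S t - c))) * \1_[set u | c <= u] (S t)).
Proof.
move=> mS; apply: measurable_funM; first exact: measurable_expR_affine.
have mc : measurable [set u : R | c <= u].
  rewrite (_ : [set u | _] = `[c, +oo[%classic)//.
  by apply/seteqP; split => u /=; rewrite in_itv/= andbT.
exact: (measurableT_comp (measurable_indic mc) mS).
Qed.

End threshold.

Section concentration.
Context d (T : measurableType d) (R : realType).
Variables (Pi : probability T R) (S : T -> R) (B lam s : R).
Let mu := @lebesgue_measure R.
(* For [v <= a], [B v^2 / 2 * (1 - 2 / 3 * lam * v) >= 8 / 25 * B v^2]. *)
Let a := 27 / 50 / lam.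
Hypotheses (mS : measurable_fun setT S) (B0 : 0 < B) (lam0 : 0 < lam) (s0 : 0 < s).
Hypothesis char_le : forall v theta, 0 <= v <= a ->
  (\int[Pi]_t (1 + cos (v * S t + theta))%:E <=
   (1 + expR (- (8 / 25 * B * v ^+ 2)))%:E)%E.

Let a0 : 0 < a. Proof. by rewrite /a divr_gt0. Qed.
Let r := 3 / a.
Let r0 : 0 < r. Proof. by rewrite divr_gt0. Qed.
Let D := Num.sqrt pi / 2 / Num.sqrt (8 / 25 * B).
Let k := Num.sqrt (8 / 25 * B).
Let k0 : 0 < k. Proof. by rewrite sqrtr_gt0 mulr_gt0. Qed.
Let D0 : 0 <= D. Proof. by rewrite !divr_ge0// sqrtr_ge0. Qed.

Let measurable_cos_comp d' (X : measurableType d') (f : X -> R) :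
  measurable_fun setT f -> measurable_fun setT (fun x => cos (f x)).
Proof.
by move=> mf; apply: measurableT_comp => //; exact: (continuous_measurable_fun (@continuous_cos R)).
Qed.

Let one_cos_ge0 x : 0 <= 1 + cos x :> R.
Proof. by have := cos_geN1 x; lra. Qed.

Let m_triangle : measurable_fun setT (fun v : R => (1 - v / a) * \1_`[0, a] v).
Proof.
by apply: measurable_funM => //; apply: measurable_funB => //; exact: measurable_funM.
Qed.

Let m_gauss : measurable_fun setT (fun v : R => expR (- (k * v) ^+ 2)).
Proof.
apply: measurableT_comp => //; apply: measurableT_comp => //.
by apply: measurable_funX; exact: measurable_funM.
Qed.

Let m_cut_gauss : measurable_fun setT (fun v => expR (- (k * v) ^+ 2) * \1_`[0, a] v).
Proof. exact: measurable_funM. Qed.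

(** The kernel is a superposition of frequencies up to [a], where [char_le] gives Gaussian decay;
    [D] is the full Gaussian integral, of order [1 / sqrt B] and independent of [y]. *)
Lemma expectation_fejer_le y : (\int[Pi]_t (fejer a (S t - y))%:E <= D%:E)%E.
Proof.
pose h (z : T * measurableTypeR R) := (1 - z.2 / a) * (1 + cos (z.2 * (S z.1 - y))) * \1_`[0, a] z.2.
have mh : measurable_fun setT (fun z => (h z)%:E).
  apply/measurable_EFinP; apply: measurable_funM.
    apply: measurable_funM.
      by apply: measurable_funB => //; apply: measurable_funM.
    apply: measurable_funD => //; apply: measurable_cos_comp; apply: measurable_funM => //.
    by apply: measurable_funB => //; apply: measurableT_comp.
  apply: (measurableT_comp (f := \1_`[0, a] : measurableTypeR R -> R)) => //.
have h0 z : (0 <= (h z)%:E)%E.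
  rewrite lee_fin /h indicE; case: (boolP (z.2 \in _)) => [|_]; last by rewrite mulr0.
  rewrite inE/= in_itv/= mulr1 => /andP[v0 va].
  by rewrite mulr_ge0// subr_ge0 ler_pdivrMr// mul1r.
have inner t : (\int[mu]_v (h (t, v))%:E = (a / 2 + fejer a (S t - y))%:E)%E.
  rewrite -(integral_fejer a0 (S t - y)) [RHS]integral_mkcond.
  apply: eq_integral => v _; rewrite patchE /h indicE /=.
  by case: ifPn => _; rewrite ?mulr1 ?mulr0.
have mf : measurable_fun setT (fun t => fejer a (S t - y)).
  apply: measurableT_comp; first exact: (measurable_fejer a0).
  exact: measurable_funB.
have E1 : (\int[Pi]_t (a / 2 + fejer a (S t - y))%:E =
    (a / 2)%:E + \int[Pi]_t (fejer a (S t - y))%:E)%E.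
  under eq_integral do rewrite EFinD.
  rewrite ge0_integralD//.
  - by rewrite integral_cst// [X in ((_ * X) + _)%E](_ : _ = 1%E) ?mule1//; exact: (probability_setT Pi).
  - by move=> t _; rewrite lee_fin divr_ge0// ltW.
  - by move=> t _; rewrite lee_fin fejer_ge0.
  - exact/measurable_EFinP.
(* The finite contribution of the constant [1] appears on both sides and cancels. *)
suff : ((a / 2)%:E + \int[Pi]_t (fejer a (S t - y))%:E <= (a / 2)%:E + D%:E)%E.
  by rewrite leeD2lE.
rewrite -E1; under eq_integral do rewrite -inner.
rewrite (fubini_tonelli (m1 := Pi) (m2 := mu) (fun z => (h z)%:E))//.
have bound : {in [set: R], forall v, (\int[Pi]_t (h (t, v))%:E <=
    ((1 - v / a) * \1_`[0%R, a] v + expR (- (k * v) ^+ 2) * \1_`[0%R, a] v)%:E)%E}.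
  move=> v _; rewrite /h /= indicE; case: (boolP (v \in _)) => [|_]; last first.
    by under eq_integral do rewrite mulr0; rewrite integral0 !mulr0 addr0.
  rewrite inE/= in_itv/= => /andP[v0 va].
  have v1 : 0 <= 1 - v / a by rewrite subr_ge0 ler_pdivrMr// mul1r.
  under eq_integral do rewrite mulr1 EFinM mulrBr.
  have mc : measurable_fun setT (fun t => (1 + cos (v * S t - v * y))%:E).
    apply/measurable_EFinP; apply: measurable_funD => //; apply: measurable_cos_comp.
    by apply: measurable_funB => //; exact: measurable_funM.
  rewrite ge0_integralZl ?lee_fin//.
  have va' : 0 <= v <= a by rewrite v0.
  have := char_le (- (v * y)) va'.
  have v1' : (0 <= (1 - v / a)%:E)%E by rewrite lee_fin.
  move=> /(lee_wpmul2l v1') /le_trans; apply; rewrite -EFinM lee_fin !mulr1 mulrDr mulr1 lerD2l.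
  have -> : - (8 / 25 * B * v ^+ 2) = - (k * v) ^+ 2.
    by rewrite exprMn sqr_sqrtr// mulr_ge0// ltW.
  have : 0 <= expR (- (k * v) ^+ 2) * (v / a).
    by rewrite mulr_ge0 ?expR_ge0// divr_ge0// ltW.
  lra.
apply: (@le_trans _ _ (\int[mu]_v
    ((1 - v / a) * \1_`[0%R, a] v + expR (- (k * v) ^+ 2) * \1_`[0%R, a] v)%:E)%E).
  apply: ge0_le_integral => //.
  - by move=> v _; apply: integral_ge0 => t _; exact: h0.
  - exact: (measurable_fun_fubini_tonelli_G (m1 := Pi) (fun z => (h z)%:E)).
  - by apply/measurable_EFinP; exact: measurable_funD.
  - by move=> v _; apply: bound; rewrite inE.
under eq_integral do rewrite EFinD.
rewrite (ge0_integralD mu measurableT); last 4 first.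
- move=> v _; rewrite lee_fin indicE; case: (boolP (v \in _)) => [|_]; last by rewrite mulr0.
  by rewrite inE/= in_itv/= mulr1 => /andP[v0 va]; rewrite subr_ge0 ler_pdivrMr// mul1r.
- exact/measurable_EFinP.
- by move=> v _; rewrite lee_fin mulr_ge0 ?expR_ge0.
- exact/measurable_EFinP.
apply: leeD.
  have an0 : a != 0 by rewrite gt_eqF.
  pose F v := v - v ^+ 2 / (2 * a).
  have dF v : is_derive v (1 : R) F (1 - v / a).
    by apply: is_derive_eq; rewrite /GRing.scale/=; field.
  have df v : is_derive v (1 : R) (fun v => 1 - v / a) (- a^-1).
    by apply: is_derive_eq; rewrite /GRing.scale/=; field.
  have h1 := integral_derivative a0 dF (is_derive_continuous df).
  have -> : (a / 2)%:E = (F a - F 0)%:E by congr EFin; rewrite /F; field.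
  rewrite -h1 [leRHS]integral_mkcond le_eqVlt; apply/orP; left; apply/eqP.
  apply: eq_integral => v _.
  by rewrite patchE indicE; case: ifPn => _; rewrite ?mulr1 ?mulr0.
rewrite /D -/k -(integral_gauss_scaled k0) [leRHS]integral_mkcond.
apply: ge0_le_integral => //.
- exact/measurable_EFinP.
- by apply/measurable_restrict => //; apply: measurable_funTS; exact/measurable_EFinP.
- move=> v _; rewrite patchE indicE; have [va|va] := boolP (v \in `[0, a]%classic).
    move: va; rewrite inE/= in_itv/= => /andP[v0 _].
    by rewrite [v \in `[0, +oo[%classic]mem_set ?mulr1//= in_itv/= v0.
  by rewrite mulr0; case: ifPn => // _; rewrite lee_fin expR_ge0.
Qed.

(** The truncated exponential widened by [r]: for [u >= t0] and [|y - u| <= r] it dominates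
    [e^(-s (u - t0))]. *)
Let G t0 y : R := \1_`[t0 - r, t0 + r] y + expR (- (s * (y - (t0 + r)))) * \1_`[t0 + r, +oo[ y.

Let G_ge0 t0 y : 0 <= G t0 y.
Proof. by rewrite addr_ge0// mulr_ge0 ?expR_ge0. Qed.

Let mG t0 : measurable_fun setT (G t0).
Proof.
apply: measurable_funD; first exact: measurable_indic.
by apply: measurable_funM; [exact: measurable_expR_affine|exact: measurable_indic].
Qed.

Let integral_G t0 : (\int[mu]_y (G t0 y)%:E = (2 * r + s^-1)%:E)%E.
Proof.
under eq_integral do rewrite EFinD.
rewrite (ge0_integralD mu measurableT); last 4 first.
- by move=> y _; rewrite lee_fin.
- by apply/measurable_EFinP; exact: measurable_indic.
- by move=> y _; rewrite lee_fin mulr_ge0 ?expR_ge0.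
- by apply/measurable_EFinP; apply: measurable_funM; [exact: measurable_expR_affine|exact: measurable_indic].
rewrite integral_indic// setIT EFinD; congr (_ + _)%E.
  rewrite [LHS]lebesgue_measure_itv/= lte_fin ltrD2l gtrN// -EFinB; congr EFin; ring.
rewrite -(integral_exp_tail (t0 + r) s0) [RHS]integral_mkcond.
apply: eq_integral => y _; rewrite patchE indicE.
by case: ifPn => _; rewrite ?mulr1 ?mulr0.
Qed.

(** The tail is at most [4 / 9] of the convolution of [G] with the kernel, whose mean is at most [D]
    times the integral [2 r + 1 / s] of [G]. Here [2 r = 100 / 9 lam], and [4 / 9 D = sqrt (2 pi) /
    (18 / 5) / sqrt B]. *)
Lemma exponential_tail_le (t0 : R) :
  (\int[Pi]_t (expR (- (s * (S t - t0))) * \1_[set u | t0 <= u] (S t))%:E <=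
   (Num.sqrt (2 * pi) / (18 / 5) * (s^-1 + 100 / 9 * lam) / Num.sqrt B)%:E)%E.
Proof.
pose g t := expR (- (s * (S t - t0))) * \1_[set u | t0 <= u] (S t).
have mg : measurable_fun setT g by exact: measurable_exponential_tail.
have g0 t : 0 <= g t by rewrite mulr_ge0 ?expR_ge0.
pose H (z : T * measurableTypeR R) := G t0 z.2 * fejer a (S z.1 - z.2).
have mH : measurable_fun setT (fun z => (H z)%:E).
  apply/measurable_EFinP; apply: measurable_funM.
    by apply: (measurableT_comp (mG t0)).
  apply: (measurableT_comp (measurable_fejer a0)).
  by apply: measurable_funB => //; apply: measurableT_comp.
have H0 z : (0 <= (H z)%:E)%E by rewrite lee_fin mulr_ge0// fejer_ge0.
have key t : ((9 / 4)%:E * (g t)%:E <= \int[mu]_y (H (t, y))%:E)%E.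
  rewrite /g indicE; have [tS|tS] := boolP (S t \in _); last first.
    by rewrite mulr0 mule0; apply: integral_ge0 => y _; exact: H0.
  move: tS; rewrite inE/= mulr1 => tS; set u := S t in tS *.
  have mHt : measurable_fun setT (fun y => (H (t, y))%:E).
    exact: (measurableT_comp mH (measurable_pair1 (T1 := T) (T2 := measurableTypeR R) t)).
  apply: (@le_trans _ _ (\int[mu]_(y in `[(u - r)%R, (u + r)%R]) (H (t, y))%:E)%E); last first.
    exact: ge0_subset_integral.
  have mfu : measurable_fun setT (fun y : measurableTypeR R => (fejer a (u - y))%:E).
    by apply/measurable_EFinP; apply: (measurableT_comp (measurable_fejer a0)); exact: measurable_funB.
  apply: (@le_trans _ _ (\int[mu]_(y in `[(u - r)%R, (u + r)%R])
      ((expR (- (s * (u - t0))))%:E * (fejer a (u - y))%:E))%E).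
    rewrite ge0_integralZl//.
    - rewrite muleC; apply: lee_wpmul2l; first by rewrite lee_fin expR_ge0.
      exact: (integral_fejer_mass a0).
    - exact: measurable_funTS.
    - by move=> y _; rewrite lee_fin fejer_ge0.
  apply: ge0_le_integral => //.
  - by move=> y _; rewrite -EFinM lee_fin mulr_ge0 ?expR_ge0// fejer_ge0.
  - by apply: emeasurable_funM => //; exact: measurable_funTS.
  - exact: measurable_funTS.
  - move=> y /=; rewrite in_itv/= => /andP[y1 y2].
    rewrite -EFinM lee_fin /H /= -/u ler_wpM2r ?fejer_ge0// /G !indicE.
    have y3 : t0 - r <= y by lra.
    have [y4|y4] := leP y (t0 + r).
      rewrite mem_set/=; last by rewrite in_itv/= y3 y4.
      apply: (@le_trans _ _ 1); last by rewrite lerDl mulr_ge0 ?expR_ge0.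
      by rewrite expR_le1 oppr_le0 mulr_ge0 ?(ltW s0)// subr_ge0.
    rewrite [y \in `[t0 + r, +oo[%classic]mem_set/= ?mulr1; last by rewrite in_itv/= andbT ltW.
    apply: (@le_trans _ _ (expR (- (s * (y - (t0 + r)))))); last by rewrite lerDr.
    by rewrite ler_expR lerN2 ler_wpM2l ?(ltW s0)//; lra.
suff : ((9 / 4)%:E * \int[Pi]_t (g t)%:E <= (D * (2 * r + s^-1))%:E)%E.
  rewrite -lee_pdivlMl// => /le_trans; apply; rewrite -EFinM lee_fin.
  have sB : 0 < Num.sqrt B by rewrite sqrtr_gt0.
  have s2 : 0 < Num.sqrt 2 :> R by rewrite sqrtr_gt0.
  have e8 : Num.sqrt (8 / 25 * B) = 2 / 5 * Num.sqrt 2 * Num.sqrt B.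
    rewrite (_ : 8 / 25 * B = (2 / 5) ^+ 2 * (2 * B)); last by field.
    by rewrite sqrtrM ?sqr_ge0// sqrtr_sqr ger0_norm// -mulrA sqrtrM.
  rewrite /D e8 sqrtrM// /r /a le_eqVlt; apply/orP; left; apply/eqP.
  have : Num.sqrt 2 ^+ 2 = 2 :> R by rewrite sqr_sqrtr.
  move: (Num.sqrt 2) s2 (Num.sqrt B) sB (Num.sqrt pi) => x x0 w w0 z x2.
  have -> : x * z / (18 / 5) * (s^-1 + 100 / 9 * lam) / w =
      x ^+ 2 * z / (18 / 5) * (s^-1 + 100 / 9 * lam) / w / x.
    by field; rewrite !gt_eqF.
  by rewrite x2; field; rewrite !gt_eqF.
rewrite -ge0_integralZl//; last 2 first.
- exact/measurable_EFinP.
- by move=> t _; rewrite lee_fin.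
apply: (@le_trans _ _ (\int[Pi]_t \int[mu]_y (H (t, y))%:E)%E).
  apply: ge0_le_integral => //.
  - by move=> t _; rewrite -EFinM lee_fin mulr_ge0.
  - by apply: emeasurable_funM => //; exact/measurable_EFinP.
  - exact: (measurable_fun_fubini_tonelli_F (m2 := mu) (fun z => (H z)%:E)).
rewrite (fubini_tonelli (m1 := Pi) (m2 := mu) (fun z => (H z)%:E))//.
apply: (@le_trans _ _ (\int[mu]_y (D%:E * (G t0 y)%:E))%E).
  apply: ge0_le_integral => //.
  - by move=> y _; apply: integral_ge0 => t _; exact: H0.
  - exact: (measurable_fun_fubini_tonelli_G (m1 := Pi) (fun z => (H z)%:E)).
  - by apply: emeasurable_funM => //; apply/measurable_EFinP; exact: mG.
  - move=> y _; rewrite /H /=; under eq_integral do rewrite EFinM.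
    rewrite ge0_integralZl//.
    + by rewrite muleC lee_wpmul2r ?lee_fin//; exact: expectation_fejer_le.
    + apply/measurable_EFinP; apply: (measurableT_comp (measurable_fejer a0)).
      exact: measurable_funB.
    + by move=> t _; rewrite lee_fin fejer_ge0.
    + by rewrite lee_fin.
rewrite ge0_integralZl ?lee_fin//.
- by rewrite integral_G.
- by apply/measurable_EFinP; exact: mG.
- by move=> y _; rewrite lee_fin.
Qed.

End concentration.

(** * Moments and the characteristic function of one centred variable *)

Section characteristic_function.
Context d (Y : measurableType d) (R : realType).
Variables (m : {measure set Y -> \bar R}) (x : Y -> R).
Hypotheses (m1 : m setT = 1%E) (mx : measurable_fun setT x).
Hypothesis x3 : m.-integrable setT (EFin \o (fun y => `|x y| ^+ 3)).

Let moo := measure1_lty m1.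

Let integrable_le (f : Y -> R) : measurable_fun setT f ->
  (forall y, `|f y| <= 1 + `|x y| ^+ 3) -> m.-integrable setT (EFin \o f).
Proof.
move=> mf fx.
apply: (le_integrable measurableT _ _ (integrable_realD (prob_integrable_cst m1 1) x3)).
  exact/measurable_EFinP.
by move=> y _ /=; rewrite lee_fin (le_trans (fx y))// ler_norm.
Qed.

Let le_cube (u : R) : 0 <= u -> u <= 1 + u ^+ 3 /\ u ^+ 2 <= 1 + u ^+ 3.
Proof.
move=> u0; have : 0 <= (u + 1) * (u - 1) ^+ 2 by rewrite mulr_ge0 ?addr_ge0// sqr_ge0.
have := sqr_ge0 u; lra.
Qed.

Lemma integrable_cube1 : m.-integrable setT (EFin \o x).
Proof.
by apply: integrable_le => // y; have [] := @le_cube `|x y|.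
Qed.

Lemma integrable_cube_norm : m.-integrable setT (EFin \o (fun y => `|x y|)).
Proof.
apply: integrable_le; first exact: measurableT_comp.
by move=> y; rewrite normr_id; have [] := @le_cube `|x y|.
Qed.

Lemma integrable_cube2 : m.-integrable setT (EFin \o (fun y => `|x y| ^+ 2)).
Proof.
apply: integrable_le; first by apply: measurable_funX; exact: measurableT_comp.
by move=> y; rewrite ger0_norm ?sqr_ge0//; have [] := @le_cube `|x y|.
Qed.

Lemma integrable_cube_signed2 : m.-integrable setT (EFin \o (fun y => x y * `|x y|)).
Proof.
apply: integrable_le; first by apply: measurable_funM => //; exact: measurableT_comp.
by move=> y; rewrite normrM normr_id -expr2; have [] := @le_cube `|x y|.
Qed.

Let b := \int[m]_y `|x y|.
Let s2 := \int[m]_y (`|x y| ^+ 2).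
Let r3 := \int[m]_y (`|x y| ^+ 3).

Let cube_polynomial c0 c1 c2 c3 c4 c5 :
  let h y := c0 + c1 * `|x y| ^+ 3 + c2 * `|x y| ^+ 2 + c3 * `|x y| + c4 * x y +
    c5 * (x y * `|x y|) in
  m.-integrable setT (EFin \o h) /\
  \int[m]_y h y = c0 + c1 * r3 + c2 * s2 + c3 * b + c4 * \int[m]_y x y +
    c5 * \int[m]_y (x y * `|x y|).
Proof.
have l1 := integrable_realD (prob_integrable_cst m1 c0) (integrable_realZ c1 x3).
have l2 := integrable_realD l1 (integrable_realZ c2 integrable_cube2).
have l3 := integrable_realD l2 (integrable_realZ c3 integrable_cube_norm).
have l4 := integrable_realD l3 (integrable_realZ c4 integrable_cube1).
have k5 := integrable_realZ c5 integrable_cube_signed2.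
split; first exact: integrable_realD l4 k5.
rewrite (RintegralD measurableT l4 k5) (RintegralD measurableT l3 (integrable_realZ c4 integrable_cube1)).
rewrite (RintegralD measurableT l2 (integrable_realZ c3 integrable_cube_norm)).
rewrite (RintegralD measurableT l1 (integrable_realZ c2 integrable_cube2)).
rewrite (RintegralD measurableT (prob_integrable_cst m1 c0) (integrable_realZ c1 x3)).
rewrite Rintegral_prob_cst// (RintegralZl _ measurableT x3).
rewrite (RintegralZl _ measurableT integrable_cube2) (RintegralZl _ measurableT integrable_cube_norm).
rewrite (RintegralZl _ measurableT integrable_cube1).
by rewrite (RintegralZl _ measurableT integrable_cube_signed2).
Qed.

(** The mean of [(|x| + b) (|x| - b)^2] is nonnegative, and its terms in [b^3] cancel. *)
Lemma mean_mul_second_moment_le : b * s2 <= r3.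
Proof.
have [_] := cube_polynomial (b ^+ 3) 1 (- b) (- b ^+ 2) 0 0.
suff : 0 <= \int[m]_y (b ^+ 3 + 1 * `|x y| ^+ 3 + - b * `|x y| ^+ 2 + - b ^+ 2 * `|x y| +
    0 * x y + 0 * (x y * `|x y|)) by move=> h e; move: h; rewrite e [b ^+ 3]exprS; lra.
apply: Rintegral_ge0 => // y _; have : 0 <= b by apply: Rintegral_ge0.
have : 0 <= `|x y| by [].
move: `|x y| b => u w u0 w0.
rewrite (_ : _ + _ = (u + w) * (u - w) ^+ 2); last by ring.
by apply: mulr_ge0; [exact: addr_ge0|exact: sqr_ge0].
Qed.

(** Split at [|x| = t]. It serves to deduce a positive third moment from a positive second one. *)
Lemma second_moment_le_cube t : 0 < t -> s2 <= t ^+ 2 + r3 / t.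
Proof.
move=> t0; have [j iE] := cube_polynomial (t ^+ 2) t^-1 0 0 0 0.
have -> : t ^+ 2 + r3 / t = t ^+ 2 + t^-1 * r3 + 0 * s2 + 0 * b + 0 * \int[m]_y x y +
    0 * \int[m]_y (x y * `|x y|) by rewrite !mul0r !addr0 mulrC.
rewrite -iE; apply: (le_Rintegral measurableT integrable_cube2 j) => y _.
rewrite !mul0r !addr0.
have [xt|xt] := leP `|x y| t.
  apply: (@le_trans _ _ (t ^+ 2)); first by rewrite lerXn2r ?nnegrE// ltW.
  by rewrite lerDl mulr_ge0 ?exprn_ge0// invr_ge0 ltW.
apply: (@le_trans _ _ (t^-1 * `|x y| ^+ 3)); last by rewrite lerDr sqr_ge0.
by rewrite mulrC ler_pdivlMr// [_ ^+ 3]exprSr ler_wpM2l ?sqr_ge0// ltW.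
Qed.

Lemma integrable_cube_shift c : m.-integrable setT (EFin \o (fun y => `|x y - c| ^+ 3)).
Proof.
have j1 := integrable_realZ 4 x3; have j2 := prob_integrable_cst m1 (4 * `|c| ^+ 3).
apply: (le_integrable measurableT _ _ (integrable_realD j1 j2)).
  apply/measurable_EFinP; apply: measurable_funX; apply: measurableT_comp => //.
  exact: measurable_funB.
move=> y _ /=; rewrite lee_fin [leLHS]ger0_norm ?exprn_ge0// [leRHS]ger0_norm; last first.
  by apply: addr_ge0; apply: mulr_ge0 => //; exact: exprn_ge0.
apply: (@le_trans _ _ ((`|x y| + `|c|) ^+ 3)).
  have xc : 0 <= `|x y| + `|c| by exact: addr_ge0.
  by apply: lerXn2r; [rewrite nnegrE|rewrite nnegrE|exact: ler_normB].
have : 0 <= `|x y| by []. have : 0 <= `|c| by [].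
move: `|x y| `|c| => u w w0 u0.
rewrite -subr_ge0 (_ : _ - _ = 3 * ((u + w) * (u - w) ^+ 2)); last by ring.
by apply: mulr_ge0 => //; apply: mulr_ge0; [exact: addr_ge0|exact: sqr_ge0].
Qed.

Hypothesis x_mean : \int[m]_y x y = 0.

Let integrable_cos v th : m.-integrable setT (EFin \o (fun y => cos (v * x y + th))).
Proof.
apply: (@bounded_integrable _ _ _ _ _ 1) => //; last by move=> y; rewrite ler_norml cos_geN1 cos_le1.
apply: (measurableT_comp (continuous_measurable_fun (@continuous_cos R))).
by apply: measurable_funD => //; exact: measurable_funM.
Qed.

Let integrable_sin v : m.-integrable setT (EFin \o (fun y => sin (v * x y))).
Proof.
apply: (@bounded_integrable _ _ _ _ _ 1) => //; last by move=> y; rewrite ler_norml sin_geN1 sin_le1.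
apply: (measurableT_comp (continuous_measurable_fun (@continuous_sin R))).
exact: measurable_funM.
Qed.

Let integrable_cos0 v : m.-integrable setT (EFin \o (fun y => cos (v * x y))).
Proof. by have := integrable_cos v 0; under eq_fun do rewrite /= addr0. Qed.

Let C v := \int[m]_y cos (v * x y).
Let D v := \int[m]_y sin (v * x y).

Lemma Rintegral_cos_shift v th :
  \int[m]_y cos (v * x y + th) = C v * cos th - D v * sin th.
Proof.
under eq_Rintegral do rewrite cosD [cos _ * cos _]mulrC [sin _ * sin _]mulrC.
rewrite (RintegralB measurableT (integrable_realZ _ (integrable_cos0 v))
  (integrable_realZ _ (integrable_sin v))).
rewrite (RintegralZl _ measurableT (integrable_cos0 v)).
by rewrite (RintegralZl _ measurableT (integrable_sin v)) mulrC [X in _ - X]mulrC.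
Qed.

Lemma Rintegral_sin_shift v th :
  \int[m]_y sin (v * x y + th) = C v * sin th + D v * cos th.
Proof.
under eq_Rintegral do rewrite sinD addrC [cos _ * sin _]mulrC [sin _ * cos _]mulrC.
rewrite (RintegralD measurableT (integrable_realZ _ (integrable_cos0 v))
  (integrable_realZ _ (integrable_sin v))).
rewrite (RintegralZl _ measurableT (integrable_cos0 v)).
by rewrite (RintegralZl _ measurableT (integrable_sin v)) mulrC [X in _ + X]mulrC.
Qed.

(** Multiplication of [a + i b'] by the characteristic function [C v + i D v], in real terms: the
    induction step for sums of independent variables. *)
Lemma integral_rotation v th a b' :
  (\int[m]_y (1 + (a * cos (v * x y + th) - b' * sin (v * x y + th)))%:E =
   (1 + ((a * C v - b' * D v) * cos th - (a * D v + b' * C v) * sin th))%:E)%E.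
Proof.
have jc := integrable_cos v th.
have js : m.-integrable setT (EFin \o (fun y => sin (v * x y + th))).
  apply: (@bounded_integrable _ _ _ _ _ 1) => //; last by move=> y; rewrite ler_norml sin_geN1 sin_le1.
  apply: (measurableT_comp (continuous_measurable_fun (@continuous_sin R))).
  by apply: measurable_funD => //; exact: measurable_funM.
have j1 := integrable_realB (integrable_realZ a jc) (integrable_realZ b' js).
have j2 := integrable_realD (prob_integrable_cst m1 1) j1.
rewrite -(fineK (integrable_fin_num measurableT j2)); congr EFin.
rewrite -/(Rintegral m setT _).
rewrite (RintegralD measurableT (prob_integrable_cst m1 1) j1) Rintegral_prob_cst//.
rewrite (RintegralB measurableT (integrable_realZ a jc) (integrable_realZ b' js)).
rewrite (RintegralZl _ measurableT jc) (RintegralZl _ measurableT js).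
by rewrite Rintegral_cos_shift Rintegral_sin_shift; ring.
Qed.

(* Squared modulus of the characteristic function, i.e. the characteristic
   function of the difference of two independent copies; the third absolute
   moment of that difference is at most four times the one of [x]. *)
Lemma characteristic_sqr_le v : 0 <= v ->
  C v ^+ 2 + D v ^+ 2 <= expR (- (v ^+ 2 * s2) + 2 / 3 * v ^+ 3 * r3).
Proof.
move=> v0.
have inner y : C v * cos (v * x y) + D v * sin (v * x y) <=
    1 - v ^+ 2 / 2 * (s2 + `|x y| ^+ 2) + v ^+ 3 / 6 *
    (r3 + `|x y| ^+ 2 * b + `|x y| * s2 + `|x y| ^+ 3) -
    v ^+ 3 / 3 * (x y * \int[m]_z (x z * `|x z|)).
  have -> : C v * cos (v * x y) + D v * sin (v * x y) =
      \int[m]_z cos (v * x z + - (v * x y)).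
    by rewrite Rintegral_cos_shift cosN sinN mulrN opprK.
  set u := x y.
  have [j iE] := cube_polynomial (1 - v ^+ 2 / 2 * u ^+ 2 + v ^+ 3 / 6 * (`|u| ^+ 3)) (v ^+ 3 / 6)
    (v ^+ 3 / 6 * `|u| - v ^+ 2 / 2) (v ^+ 3 / 6 * u ^+ 2)
    (v ^+ 2 * u - v ^+ 3 / 3 * u * `|u|) (- (v ^+ 3 / 3 * u)).
  have e2 : `|u| ^+ 2 = u ^+ 2 by rewrite real_normK ?num_real.
  apply: le_trans (le_Rintegral measurableT (integrable_cos _ _) j _) _ => [z _|].
    move: (x z) => w.
    rewrite (_ : v * w + - (v * u) = v * (w - u)); last by ring.
    apply: (le_trans (cos_le_cubic _)); rewrite normrM (ger0_norm v0).
    (* The expansion leaves the signed terms [w u |w|] and [w u |u|], which have mean zero because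
       [x] is centred. *)
    have h : `|w - u| ^+ 3 <= (`|w| + `|u|) * (w - u) ^+ 2.
      by rewrite exprS real_normK ?num_real// ler_wpM2r ?sqr_ge0// ler_normB.
    have v3 : 0 <= v ^+ 3 / 6 by rewrite divr_ge0// exprn_ge0.
    have := ler_wpM2l v3 h; rewrite [(v * `|_|) ^+ 3]exprMn [(v * (_ - _)) ^+ 2]exprMn.
    have e1 : `|w| ^+ 2 = w ^+ 2 by rewrite real_normK ?num_real.
    rewrite [`|w| ^+ 3]exprS [`|u| ^+ 3]exprS e1 e2.
    move: (`|w - u| ^+ 3) `|w| `|u| => A wn un /=; lra.
  by rewrite iE x_mean e2; lra.
pose c0 := \int[m]_z (x z * `|x z|).
have j1 := integrable_realD (integrable_realZ (C v) (integrable_cos0 v))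
  (integrable_realZ (D v) (integrable_sin v)).
have [j2 iE] := cube_polynomial (1 - v ^+ 2 / 2 * s2 + v ^+ 3 / 6 * r3) (v ^+ 3 / 6)
  (v ^+ 3 / 6 * b - v ^+ 2 / 2) (v ^+ 3 / 6 * s2) (- (v ^+ 3 / 3 * c0)) 0.
have : C v ^+ 2 + D v ^+ 2 = \int[m]_y (C v * cos (v * x y) + D v * sin (v * x y)).
  rewrite (RintegralD measurableT (integrable_realZ (C v) (integrable_cos0 v))
    (integrable_realZ (D v) (integrable_sin v))).
  by rewrite (RintegralZl _ measurableT (integrable_cos0 v)) (RintegralZl _ measurableT (integrable_sin v)).
move=> ->; apply: le_trans (le_Rintegral measurableT j1 j2 _) _ => [y _|].
  by apply: (le_trans (inner y)); rewrite -/c0; lra.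
rewrite iE x_mean.
apply: (le_trans _ (expR_ge1Dx _)).
have v3 : 0 <= v ^+ 3 / 3 by rewrite divr_ge0// exprn_ge0.
have := ler_wpM2l v3 mean_mul_second_moment_le.
lra.
Qed.

End characteristic_function.

(** * Product measures and list codes *)

Section product_measure.
Context d (Y : measurableType d) (R : realType) (X : eqType).
Local Notation meas := {measure set Y -> \bar R}.
Local Open Scope ereal_scope.

(* [iprod_int] integrates functions of sequences; this is a function of
   [n]-tuples extended by [0] to all sequences, as in [prod_chan]. *)
Definition on_seq n (F : n.-tuple Y -> \bar R) (u : seq Y) : \bar R :=
  match insub u with Some t => F t | None => 0 end.

Lemma on_seq_tuple n (F : n.-tuple Y -> \bar R) (t : n.-tuple Y) : on_seq F t = F t.
Proof. by rewrite /on_seq valK. Qed.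

Lemma on_seq_cons n (F : n.+1.-tuple Y -> \bar R) y :
  (fun u => on_seq F (y :: u)) = on_seq (fun t : n.-tuple Y => F [tuple of y :: t]).
Proof.
apply/funext => u; rewrite /on_seq; case: insubP => [t tu tE|nu].
  have su : size u == n by move: tu.
  have -> : insub u = Some (Tuple su) :> option (n.-tuple Y) by rewrite insubT.
  by congr F; apply: val_inj; rewrite tE.
by rewrite insubF//; apply/negbTE.
Qed.

(** Built by induction, as the image under cons of the product of the first letter's measure with
    the measure for the rest. It makes linearity, monotonicity and Tonelli available for iterated
    integrals. *)
Lemma product_measure (V : X -> meas) n (s : n.-tuple X) :
  (forall x, x \in s -> V x setT = 1) ->
  exists Pi : probability (n.-tuple Y) R,
    forall F : n.-tuple Y -> \bar R, measurable_fun setT F -> (forall t, 0 <= F t) ->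
      iprod_int [seq V x | x <- s] (on_seq F) = \int[Pi]_t F t.
Proof.
elim: n s => [s _|n IH].
  exists [the probability _ _ of dirac [tuple]] => F mF F0.
  rewrite (tuple0 s) /= integral_dirac// diracT mul1e.
  exact: (on_seq_tuple F [tuple]).
case/tupleP => x s V1.
have [Pi PiE] := IH s (fun z zs => V1 z (mem_behead (s := x :: s) zs)).
have [p pV] := probability_copy (V1 x (mem_head x s)).
pose c (z : Y * n.-tuple Y) : n.+1.-tuple Y := [tuple of z.1 :: z.2].
have mc : measurable_fun setT c by exact: measurable_cons.
pose cX : {mfun _ >-> _} := HB.pack c (isMeasurableFun.Build _ _ _ _ c mc).
exists [the probability _ _ of distribution (p \x Pi)%E cX] => F mF F0.
rewrite [RHS]ge0_integral_pushforward// preimage_setT /=.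
have mFc : measurable_fun setT (F \o c) by exact: measurableT_comp.
rewrite [RHS](fubini_tonelli1 (F \o c))//; last by move=> z; exact: F0.
rewrite (eq_integral_measure _ _ (esym pV)).
apply: eq_integral => y _; rewrite on_seq_cons PiE//.
apply: measurableT_comp => //.
exact: measurable_cons.
Qed.

Lemma measurable_iprod_int (V : X -> meas) n (s : n.-tuple X)
    (F : Y -> n.-tuple Y -> \bar R) :
  (forall x, x \in s -> V x setT = 1) ->
  measurable_fun setT (fun z : Y * n.-tuple Y => F z.1 z.2) ->
  (forall y t, 0 <= F y t) ->
  measurable_fun setT (fun y => iprod_int [seq V x | x <- s] (on_seq (F y))).
Proof.
move=> V1 mF F0; have [Pi PiE] := product_measure V1.
have mFy y : measurable_fun setT (F y).
  exact: (measurableT_comp mF (measurable_pair1 (T1 := Y) y)).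
rewrite (_ : (fun y => _) = fun y => \int[Pi]_t F y t).
  exact: (measurable_fun_fubini_tonelli_F (m2 := Pi) (fun z => F z.1 z.2)).
by apply/funext => y; rewrite PiE.
Qed.

Lemma iprod_int_ge0 (V : X -> meas) n (s : n.-tuple X) (F : n.-tuple Y -> \bar R) :
  (forall t, 0 <= F t) -> 0 <= iprod_int [seq V x | x <- s] (on_seq F).
Proof.
elim: n s F => [s F F0|n IH]; first by rewrite (tuple0 s) /= (on_seq_tuple F [tuple]).
case/tupleP => x s F F0 /=; apply: integral_ge0 => y _.
by rewrite on_seq_cons IH.
Qed.

Lemma iprod_int_dens (Q : meas) (W : X -> meas) (f : X -> Y -> R) n (s : n.-tuple X)
    (F : n.-tuple Y -> \bar R) :
  Q setT = 1 -> (forall x, x \in s -> W x setT = 1) ->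
  (forall x, x \in s -> has_dens Q (W x) (f x)) ->
  measurable_fun setT F -> (forall t, 0 <= F t) ->
  iprod_int [seq W x | x <- s] (on_seq F) = iprod_int [seq Q | x <- s]
    (on_seq (fun t => F t * (\prod_(i < n) f (tnth s i) (tnth t i))%:E)).
Proof.
move=> Q1; elim: n s F => [s F _ _ _ _|n IH].
  rewrite (tuple0 s) /= !(on_seq_tuple _ [tuple]) big_ord0 mule1//.
case/tupleP => x s F W1 Wf mF F0.
have xs z : z \in s -> z \in [tuple of x :: s] by exact: (mem_behead (s := x :: s)).
have Wx1 := W1 x (mem_head x s).
have Wfx := Wf x (mem_head x s).
have mcons y : measurable_fun setT (fun t : n.-tuple Y => [the n.+1.-tuple Y of y :: t]).
  exact: measurable_cons.
have mFz : measurable_fun setT (fun z : Y * n.-tuple Y => F [tuple of z.1 :: z.2]).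
  by apply: measurableT_comp => //; exact: measurable_cons.
rewrite /=; under eq_integral do rewrite on_seq_cons.
have W1s z : z \in s -> W z setT = 1 by move=> /xs; exact: W1.
have Wfs z : z \in s -> has_dens Q (W z) (f z) by move=> /xs; exact: Wf.
rewrite (ge0_integral_has_dens _ _ Wfx); last 4 first.
- by rewrite Wx1 ltry.
- by rewrite Q1 ltry.
- exact: (measurable_iprod_int (F := fun y t => F [tuple of y :: t]) W1s).
- by move=> y; apply: iprod_int_ge0.
apply: eq_integral => y _; rewrite on_seq_cons.
have mFy : measurable_fun setT (fun t : n.-tuple Y => F [tuple of y :: t]) by exact: (measurableT_comp mF (mcons y)).
rewrite (IH s _ W1s Wfs mFy (fun t => F0 [tuple of y :: t])).
have [Pi PiE] := @product_measure (fun=> Q) n s (fun _ _ => Q1).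
have fx0 : (0 <= f x y)%R by exact: (has_dens_ge0 Wfx).
have p0 (t : n.-tuple Y) : (0 <= \prod_(i < n) f (tnth s i) (tnth t i))%R.
  by apply: prodr_ge0 => i _; exact: (has_dens_ge0 (Wfs _ (mem_tnth i s))).
have mp : measurable_fun setT (fun t : n.-tuple Y => \prod_(i < n) f (tnth s i) (tnth t i))%R.
  apply: measurable_prod => i _.
  apply: (measurableT_comp (has_dens_measurable (Wfs _ (mem_tnth i s)))).
  exact: measurable_tnth.
rewrite PiE; last 2 first.
- by apply: emeasurable_funM => //; exact/measurable_EFinP.
- by move=> t; rewrite mule_ge0// lee_fin.
have pE (t : n.-tuple Y) : F [tuple of y :: t] *
    (\prod_(i < n.+1) f (tnth [tuple of x :: s] i) (tnth [tuple of y :: t] i))%:E =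
    (f x y)%:E * (F [tuple of y :: t] * (\prod_(i < n) f (tnth s i) (tnth t i))%:E).
  rewrite big_ord_recl !tnth0 EFinM muleCA; congr (_ * (_ * _%:E)).
  by apply: eq_bigr => i _; rewrite !tnthS.
transitivity (iprod_int [seq Q | _ <- s] (on_seq (fun t : n.-tuple Y =>
    (f x y)%:E * (F [tuple of y :: t] * (\prod_(i < n) f (tnth s i) (tnth t i))%:E)))); last first.
  by congr (iprod_int _ (on_seq _)); apply/funext => t; rewrite -pE.
rewrite PiE; last 2 first.
- by apply: emeasurable_funM => //; apply: emeasurable_funM => //; exact/measurable_EFinP.
- by move=> t; rewrite mule_ge0 ?lee_fin// mule_ge0// lee_fin.
rewrite ge0_integralZl//.
- by rewrite muleC.
- by apply: emeasurable_funM => //; exact/measurable_EFinP.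
- by move=> t _; rewrite mule_ge0// lee_fin.
Qed.

End product_measure.

(** * Exponential tails under the tilted product measure *)

Section product_concentration.
Context d (Y : measurableType d) (R : realType) (X : eqType).
Local Notation meas := {measure set Y -> \bar R}.
Variables (V : X -> meas) (g : X -> Y -> R) (n : nat).
Implicit Types s : n.-tuple X.

Let measurable_letter_sum s : (forall x, x \in s -> measurable_fun setT (g x)) ->
  measurable_fun setT (fun t : n.-tuple Y => \sum_(i < n) g (tnth s i) (tnth t i)).
Proof.
move=> mg; apply: measurable_sum => i.
exact: (measurableT_comp (mg _ (mem_tnth i s)) (measurable_tnth i)).
Qed.

(** The pair [ab] holds the real and imaginary parts of the characteristic function of the sum. The
    phase [th] is kept free so that the induction can absorb the first letter into it; only the
    modulus, which factorises, is needed afterwards. *)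
Lemma iprod_int_cos s v :
  (forall x, x \in s -> V x setT = 1%E) ->
  (forall x, x \in s -> measurable_fun setT (g x)) ->
  exists ab : R * R,
    ab.1 ^+ 2 + ab.2 ^+ 2 = \prod_(i < n)
      ((\int[V (tnth s i)]_y cos (v * g (tnth s i) y)) ^+ 2 +
       (\int[V (tnth s i)]_y sin (v * g (tnth s i) y)) ^+ 2) /\
    forall th, iprod_int [seq V x | x <- s] (on_seq (fun t : n.-tuple Y =>
      (1 + cos (v * \sum_(i < n) g (tnth s i) (tnth t i) + th))%:E)) =
      (1 + (ab.1 * cos th - ab.2 * sin th))%:E.
Proof.
elim: n s => [s _ _|k IH].
  exists (1, 0); rewrite /= big_ord0 expr1n expr0n addr0; split => // th.
  by rewrite (tuple0 s) /= (on_seq_tuple _ [tuple]) big_ord0 mulr0 add0r mul1r mul0r subr0.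
case/tupleP => x s V1 mg.
have xs z : z \in s -> z \in [tuple of x :: s] by exact: (mem_behead (s := x :: s)).
have [[a b] [abE H]] := IH s (fun z zs => V1 z (xs z zs)) (fun z zs => mg z (xs z zs)).
have Vx := V1 x (mem_head x s); have mx := mg x (mem_head x s).
set c := \int[V x]_y cos (v * g x y); set e := \int[V x]_y sin (v * g x y).
exists (a * c - b * e, a * e + b * c) => /=; split.
  rewrite big_ord_recl tnth0 -/c -/e.
  under eq_bigr do rewrite tnthS.
  by rewrite -abE /=; ring.
move=> th; rewrite -(integral_rotation Vx mx).
apply: eq_integral => y _; rewrite on_seq_cons -H.
congr (iprod_int _ (on_seq _)); apply/funext => t; rewrite big_ord_recl !tnth0.
under eq_bigr do rewrite !tnthS.
by congr (1 + cos _)%:E; ring.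
Qed.

Variable s : n.-tuple X.
Hypotheses (V1 : forall x, x \in s -> V x setT = 1%E)
  (mg : forall x, x \in s -> measurable_fun setT (g x))
  (g3 : forall x, x \in s -> (V x).-integrable setT (EFin \o (fun y => `|g x y| ^+ 3)))
  (g_mean : forall x, x \in s -> \int[V x]_y g x y = 0).
Variables B lam : R.
Hypotheses (B0 : 0 < B) (lam0 : 0 < lam)
  (BE : \sum_(i < n) \int[V (tnth s i)]_y (`|g (tnth s i) y| ^+ 2) = B)
  (lamE : \sum_(i < n) \int[V (tnth s i)]_y (`|g (tnth s i) y| ^+ 3) = lam * B).

Lemma product_characteristic_le v th : 0 <= v <= 27 / 50 / lam ->
  (iprod_int [seq V x | x <- s] (on_seq (fun t : n.-tuple Y =>
      (1 + cos (v * \sum_(i < n) g (tnth s i) (tnth t i) + th))%:E)) <=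
   (1 + expR (- (8 / 25 * B * v ^+ 2)))%:E)%E.
Proof.
move=> /andP[v0 va]; have [[a b] [abE ->]] := iprod_int_cos v V1 mg.
rewrite lee_fin lerD2l.
(* The defect of the squares is [(a sin th + b cos th)^2]. *)
have le_modulus : a * cos th - b * sin th <= Num.sqrt (a ^+ 2 + b ^+ 2).
  have [h|h] := leP (a * cos th - b * sin th) 0; first exact: le_trans h (sqrtr_ge0 _).
  rewrite -ler_sqr ?nnegrE ?sqrtr_ge0 ?(ltW h)//.
  rewrite sqr_sqrtr ?addr_ge0 ?sqr_ge0// -subr_ge0.
  have := sqr_ge0 (a * sin th + b * cos th).
  have := cos2Dsin2 th.
  move: (cos th) (sin th) => x y xy1.
  have -> : a ^+ 2 + b ^+ 2 = (a ^+ 2 + b ^+ 2) * (x ^+ 2 + y ^+ 2) by rewrite xy1 mulr1.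
  by congr (0 <= _); ring.
apply: (le_trans le_modulus).
have -> : expR (- (8 / 25 * B * v ^+ 2)) = Num.sqrt (expR (- (16 / 25 * B * v ^+ 2))).
  rewrite (_ : - (16 / 25 * B * v ^+ 2) = - (8 / 25 * B * v ^+ 2) + - (8 / 25 * B * v ^+ 2)); last by field.
  by rewrite expRD -expr2 sqrtr_sqr ger0_norm// expR_ge0.
rewrite ler_wsqrtr// abE.
apply: (@le_trans _ _ (\prod_(i < n) expR (- (v ^+ 2 *
    \int[V (tnth s i)]_y (`|g (tnth s i) y| ^+ 2)) +
    2 / 3 * v ^+ 3 * \int[V (tnth s i)]_y (`|g (tnth s i) y| ^+ 3)))).
  apply: ler_prod => i _; rewrite addr_ge0 ?sqr_ge0//=.
  by apply: characteristic_sqr_le => //; [apply: V1|apply: mg|apply: g3|apply: g_mean];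
    exact: mem_tnth.
rewrite -expR_sum ler_expR big_split/= sumrN -!mulr_sumr BE lamE.
(* This bounds the exponent [- B v^2 (1 - 2 / 3 v lam)] of the squared modulus by
   [- 16 / 25 B v^2]. *)
have h : v * lam <= 27 / 50 by rewrite -ler_pdivlMr.
have := ler_wpM2l (mulr_ge0 (ltW B0) (sqr_ge0 v)) h.
by rewrite [v ^+ 3]exprS; move: (v ^+ 2) => w; lra.
Qed.

Lemma product_exponential_tail (sg t0 : R) : 0 < sg ->
  (iprod_int [seq V x | x <- s] (on_seq (fun t : n.-tuple Y =>
     let u := (\sum_(i < n) g (tnth s i) (tnth t i))%R in
     (expR (- (sg * (u - t0))) * \1_[set u | t0 <= u] u)%:E)) <=
   (Num.sqrt (2 * pi) / (18 / 5) * (sg^-1 + 100 / 9 * lam) / Num.sqrt B)%:E)%E.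
Proof.
move=> sg0; have [Pi PiE] := product_measure V1.
pose S (t : n.-tuple Y) : R := \sum_(i < n) g (tnth s i) (tnth t i).
have mS : measurable_fun setT S by exact: measurable_letter_sum.
rewrite PiE.
- apply: exponential_tail_le => // v th vI.
  rewrite -PiE; first exact: product_characteristic_le.
  + apply/measurable_EFinP; apply: measurable_funD => //.
    apply: (measurableT_comp (continuous_measurable_fun (@continuous_cos R))).
    by apply: measurable_funD => //; exact: measurable_funM.
  + by move=> t; rewrite lee_fin; have := cos_geN1 (v * S t + th); lra.
- by apply/measurable_EFinP; exact: (measurable_exponential_tail _ _ mS).
- by move=> t; rewrite lee_fin mulr_ge0 ?expR_ge0.
Qed.

End product_concentration.

Section one_codeword.
Context d (Y : measurableType d) (R : realType) (X : eqType).
Local Notation meas := {measure set Y -> \bar R}.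
Variables (Q : meas) (W V : X -> meas) (f v : X -> Y -> R) (z mean : X -> R).
Variables (sg : R) (n : nat) (s : n.-tuple X).
Let g x y := ln (f x y) - mean x.
Hypotheses (sg0 : 0 < sg) (Q1 : Q setT = 1%E)
  (W1 : forall x, x \in s -> W x setT = 1%E)
  (V1 : forall x, x \in s -> V x setT = 1%E)
  (Wf : forall x, x \in s -> has_dens Q (W x) (f x))
  (Vv : forall x, x \in s -> has_dens Q (V x) (v x))
  (z0 : forall x, x \in s -> 0 < z x)
  (fE : forall x, x \in s -> forall y, f x y = v x y * (z x * expR (- (sg * ln (f x y)))))
  (g3 : forall x, x \in s -> (V x).-integrable setT (EFin \o (fun y => `|g x y| ^+ 3)))
  (g_mean : forall x, x \in s -> \int[V x]_y g x y = 0).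
Variables B lam K kap : R.
Hypotheses (B0 : 0 < B) (lam0 : 0 < lam)
  (BE : \sum_(i < n) \int[V (tnth s i)]_y (`|g (tnth s i) y| ^+ 2) = B)
  (lamE : \sum_(i < n) \int[V (tnth s i)]_y (`|g (tnth s i) y| ^+ 3) = lam * B)
  (KE : \sum_(i < n) mean (tnth s i) = K)
  (kapE : \sum_(i < n) ln (z (tnth s i)) = kap).

Let G := Num.sqrt (2 * pi) / (18 / 5) * (sg^-1 + 100 / 9 * lam) / Num.sqrt B.
Let S (t : n.-tuple Y) := \sum_(i < n) g (tnth s i) (tnth t i).

(* Change of measure on [{prod f > e^tau}], where the log-likelihood sum exceeds
   [tau]; the remaining part of [A] is charged to [Q]. *)
Lemma correct_decoding_le (A : set (n.-tuple Y)) tau : measurable A ->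
  (iprod_int [seq W x | x <- s] (on_seq (fun t => (\1_A t)%:E)) <=
   (expR tau)%:E * iprod_int [seq Q | x <- s] (on_seq (fun t => (\1_A t)%:E)) +
   (expR (kap - sg * tau) * G)%:E)%E.
Proof.
move=> mA.
have m1A : measurable_fun setT (fun t : n.-tuple Y => (\1_A t)%:E : \bar R).
  by apply/measurable_EFinP; exact: measurable_indic.
have A0 t : (0 <= (\1_A t)%:E :> \bar R)%E by rewrite lee_fin.
have [Pi PiE] := @product_measure _ _ _ _ (fun=> Q) n s (fun _ _ => Q1).
have mg x : x \in s -> measurable_fun setT (g x).
  move=> xs; apply: measurable_funB => //; apply: measurable_ln_comp.
  exact: has_dens_measurable (Wf xs).
have mS : measurable_fun setT S.
  apply: measurable_sum => i.
  exact: (measurableT_comp (mg _ (mem_tnth i s)) (measurable_tnth i)).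
have mprod (h : X -> Y -> R) : (forall x, x \in s -> measurable_fun setT (h x)) ->
    measurable_fun setT (fun t : n.-tuple Y => \prod_(i < n) h (tnth s i) (tnth t i)).
  move=> mh; apply: measurable_prod => i _.
  exact: (measurableT_comp (mh _ (mem_tnth i s)) (measurable_tnth i)).
have mpf := mprod f (fun x xs => has_dens_measurable (Wf xs)).
have mpv := mprod v (fun x xs => has_dens_measurable (Vv xs)).
pose pf (t : n.-tuple Y) := \prod_(i < n) f (tnth s i) (tnth t i).
pose pv (t : n.-tuple Y) := \prod_(i < n) v (tnth s i) (tnth t i).
have pf0 t : 0 <= pf t.
  by apply: prodr_ge0 => i _; exact: (has_dens_ge0 (Wf (mem_tnth i s))).
have pv0 t : 0 <= pv t.
  by apply: prodr_ge0 => i _; exact: (has_dens_ge0 (Vv (mem_tnth i s))).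
pose t0 := tau - K.
pose h (t : n.-tuple Y) := expR (- (sg * (S t - t0))) * \1_[set u | t0 <= u] (S t).
have h0 t : 0 <= h t by rewrite mulr_ge0 ?expR_ge0.
have mh : measurable_fun setT h by exact: measurable_exponential_tail.
have sumln t : \sum_(i < n) ln (f (tnth s i) (tnth t i)) = S t + K.
  by rewrite /S /g -KE -big_split; apply: eq_bigr => i _ /=; rewrite subrK.
have pfE t : pf t = pv t * (expR kap * expR (- (sg * (S t + K)))).
  rewrite -expRD -sumln -kapE mulr_sumr -sumrN -big_split expR_sum -big_split/=.
  apply: eq_bigr => i _; rewrite {1}fE ?mem_tnth// expRD lnK// posrE.
  by apply: z0; exact: mem_tnth.
have pointwise t : \1_A t * pf t <=
    expR tau * \1_A t + expR (kap - sg * tau) * (h t * pv t).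
  have k0 : 0 <= expR (kap - sg * tau) * (h t * pv t).
    by rewrite mulr_ge0 ?expR_ge0// mulr_ge0.
  rewrite indicE; case: (t \in A); last by rewrite mul0r mulr0 add0r.
  rewrite mul1r mulr1; have [pft|pft] := leP (pf t) (expR tau).
    by apply: (le_trans pft); rewrite lerDl.
  apply: (@le_trans _ _ (expR (kap - sg * tau) * (h t * pv t))); last by rewrite lerDr expR_ge0.
  (* By convention [ln 0 = 0], so the product equals the exponential of the sum of logarithms only
     once every factor is known to be positive. *)
  have fpos i : 0 < f (tnth s i) (tnth t i).
    rewrite lt_neqAle (has_dens_ge0 (Wf (mem_tnth i s))) andbT eq_sym.
    apply: contraTneq pft => fi0.
    by rewrite -leNgt /pf (bigD1 i)//= fi0 mul0r expR_ge0.
  have tS : t0 <= S t.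
    rewrite /t0 lerBlDr -sumln -ler_expR expR_sum.
    rewrite (eq_bigr (fun i => f (tnth s i) (tnth t i))); first exact: ltW.
    by move=> i _; rewrite lnK ?posrE.
  rewrite /h indicE mem_set// mulr1 pfE -expRD mulrA -expRD mulrC /t0.
  by rewrite le_eqVlt; apply/orP; left; apply/eqP; congr (expR _ * _); ring.
have tail := product_exponential_tail V1 mg g3 g_mean B0 lam0 BE lamE t0 sg0.
rewrite (iprod_int_dens Q1 W1 Wf m1A A0).
rewrite (iprod_int_dens (F := fun t => (h t)%:E) Q1 V1 Vv) in tail; last 2 first.
- exact/measurable_EFinP.
- by move=> t; rewrite lee_fin.
rewrite PiE in tail; last 2 first.
- by apply: emeasurable_funM; exact/measurable_EFinP.
- by move=> t; rewrite mule_ge0 ?lee_fin//; exact: pv0.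
rewrite (PiE _ m1A A0) PiE; last 2 first.
- by apply: emeasurable_funM => //; exact/measurable_EFinP.
- by move=> t; rewrite mule_ge0 ?lee_fin//; exact: pf0.
have mhv : measurable_fun setT (fun t => (h t)%:E * (pv t)%:E)%E.
  by apply: emeasurable_funM; exact/measurable_EFinP.
apply: (@le_trans _ _ (\int[Pi]_t ((expR tau)%:E * (\1_A t)%:E +
    (expR (kap - sg * tau))%:E * ((h t)%:E * (pv t)%:E)))%E).
  apply: ge0_le_integral => //.
  - by move=> t _; rewrite mule_ge0 ?lee_fin//; exact: pf0.
  - by apply: emeasurable_funM => //; exact/measurable_EFinP.
  - by apply: emeasurable_funD; exact: emeasurable_funM.
  - by move=> t _; rewrite -!EFinM -EFinD lee_fin; exact: pointwise.
have hv0 t : (0 <= (h t)%:E * (pv t)%:E)%E by rewrite mule_ge0 ?lee_fin.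
rewrite (ge0_integralD Pi measurableT); last 4 first.
- by move=> t _; apply: mule_ge0; [rewrite lee_fin expR_ge0|exact: A0].
- exact: emeasurable_funM.
- by move=> t _; apply: mule_ge0; [rewrite lee_fin expR_ge0|exact: hv0].
- exact: emeasurable_funM.
rewrite (ge0_integralZl_EFin Pi measurableT (fun t _ => A0 t) m1A (expR_ge0 _)).
rewrite (ge0_integralZl_EFin Pi measurableT (fun t _ => hv0 t) mhv (expR_ge0 _)).
by rewrite leeD2l// EFinM lee_wpmul2l// lee_fin expR_ge0.
Qed.

End one_codeword.

Section list_code.
Context d (Y : measurableType d) (R : realType) (X : choiceType).
Local Notation meas := {measure set Y -> \bar R}.
Variables (Q : meas) (W V : X -> meas) (f v : X -> Y -> R) (z mean : X -> R).
Variables (sg : R) (n M L : nat).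
Variables (enc : 'I_M -> n.-tuple X) (dec : n.-tuple Y -> {set 'I_M}).
Let g x y := ln (f x y) - mean x.
Hypotheses (M0 : (0 < M)%N) (L0 : (0 < L)%N).
Hypotheses (dec_meas : forall m, measurable [set y | m \in dec y])
  (dec_size : forall y, (#|dec y| <= L)%N).
Hypotheses (sg0 : 0 < sg) (Q1 : Q setT = 1%E)
  (W1 : forall m x, x \in enc m -> W x setT = 1%E)
  (V1 : forall m x, x \in enc m -> V x setT = 1%E)
  (Wf : forall m x, x \in enc m -> has_dens Q (W x) (f x))
  (Vv : forall m x, x \in enc m -> has_dens Q (V x) (v x))
  (z0 : forall m x, x \in enc m -> 0 < z x)
  (fE : forall m x, x \in enc m ->
     forall y, f x y = v x y * (z x * expR (- (sg * ln (f x y)))))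
  (g3 : forall m x, x \in enc m ->
     (V x).-integrable setT (EFin \o (fun y => `|g x y| ^+ 3)))
  (g_mean : forall m x, x \in enc m -> \int[V x]_y g x y = 0).
Variables B lam K kap E : R.
Hypotheses (B0 : 0 < B) (lam0 : 0 < lam)
  (BE : forall m, \sum_(i < n) \int[V (tnth (enc m) i)]_y (`|g (tnth (enc m) i) y| ^+ 2) = B)
  (lamE : forall m, \sum_(i < n) \int[V (tnth (enc m) i)]_y (`|g (tnth (enc m) i) y| ^+ 3) = lam * B)
  (KE : forall m, \sum_(i < n) mean (tnth (enc m) i) = K)
  (kapE : forall m, \sum_(i < n) ln (z (tnth (enc m) i)) = kap)
  (EE : kap - sg * ln (M%:R / L%:R) = - ((1 + sg) * E)).

Let A m : set (n.-tuple Y) := [set y | m \in dec y].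
Let mA m : measurable (A m). Proof. exact: dec_meas. Qed.
Let G := Num.sqrt (2 * pi) / (18 / 5) * (sg^-1 + 100 / 9 * lam) / Num.sqrt B.

(** Every output lies in at most [L] of the sets [A m]. The [Q]-mass of [A m] does not involve the
    codeword, hence the auxiliary tuple over [unit]. *)
Let decoding_sets_mass : exists qm : 'I_M -> R,
  \sum_m qm m <= L%:R /\
  forall m, iprod_int [seq Q | x <- enc m] (on_seq (fun t => (\1_(A m) t)%:E)) = (qm m)%:E.
Proof.
have [Pi PiE] := @product_measure _ Y R unit (fun=> Q) n [tuple of nseq n tt] (fun _ _ => Q1).
exists (fun m => fine (Pi (A m))); split.
  rewrite -lee_fin -sumEFin.
  under eq_bigr do rewrite fineK ?fin_num_measure//.
  have iE m : Pi (A m) = (\int[Pi]_t (\1_(A m) t)%:E)%E by rewrite integral_indic// setIT.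
  under eq_bigr do rewrite iE.
  rewrite -ge0_integral_sum//; last first.
    by move=> m; apply/measurable_EFinP; exact: measurable_indic.
  apply: (@le_trans _ _ (\int[Pi]_t (cst (L%:R : R)%:E t))%E); last first.
    by rewrite integral_cst// [X in (_ * X)%E](_ : _ = 1%E) ?mule1//; exact: (probability_setT Pi).
  apply: ge0_le_integral => //.
  - by move=> t _; apply: sume_ge0 => m _; rewrite lee_fin.
  - by apply: emeasurable_sum => m; apply/measurable_EFinP; exact: measurable_indic.
  move=> t _; rewrite sumEFin lee_fin.
  have -> : \sum_m \1_(A m) t = #|dec t|%:R :> R.
    rewrite -sum1_card natr_sum [RHS]big_mkcond/=; apply: eq_bigr => m _.
    rewrite indicE; case: ifPn => mt; first by rewrite mem_set.
    by rewrite memNset//=; exact/negP.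
  by rewrite ler_nat.
move=> m; rewrite fineK ?fin_num_measure//.
have -> : [seq Q | _ <- enc m] = [seq Q | _ <- nseq n tt].
  rewrite map_nseq -[in RHS](size_tuple (enc m)).
  by elim: (tval (enc m)) => //= x s ->.
rewrite PiE//; last by apply/measurable_EFinP; exact: measurable_indic.
by rewrite integral_indic// setIT.
Qed.

Let correct_and_error : exists pm : 'I_M -> R, forall m,
  iprod_int [seq W x | x <- enc m] (on_seq (fun t => (\1_(A m) t)%:E)) = (pm m)%:E /\
  prod_chan W (enc m) [set y | m \notin dec y] = (1 - pm m)%:E.
Proof.
have h m : exists p : R,
  iprod_int [seq W x | x <- enc m] (on_seq (fun t => (\1_(A m) t)%:E)) = p%:E /\
  prod_chan W (enc m) [set y | m \notin dec y] = (1 - p)%:E.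
  have [Pi PiE] := product_measure (@W1 m).
  exists (fine (Pi (A m))); rewrite EFinB fineK ?fin_num_measure//.
  have mI (U : set (n.-tuple Y)) : measurable U ->
      iprod_int [seq W x | x <- enc m] (on_seq (fun t => (\1_U t)%:E)) = Pi U.
    move=> mU; rewrite PiE//; last by apply/measurable_EFinP; exact: measurable_indic.
    by rewrite integral_indic// setIT.
  split; first exact: mI.
  have -> : [set y | m \notin dec y] = ~` A m.
    by apply/seteqP; split => y /negP.
  rewrite -probability_setC//; apply: mI; exact: measurableC.
by have [pm pmE] := choice h; exists pm.
Qed.

(** The threshold [tau = ln (x M / L)] turns the first error term into [x], and by [EE] the second
    into [x^-sg e^(-(1 + sg) E) G]; this is the hypothesis of [balancing]. *)
Lemma list_code_error :
  ((1 - 2 * expR (1 + sg) * ((expR 1 * Num.sqrt B)^-1 *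
      ((Num.sqrt (2 * pi))^-1 + 2 * ((56 / 100) * lam)) / sg) `^ ((1 + sg)^-1) *
      expR (- E))%:E <= avg_error W enc dec)%E.
Proof.
have [qm [qmL qmE]] := decoding_sets_mass.
have [pm pmE] := correct_and_error.
have Mr : 0 < M%:R :> R by rewrite ltr0n.
have Lr : 0 < L%:R :> R by rewrite ltr0n.
pose p := M%:R^-1 * \sum_m pm m.
have -> : avg_error W enc dec = (1 - p)%:E.
  rewrite /avg_error (eq_bigr (fun m => (1 - pm m)%:E)); last by move=> m _; have [] := pmE m.
  rewrite sumEFin -EFinM sumrB sumr_const card_ord mulrBr mulVf ?gt_eqF//.
rewrite lee_fin lerD2l lerN2; apply: balancing => //; first exact: ltW.
  by rewrite sqrtr_gt0.
move=> x x0; pose tau := ln (x * (M%:R / L%:R)).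
have ML : 0 < M%:R / L%:R :> R by rewrite divr_gt0.
have tauE : expR tau = x * (M%:R / L%:R) by rewrite lnK// posrE mulr_gt0.
have pmle m : pm m <= expR tau * qm m + expR (kap - sg * tau) * G.
  have := correct_decoding_le sg0 Q1 (@W1 m) (@V1 m) (@Wf m) (@Vv m) (@z0 m) (@fE m)
    (@g3 m) (@g_mean m) B0 lam0 (BE m) (lamE m) (KE m) (kapE m) tau (dec_meas m).
  have [-> _] := pmE m; rewrite qmE.
  by rewrite -EFinM -EFinD lee_fin.
have : p <= M%:R^-1 * (expR tau * L%:R + M%:R * (expR (kap - sg * tau) * G)).
  apply: ler_wpM2l; first by rewrite invr_ge0 ltW.
  apply: (@le_trans _ _ (\sum_m (expR tau * qm m + expR (kap - sg * tau) * G))).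
    by apply: ler_sum => m _; exact: pmle.
  rewrite big_split/= sumr_const card_ord -mulr_sumr mulr_natl lerD2r.
  by rewrite ler_wpM2l ?expR_ge0.
move=> /le_trans; apply; rewrite mulrDr mulKf ?gt_eqF//.
apply: lerD.
  by rewrite tauE le_eqVlt; apply/orP; left; apply/eqP; field; rewrite !gt_eqF.
rewrite (_ : expR (kap - sg * tau) = x `^ (- sg) * expR (- ((1 + sg) * E))); last first.
  rewrite /powR gt_eqF// -expRD -EE /tau lnM ?posrE//; congr expR; ring.
by rewrite /G; rewrite le_eqVlt; apply/orP; left; apply/eqP; ring.
Qed.

End list_code.

(** * Constant composition codes *)

Section support.
Context d (Y : measurableType d) (R : realType) (X : choiceType).
Local Notation meas := {measure set Y -> \bar R}.
Variables (P : X -> R) (S : seq X).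
Hypothesis PS : is_fpmf P S.

(** The positions in this sequence form the finite index type of the preceding sections, with
    strictly positive weights. *)
Definition pmf_support := [seq x <- S | 0 < P x].
Definition support_letter (i : 'I_(size pmf_support)) : X := tnth (in_tuple pmf_support) i.
Local Notation letter := support_letter.

Lemma support_letter_gt0 i : 0 < P (letter i).
Proof. by have := mem_tnth i (in_tuple pmf_support); rewrite mem_filter => /andP[]. Qed.

Lemma support_letterP x : 0 < P x -> exists i, x = letter i.
Proof.
move=> Px; have [_ PS0 _ _] := PS.
have : x \in in_tuple pmf_support.
  rewrite mem_filter Px /=; apply: contraTT Px => /PS0 ->.
  by rewrite ltxx.
by move=> /tnthP[i ->]; exists i.
Qed.

(* Letters outside the support contribute [0 * F x = 0], even if [F x] is infinite. *)
Lemma sum_support (F : X -> \bar R) :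
  (\sum_(x <- S) (P x)%:E * F x = \sum_i (P (letter i))%:E * F (letter i))%E.
Proof.
have [_ _ P_ge0 _] := PS.
rewrite (bigID (fun x => 0 < P x))/= [X in (_ + X)%E]big1 ?adde0; last first.
  move=> x; rewrite -leNgt => Px.
  by rewrite (_ : P x = 0) ?mul0e//; apply/eqP; rewrite eq_le Px P_ge0.
by rewrite -big_filter -/pmf_support big_tnth.
Qed.

Lemma sum_support_real (F : X -> R) :
  \sum_(x <- S) P x * F x = \sum_i P (letter i) * F (letter i).
Proof.
have := sum_support (EFin \o F).
rewrite /=; under eq_bigr do rewrite -EFinM; under [RHS]eq_bigr do rewrite -EFinM.
by rewrite !sumEFin => -[].
Qed.

Lemma sum_support1 : \sum_i P (letter i) = 1.
Proof.
have [_ _ _ <-] := PS; have := sum_support_real (cst 1).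
by rewrite /=; under eq_bigr do rewrite mulr1; under [RHS]eq_bigr do rewrite mulr1.
Qed.

Local Notation p := (fun i => P (letter i)).

Lemma renyi_cond_support a (V : X -> meas) Q :
  renyi_cond a V Q P S = cond_renyi p a (fun i => V (letter i)) Q.
Proof. exact: sum_support. Qed.

Lemma augustin_info_support a (V : X -> meas) :
  augustin_info a V P S = augustin p a (fun i => V (letter i)).
Proof.
congr ereal_inf; apply/seteqP; split => _ [Q _ <-]; exists Q => //.
  by rewrite renyi_cond_support.
by rewrite renyi_cond_support.
Qed.

Lemma composition_support n (x : n.-tuple X) z : has_composition x P -> z \in x -> 0 < P z.
Proof.
move=> -> zx; have n0 : (0 < n)%N by rewrite -(size_tuple x) -has_predT; apply/hasP; exists z.
by rewrite divr_gt0 ?ltr0n// -has_count has_pred1.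
Qed.

(** Letter sums along a codeword depend on its composition only, so variance, third moment, mean and
    normalisation are the same for all messages. *)
Lemma sum_composition n (x : n.-tuple X) (F : X -> R) : (0 < n)%N -> has_composition x P ->
  \sum_(i < n) F (tnth x i) = n%:R * \sum_(z <- S) P z * F z.
Proof.
move=> n0 xP; have [uS S0 _ _] := PS.
rewrite -(big_tuple _ _ x xpredT F) mulr_sumr.
have {1}-> : \sum_(y <- x) F y = \sum_(y <- x) \sum_(z <- S) (y == z)%:R * F z.
  apply: eq_big_seq => y yx.
  have yS : y \in S.
    by apply: contraTT (composition_support xP yx) => /S0 ->; rewrite ltxx.
  rewrite (bigD1_seq y)//= eqxx mul1r big1 ?addr0// => z.
  by rewrite eq_sym => /negbTE ->; rewrite mul0r.
rewrite exchange_big; apply: eq_bigr => z _ /=.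
rewrite -mulr_suml mulrA xP mulrCA mulfV ?mulr1; last by rewrite pnatr_eq0 -lt0n.
rewrite -natr_sum; congr (_%:R * _).
by rewrite -sum1_count [RHS]big_mkcond.
Qed.

End support.

(** * Finiteness of the exponent and its form as a convex conjugate *)

Section strong_converse.
Context d (Y : measurableType d) (R : realType) (I : finType) (p : I -> R).
Local Notation meas := {measure set Y -> \bar R}.
Hypotheses (p0 : forall i, 0 < p i) (p1 : \sum_i p i = 1).
Variables (W : I -> meas) (r0 : R).
Hypothesis W1 : forall i, W i setT = 1%E.
Hypothesis rate_gt : (augustin p 1 W < r0%:E)%E.
Let g x := x * fine (augustin p (1 - x)^-1 W).
Implicit Types (a r u x : R).

Lemma augustin_fin a : 1 < a -> augustin p a W = (fine (augustin p a W))%:E /\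
  0 <= fine (augustin p a W).
Proof.
move=> a1; have oo := augustin_lty p0 p1 W1 rate_gt a1.
have a0 : (0 <= augustin p a W)%E.
  apply/ereal_infP => _ [Q _ <-].
  exact: (cond_renyi_ge0 p0 (ltW a1) W1 (probability_setT Q)).
by rewrite fineK ?ge0_fin_numE//; split => //; exact: fine_ge0.
Qed.

Let e r := fine (ereal_sup [set ((1 - a) / a)%:E * (augustin p a W - r%:E)
            | a in `]1%R, +oo[%classic])%E.

Let order x : 0 < x < 1 -> 1 < (1 - x)^-1.
Proof. by move=> /andP[x0 x1]; rewrite invf_gt1 ?subr_gt0// gtrBl. Qed.

Let termE r x : 0 < x < 1 -> (((1 - (1 - x)^-1) / (1 - x)^-1)%:E *
  (augustin p (1 - x)^-1 W - r%:E) = (x * r - g x)%:E)%E.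
Proof.
move=> x01; rewrite (augustin_fin (order x01)).1 -EFinB -EFinM /g; congr EFin.
move: x01 => /andP[_ x1]; field.
by rewrite subr_eq0 gt_eqF.
Qed.

Let supE r u : (forall x, 0 < x < 1 -> x * r - g x <= u) ->
  (ereal_sup [set ((1 - a) / a)%:E * (augustin p a W - r%:E)
            | a in `]1%R, +oo[%classic] <= u%:E)%E.
Proof.
move=> H; apply/ereal_supP => _ [a /= + <-]; rewrite in_itv/= andbT => a1.
have a0 : 0 < a by lra.
have x01 : 0 < 1 - a^-1 < 1.
  by rewrite subr_gt0 invf_lt1// a1 gtrBl invr_gt0.
have aE : a = (1 - (1 - a^-1))^-1 by rewrite (_ : 1 - (1 - a^-1) = a^-1) ?invrK//; ring.
by rewrite {1 2 3}aE termE// lee_fin H.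
Qed.

(** Bounded below by the term at [rho = 1 / 2], and above by [|r|] because [g] is nonnegative. *)
Let strong_converse_fin r : ereal_sup [set ((1 - a) / a)%:E * (augustin p a W - r%:E)
            | a in `]1%R, +oo[%classic]%E = (e r)%:E.
Proof.
rewrite /e fineK// fin_numE; apply/andP; split.
  have h : 0 < (2^-1 : R) < 1 by apply/andP; split; lra.
  rewrite gt_eqF// (@lt_le_trans _ _ (2^-1 * r - g 2^-1)%:E) ?ltNyr//.
  apply: ereal_sup_ubound; rewrite -termE//.
  by exists (1 - 2^-1)^-1 => //=; rewrite in_itv/= andbT; exact: order.
rewrite lt_eqF// (@le_lt_trans _ _ `|r|%R%:E) ?ltry//; apply: supE => x x01.
have := (augustin_fin (order x01)).2; move: (x01) => /andP[x0 x1] h.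
have : 0 <= g x by rewrite /g mulr_ge0// ltW.
have := ler_norm r; have : 0 <= `|r| by [].
by move: `|r| (g x) => u w; nra.
Qed.

Lemma strong_converse_ub r x : 0 < x < 1 -> x * r - g x <= e r.
Proof.
move=> x01; rewrite -lee_fin -(strong_converse_fin r) -termE//.
apply: ereal_sup_ubound; exists (1 - x)^-1 => //=.
by rewrite in_itv/= andbT; exact: order.
Qed.

Lemma strong_converse_lub r u : (forall x, 0 < x < 1 -> x * r - g x <= u) -> e r <= u.
Proof. by move=> H; rewrite -lee_fin -(strong_converse_fin r); exact: supE. Qed.

End strong_converse.

(** * The error bound for constant composition codes *)

Section list_bound.
Context (R : realType) d (Y : measurableType d) (X : choiceType).
Local Notation meas := {measure set Y -> \bar R}.
Variables (W : X -> probability Y R) (M L n : nat) (P : X -> R) (S : seq X).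
Variables (a : R) (qs : probability Y R) (e : R).
Let Wm x : meas := W x.
Let Rt : R := ln (M%:R / L%:R) / n%:R.
Hypotheses (M0 : (0 < M)%N) (L0 : (0 < L)%N) (n0 : (0 < n)%N) (PS : is_fpmf P S).
Hypotheses (a1 : 1 < a) (q_mean : is_augustin_mean a Wm P S qs)
  (aug_lty : (augustin_info a Wm P S < +oo)%E)
  (eE : e = (a - 1) / a * (Rt - fine (augustin_info a Wm P S))).

Let V x : meas := tilted a (W x) qs.
Let ell x y := ln (fine (ac_dens (W x) qs y)).
Let mom k x := (\int[V x]_y ((`| ell x y - fine (\int[V x]_z (ell x z)%:E) | ^+ k)%:E))%E.
Let a2 := fine (\sum_(x <- S) (P x)%:E * mom 2%N x)%E.
Let a3 := fine (\sum_(x <- S) (P x)%:E * mom 3%N x)%E.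
Let delta := (expR 1 * Num.sqrt a2)^-1 * ((Num.sqrt (2 * pi))^-1 + 2 * ((56 / 100) * a3 / a2)).
Hypothesis ell3 : forall x, 0 < P x ->
  (V x).-integrable setT (fun y => (`| ell x y | ^+ 3)%:E).
Hypothesis a2_gt0 : 0 < a2.

Let I := 'I_(size (pmf_support P S)).
Let letter : I -> X := @support_letter R X P S.
Let p i := P (letter i).
Let f x y := fine (ac_dens (W x) qs y).
Let z x := \int[qs]_y (f x y `^ a).
Let v x y := (z x)^-1 * f x y `^ a.
Let mean x := fine (\int[V x]_y (ell x y)%:E)%E.
Let g x y := ell x y - mean x.
Let s2 x := \int[V x]_y (`|g x y| ^+ 2).
Let s3 x := \int[V x]_y (`|g x y| ^+ 3).

Let W1 (i : I) : Wm (letter i) setT = 1%E. Proof. exact: probability_setT. Qed.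
Let p0 (i : I) : 0 < p i. Proof. exact: support_letter_gt0. Qed.
Let p1 : \sum_i p i = 1. Proof. exact: sum_support1. Qed.

Let mean_support : cond_renyi p a (fun i => Wm (letter i)) qs =
  augustin p a (fun i => Wm (letter i)).
Proof. by rewrite -(renyi_cond_support PS) q_mean (augustin_info_support PS). Qed.

Let lty_support : (augustin p a (fun i => Wm (letter i)) < +oo)%E.
Proof. by rewrite -(augustin_info_support PS). Qed.

Let letterP x : 0 < P x -> exists i, x = letter i.
Proof. exact: support_letterP. Qed.

Let Wf x : 0 < P x -> has_dens qs (Wm x) (f x).
Proof. by move=> /letterP[i ->]; exact: (augustin_mean_has_dens p0 W1 a1 mean_support lty_support i). Qed.

Let Vv x : 0 < P x -> has_dens qs (V x) (v x).
Proof. by move=> /letterP[i ->]; exact: (tilted_channel_has_dens p0 W1 a1 mean_support lty_support i). Qed.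

Let V1 x : 0 < P x -> V x setT = 1%E.
Proof. by move=> /letterP[i ->]; exact: (tilted_channel_setT p0 W1 a1 mean_support lty_support i). Qed.

Let z1 x : 0 < P x -> 1 <= z x.
Proof. by move=> /letterP[i ->]; exact: (augustin_normalization_ge1 p0 W1 a1 mean_support lty_support i). Qed.

Let z0 x : 0 < P x -> 0 < z x.
Proof. by move=> /z1; exact: lt_le_trans. Qed.

(** Where [f] vanishes so does [v], which makes the identity independent of the value of [ln 0]. *)
Let fE x : 0 < P x -> forall y, f x y = v x y * (z x * expR (- ((a - 1) * ln (f x y)))).
Proof.
move=> Px y; rewrite /v mulrACA mulVf ?gt_eqF ?z0// mul1r.
have := has_dens_ge0 (Wf Px) y; rewrite le_eqVlt => /predU1P[<-|f0].
  by rewrite powR0 ?mul0r// gt_eqF// (lt_trans ltr01).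
rewrite /powR gt_eqF// -expRD (_ : _ + _ = ln (f x y)); last by ring.
by rewrite lnK.
Qed.

Let mell x : 0 < P x -> measurable_fun setT (ell x).
Proof. by move=> Px; apply: measurable_ln_comp; exact: has_dens_measurable (Wf Px). Qed.

Let mg x : 0 < P x -> measurable_fun setT (g x).
Proof. by move=> Px; apply: measurable_funB => //; exact: mell. Qed.

Let g3 x : 0 < P x -> (V x).-integrable setT (EFin \o (fun y => `|g x y| ^+ 3)).
Proof. by move=> Px; exact: (integrable_cube_shift (V1 Px) (mell Px) (ell3 Px)). Qed.

Let g_mean x : 0 < P x -> \int[V x]_y g x y = 0.
Proof.
move=> Px; have j := integrable_cube1 (V1 Px) (mell Px) (ell3 Px).
rewrite (RintegralB measurableT j (prob_integrable_cst (V1 Px) (mean x))).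
by rewrite Rintegral_prob_cst ?V1// /mean subrr.
Qed.

Let momE : a2 = \sum_(x <- S) P x * s2 x /\ a3 = \sum_(x <- S) P x * s3 x.
Proof.
have fin (h : X -> Y -> R) : (forall x, 0 < P x -> (V x).-integrable setT (EFin \o h x)) ->
    fine (\sum_(x <- S) (P x)%:E * \int[V x]_y (h x y)%:E)%E =
    \sum_(x <- S) P x * \int[V x]_y h x y.
  move=> jh; rewrite (sum_support PS) (sum_support_real PS).
  rewrite -[RHS]/(fine (_ %:E)) -sumEFin; congr fine; apply: eq_bigr => i _.
  rewrite EFinM fineK//; apply: (integrable_fin_num measurableT).
  exact: (jh _ (p0 i)).
split; apply: (fin (fun x y => `|g x y| ^+ _)) => x Px; last exact: g3.
exact: (integrable_cube2 (V1 Px) (mg Px) (g3 Px)).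
Qed.

Let a3_gt0 : 0 < a3.
Proof.
(* With [t^2 = a2 / 2] the bound [a2 <= t^2 + a3 / t] leaves [a3 / t >= a2 / 2 > 0]. *)
pose t := Num.sqrt (a2 / 2).
have t0 : 0 < t by rewrite sqrtr_gt0 divr_gt0.
have : a2 <= t ^+ 2 + a3 / t.
  rewrite momE.1 momE.2 !(sum_support_real PS) -[t ^+ 2]mul1r -p1 !mulr_suml -big_split.
  apply: ler_sum => i _ /=; rewrite -mulrA -mulrDr ler_wpM2l ?(ltW (p0 i))//.
  exact: (second_moment_le_cube (V1 (p0 i)) (mg (p0 i)) (g3 (p0 i))).
rewrite sqr_sqrtr; last by rewrite divr_ge0// ltW.
move=> h; have : 0 < a3 / t by have := a2_gt0; lra.
by rewrite pmulr_lgt0// invr_gt0.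
Qed.

Let infoE : fine (augustin_info a Wm P S) = (a - 1)^-1 * \sum_(x <- S) P x * ln (z x).
Proof.
rewrite (augustin_info_support PS) (augustin_infoE p0 W1 a1 mean_support lty_support)/=.
by rewrite (sum_support_real PS).
Qed.

Lemma constant_composition_error (enc : 'I_M -> n.-tuple X) (dec : n.-tuple Y -> {set 'I_M}) :
  (forall m, measurable [set y | m \in dec y]) ->
  (forall y, (#|dec y| <= L)%N) ->
  (forall m, has_composition (enc m) P) ->
  ((1 - 2 * expR a * (delta / (a - 1)) `^ (a^-1)
       * (n%:R `^ (- (2 * a)^-1)) * expR (- (n%:R * e)))%:E
    <= avg_error Wm enc dec)%E.
Proof.
move=> dec_meas dec_size encP.
have Px m x : x \in enc m -> 0 < P x by exact: composition_support.
have nr : 0 < n%:R :> R by rewrite ltr0n.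
have an : a - 1 != 0 by rewrite subr_eq0 gt_eqF.
have sumE (F : X -> R) m : \sum_(i < n) F (tnth (enc m) i) = n%:R * \sum_(x <- S) P x * F x.
  exact: sum_composition.
have B0 : 0 < n%:R * a2 by rewrite mulr_gt0.
have lam0 : 0 < a3 / a2 by rewrite divr_gt0.
have := @list_code_error _ Y R X qs Wm V f v z mean (a - 1) n M L enc dec M0 L0
  dec_meas dec_size _ (probability_setT qs) (fun m x _ => probability_setT (W x))
  (fun m x xm => V1 (Px m x xm)) (fun m x xm => Wf (Px m x xm))
  (fun m x xm => Vv (Px m x xm)) (fun m x xm => z0 (Px m x xm))
  (fun m x xm => fE (Px m x xm)) (fun m x xm => g3 (Px m x xm))
  (fun m x xm => g_mean (Px m x xm)) (n%:R * a2) (a3 / a2)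
  (n%:R * \sum_(x <- S) P x * mean x) (n%:R * \sum_(x <- S) P x * ln (z x)) (n%:R * e)
  B0 lam0 _ _ (sumE mean) (sumE (fun x => ln (z x))) _.
rewrite subr_gt0 => /(_ a1).
have -> : 1 + (a - 1) = a by ring.
have BE m : \sum_(i < n) s2 (tnth (enc m) i) = n%:R * a2 by rewrite sumE momE.1.
have CE m : \sum_(i < n) s3 (tnth (enc m) i) = a3 / a2 * (n%:R * a2).
  by rewrite sumE momE.2; field; rewrite gt_eqF.
(* Since [sum_x P(x) ln z_x = (a - 1) I_a], the left side is [- n (a - 1) (Rt - I_a)], that is
   [- a n e]. *)
have EE : n%:R * (\sum_(x <- S) P x * ln (z x)) - (a - 1) * ln (M%:R / L%:R) =
    - (a * (n%:R * e)).
  rewrite eE infoE (_ : ln (M%:R / L%:R) = n%:R * Rt); last first.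
    by rewrite /Rt [RHS]mulrC divfK// gt_eqF.
  move: (\sum_(x <- S) _) Rt => w r; field.
  by rewrite an gt_eqF// (lt_trans ltr01).
move=> /(_ BE CE EE) /(le_trans _); apply; rewrite lee_fin le_eqVlt; apply/orP; left.
apply/eqP; congr (1 - _ * _); rewrite -mulrA; congr (_ * _).
have delta0 : 0 <= delta / (a - 1).
  rewrite divr_ge0 ?subr_ge0 ?(ltW a1)// mulr_ge0 ?invr_ge0 ?mulr_ge0 ?expR_ge0 ?sqrtr_ge0//.
  by rewrite addr_ge0 ?invr_ge0 ?sqrtr_ge0// mulr_ge0// divr_ge0 ?(ltW a2_gt0)// mulr_ge0// ltW.
(* The total variance is [n a2]; its factor [n^(-1/2)], raised to the power [1 / a], is the
   polynomial prefactor, while the ratio [a3 / a2] is free of [n]. *)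
have -> : (expR 1 * Num.sqrt (n%:R * a2))^-1 * ((Num.sqrt (2 * pi))^-1 + 2 * (56 / 100 * (a3 / a2))) /
    (a - 1) = delta / (a - 1) * n%:R `^ (- 2^-1).
  rewrite powRN powR12_sqrt ?(ltW nr)// sqrtrM ?(ltW nr)// /delta !invfM -[_ * a3 / a2]mulrA.
  move: (Num.sqrt n%:R)^-1 (Num.sqrt a2)^-1 (expR 1)^-1 (_ + _) (a - 1)^-1 => x1 x2 x3 x4 x5.
  ring.
rewrite [in RHS]powRM ?powR_ge0// -powRrM; congr (_ * _ `^ _); field.
by rewrite gt_eqF// (lt_trans ltr01).
Qed.

End list_bound.

Theorem theorem1 (R : realType) (d : measure_display) (Y : measurableType d)
  (X : choiceType) (W : X -> probability Y R) (M L n : nat)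
  (P : X -> R) (S : seq X) (q : R -> probability Y R) :
  let Wm := fun x => (W x : {measure set Y -> \bar R}) in
  (0 < M)%N -> (0 < L)%N -> (0 < n)%N ->
  is_fpmf P S ->
  (forall x, exists k : nat, n%:R * P x = k%:R) ->
  (* q a is the Augustin mean q_{a,P} of order a *)
  (forall a, 0 < a -> is_augustin_mean a Wm P S (q a)) ->
  let Rt := ln (M%:R / L%:R) / n%:R in
  (* tilted channel x |-> W_a^{q_{a,P}}(x) *)
  let Vt := fun a x => tilted a (W x) (q a) in
  (augustin_info 1 Wm P S < Rt%:E)%E ->
  (exists l : \bar R,
      (fun a => augustin_info 1 (Vt a) P S) x @[x --> +oo] --> l
      /\ (Rt%:E < l)%E) ->
  let Esc_P := fun r => fine (Esc Wm P S r) in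
  let astar := (1 - derive1 Esc_P Rt)^-1 in
  [/\ derivable Esc_P Rt 1, 1 < astar,
      augustin_info 1 (Vt astar) P S = Rt%:E &
      let V := Vt astar in
      let qs := q astar in
      let ell := fun x y => ln (fine (ac_dens (W x) qs y)) in
      let mom := fun k x =>
        (\int[V x]_y ((`| ell x y - fine (\int[V x]_z (ell x z)%:E) | ^+ k)%:E))%E in
      let a2 := fine (\sum_(x <- S) (P x)%:E * mom 2%N x)%E in
      let a3 := fine (\sum_(x <- S) (P x)%:E * mom 3%N x)%E in
      let delta := (expR 1 * Num.sqrt a2)^-1 *
                   ((Num.sqrt (2 * pi))^-1 + 2 * ((56 / 100) * a3 / a2)) in
      (forall x, 0 < P x ->
         (V x).-integrable setT (fun y => (`| ell x y | ^+ 3)%:E)) ->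
      0 < a2 ->
      forall (enc : 'I_M -> n.-tuple X) (dec : n.-tuple Y -> {set 'I_M}),
        (forall m, measurable [set y | m \in dec y]) ->
        (forall y, (#|dec y| <= L)%N) ->
        (forall m, has_composition (enc m) P) ->
        ((1 - 2 * expR astar * (delta / (astar - 1)) `^ (astar^-1)
             * (n%:R `^ (- (2 * astar)^-1)) * expR (- (n%:R * Esc_P Rt)))%:E
          <= avg_error Wm enc dec)%E].
Proof.
move=> Wm M0 L0 n0 PS _ qmean Rt Vt rate_gt [l [Fl Rl]] Esc_P astar.
pose letter := @support_letter R X P S.
pose W' i := Wm (letter i).
pose p i := P (letter i).
have p0 i : 0 < p i by exact: support_letter_gt0.
have p1 : \sum_i p i = 1 by exact: sum_support1.
have W1 i : W' i setT = 1%E by exact: probability_setT.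
have augE a (V : X -> {measure set Y -> \bar R}) : augustin_info a V P S =
    augustin p a (fun i => V (letter i)) by exact: augustin_info_support.
have qm a : 1 < a -> cond_renyi p a W' (q a) = augustin p a W'.
  move=> a1; rewrite -[RHS](augE a Wm) -(qmean a (lt_trans ltr01 a1)).
  by rewrite (renyi_cond_support PS).
have rg : (augustin p 1 W' < Rt%:E)%E by rewrite -(augE 1 Wm).
(* The limit at infinity exceeds the rate, hence so does the value at some finite order above
   one. *)
have rl : exists2 a, 1 < a & (Rt%:E < augustin p 1 (fun i => tilted a (W' i) (q a)))%E.
  have [a [a1 aR]] : exists a, 1 < a /\ (Rt%:E < augustin_info 1 (Vt a) P S)%E.
    have Rn : nbhs l [set y | (Rt%:E < y)%E]. by exact: open_ereal_gt'.
    have h1 : \forall a \near +oo%R, (1 : R) < a by exact: nbhs_pinfty_gt.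
    by have [a []] := filter_ex (filterI h1 (Fl _ Rn)); exists a.
  by exists a => //; rewrite -(augE 1 (Vt a)).
have EscE r : Esc_P r = fine (ereal_sup [set ((1 - a) / a)%:E * (augustin p a W' - r%:E)
    | a in `]1%R, +oo[%classic])%E.
  congr (fine (ereal_sup _)); apply/seteqP; split => _ [a a1 <-]; exists a => //.
    by rewrite -(augE a Wm).
  by rewrite -(augE a Wm).
have ub r x : 0 < x < 1 -> x * r - x * fine (augustin p (1 - x)^-1 W') <= Esc_P r.
  by move=> x01; rewrite EscE; exact: (strong_converse_ub p0 p1 W1 rg).
have lub r u : (forall x, 0 < x < 1 -> x * r - x * fine (augustin p (1 - x)^-1 W') <= u) ->
    Esc_P r <= u.
  by move=> H; rewrite EscE; exact: (strong_converse_lub p0 p1 W1 rg).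
have [x [/andP[x0 x1] J eE eder eder1]] := augustin_legendre p0 p1 W1 qm rg rl ub lub.
have astarE : astar = (1 - x)^-1 by rewrite /astar eder1.
have a1 : 1 < astar by rewrite astarE invf_gt1 ?subr_gt0// gtrBl.
have xE : x = (astar - 1) / astar by rewrite astarE; field; rewrite subr_eq0 gt_eqF.
split => //; first by rewrite augE astarE.
move=> V qs ell mom a2 a3 delta ell3 a20 enc dec dec_meas dec_size encP.
apply: (constant_composition_error (P := P) (S := S) M0 L0 n0 PS a1) => //.
- exact: qmean (lt_trans ltr01 a1).
- by rewrite augE; exact: (augustin_lty p0 p1 W1 rg).
- by rewrite eE augE -astarE -mulrBr {1}xE.
Qed.
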